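(* Let $\mathcal T$ be a finite set of positive lags and let $Q$ be the test statistic for volatility clustering, $$Q=\frac n4\sum_{\tau\in\mathcal T}\left(\sum_{t=1}^{n-\tau}\frac{x_t^2x_{t+\tau}^2}{n-\tau}-1\right)^2,$$ computed from a univariate series $x_1,\dots,x_n$ which is standardized to have zero mean and unit variance. Under the null hypothesis that $x_1,\dots,x_n$ are iid Gaussian, the limiting distribution of $Q$ as $n\to\infty$ is the chi-squared distribution with $|\mathcal T|$ degrees of freedom.
   Context: Standardization refers to the observed series: from the raw observations $y_1,\dots,y_n$ (iid Gaussian under the null hypothesis) one forms $x_t=(y_t-\bar y)/s$, where $\bar y$ and $s^2$ are the sample mean and sample variance of $y_1,\dots,y_n$. *)

(* Defs.v *)
From HB Require Import structures.
From mathcomp Require Import all_boot all_order all_algebra finmap.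
From mathcomp Require Import all_classical all_reals all_analysis.
From mathcomp Require Import measurable_realfun.

Set Implicit Arguments.
Unset Strict Implicit.
Unset Printing Implicit Defensive.

Import Order.TTheory GRing.Theory Num.Theory.
Import numFieldNormedType.Exports.

Local Open Scope classical_set_scope.
Local Open Scope ring_scope.

(* A series is indexed from 0: the observations y_1, ..., y_n are
   y 0, ..., y n.-1, and the values of y from index n on are ignored. *)
Section series.
Context {R : realType}.
Implicit Types (x y : nat -> R) (n : nat).

Definition sample_mean n y : R := (\sum_(t < n) y t) / n%:R.

(* [bessel] selects the divisor: n - 1 if it is true, n if it is false. *)
Definition sample_variance (bessel : bool) n y : R :=
  (\sum_(t < n) (y t - sample_mean n y) ^+ 2) / (n - bessel)%:R.

Definition standardize (bessel : bool) n y : nat -> R :=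
  fun t => (y t - sample_mean n y) / Num.sqrt (sample_variance bessel n y).

(* For n <= tau the inner sum is empty and its divisor is 0; this is irrelevant
   as n tends to infinity. *)
Definition vol_clustering_stat (Tau : {fset nat}) n x : R :=
  n%:R / 4 *
  \sum_(tau <- Tau)
     ((\sum_(t < n - tau) x t ^+ 2 * x (t + tau)%N ^+ 2 / (n - tau)%:R) - 1) ^+ 2.

End series.

Section random_variables.
Context d (T : measurableType d) (R : realType) (P : probability T R).
Implicit Type y : nat -> {RV P >-> R}.

Definition mutually_independent y : Prop :=
  forall (J : {fset nat}) (A : nat -> set R), (forall i, measurable (A i)) ->
    P (\bigcap_(i in [set` J]) (y i @^-1` A i)) =
    (\prod_(i <- J) P (y i @^-1` A i))%E.

(* [sigma] is the standard deviation. Laws are compared on measurable sets only: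
   on other sets both sides take junk values. *)
Definition iid_gaussian (mu sigma : R) y : Prop :=
  mutually_independent y /\
  forall t A, measurable A -> distribution P (y t) A = normal_prob mu sigma A.

Definition vol_clustering_Q (bessel : bool) (Tau : {fset nat}) y (n : nat)
    (w : T) : R :=
  vol_clustering_stat Tau n (standardize bessel n (fun t => y t w)).

Lemma measurable_vol_clustering_Q bessel Tau y n :
  measurable_fun [set: T] (vol_clustering_Q bessel Tau y n).
Proof.
have mmean : measurable_fun [set: T] (fun w => sample_mean n (fun t => y t w)).
  apply: measurable_funM => //; apply: measurable_sum => i.
  exact: measurable_funPT.
have mvar : measurable_fun [set: T]
    (fun w => sample_variance bessel n (fun t => y t w)).
  apply: measurable_funM => //; apply: measurable_sum => i.
  apply: measurable_funX; apply: measurable_funB => //.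
have var_ge0 w : 0 <= sample_variance bessel n (fun t => y t w).
  by apply: divr_ge0 => //; apply: sumr_ge0 => i _; exact: sqr_ge0.
have mstd t : measurable_fun [set: T]
    (fun w => standardize bessel n (fun t => y t w) t).
  apply: measurable_funM; first exact: measurable_funB.
  rewrite (_ : (fun w => _) =
    (fun w => sample_variance bessel n (fun t => y t w) `^ (- 2^-1))).
    exact: (measurableT_comp (measurable_powR _)).
  by apply/funext => w; rewrite powRN powR12_sqrt.
apply: measurable_funM => //; apply: measurable_sum => tau.
apply: measurable_funX; apply: measurable_funB => //.
apply: measurable_sum => t; apply: measurable_funM => //.
by apply: measurable_funM; exact: measurable_funX.
Qed.

HB.instance Definition _ bessel Tau y n :=
  isMeasurableFun.Build _ _ _ _ (vol_clustering_Q bessel Tau y n)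
    (measurable_vol_clustering_Q bessel Tau y n).

Definition cvg_in_law (X : nat -> {RV P >-> R}) (nu : probability R R) : Prop :=
  forall r : R, {for r, continuous (fun s : R => nu `]-oo, s]%classic)} ->
    (fun n => cdf (X n) r) @ \oo --> nu `]-oo, r]%classic.

End random_variables.

Section chi_squared.
Context {R : realType}.

(* [measurableTypeR R] is R with the Borel sigma-algebra, on which [normal_prob]
   is defined. *)
Definition add_sqr (z : R * measurableTypeR R) : R := z.1 + (z.2 : R) ^+ 2.

Lemma measurable_add_sqr : measurable_fun [set: R * measurableTypeR R] add_sqr.
Proof.
apply: measurable_funD; first exact: measurable_fst.
by apply: measurable_funX; exact: measurable_snd.
Qed.

HB.instance Definition _ :=
  isMeasurableFun.Build _ _ _ _ add_sqr measurable_add_sqr.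

(* The law of Z_1 ^ 2 + ... + Z_k ^ 2 for independent standard normal Z_i; it is
   the Dirac mass at 0 if k = 0. *)
Fixpoint chi_squared (k : nat) : probability R R :=
  if k is k'.+1 then
    distribution (chi_squared k' \x normal_prob 0 1)%E add_sqr
  else \d_(0 : R).

End chi_squared.

(* Main.v *)
Require Import Defs.
From mathcomp Require Import all_boot all_order all_algebra finmap.
From mathcomp Require Import all_classical all_reals all_analysis.
From mathcomp Require Import measurable_realfun.
From mathcomp Require Import ring lra zify.
Set Implicit Arguments.
Unset Strict Implicit.
Unset Printing Implicit Defensive.
Import Order.TTheory GRing.Theory Num.Theory.
Import numFieldNormedType.Exports.
Local Open Scope classical_set_scope.
Local Open Scope ring_scope.

(** Write z_t for the standardized Gaussian variables (y_t - mu) / sigma and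
    u_t = z_t ^ 2 - 1, which are independent with mean 0 and variance 2.  The
    proof compares Q with the sum over the lags of S_tau ^ 2, where
        S_tau = (2 sqrt n)^-1 sum_i u_i u_(i - tau),
    and shows that the vector of the S_tau is asymptotically standard normal.

    Standardization is harmless ([lag_summand_approx]).  Up to a factor tending
    to 1, the summand of Q at tau is the square of half of sqrt n (A - v ^ 2),
    where A is the average of the products (z_t - zbar)^2 (z_(t+tau) - zbar)^2
    and v is the sample variance.  In the expansion [scaled_deviation_expand] the
    sample mean zbar, of order n^(-1/2), only multiplies normalized sums that are
    bounded in probability; the linear terms sum u_t and sum u_(t+tau) of A are
    cancelled by those of v ^ 2 except for at most tau boundary terms each; what
    remains is sum u_t u_(t+tau).  The bounds in probability all come from the
    orthogonality of the terms of these sums ([orthogonal_sum_L2]).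

    The limit of the S_tau is only needed through the Laplace transform of the
    sum of their squares, that is, for the test functions exp(-l |x|^2)
    ([lindeberg_clt]).  This family is stable under convolution with an isotropic
    Gaussian law: it only changes l and multiplies by a constant.  So adding
    one term to the sums can be compared with one step of this explicit heat flow
    ([gauss_flow_step]), and the steps telescope to the product
    (1 + 2 l)^(- #|Tau| / 2) with an error of order n^(-1/2) ([lindeberg_bound]).
    The covariance of the new term given the past is random, being a product of
    two recent values of u; since it is independent of the sums deprived of their
    last few terms, it may be replaced by its mean ([decorrelation]).

    Hence the expectation of exp(- j Q) tends to the Laplace transform of the
    chi-squared law at j, for each natural number j.  These are the moments of
    exp(- Q), which lies in [0, 1], so Bernstein polynomials extend the
    convergence to Lipschitz functions of exp(- Q), and a sandwich between
    piecewise linear functions gives the distribution functions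
    ([moments_cvg_cdf]). *)

(** * Elementary sums and limits *)

Section elementary.
Context {R : realType}.

Lemma invn_cvg0 : (n%:R : R)^-1 @[n --> \oo] --> (0 : R).
Proof.
apply/gtr0_cvgV0; last exact: cvgr_idn.
by apply: filterS (nbhs_infty_gt 0) => n n0; rewrite ltr0n.
Qed.

Lemma sqrtV_cvg0 : (Num.sqrt n%:R)^-1 @[n --> \oo] --> (0 : R).
Proof.
under eq_fun do rewrite -sqrtrV //.
rewrite -(@sqrtr0 R); apply: continuous_cvg; last exact: invn_cvg0.
exact: sqrt_continuous.
Qed.

Lemma ratio_cvg (c : nat) : n%:R / (n - c)%:R @[n --> \oo] --> (1 : R).
Proof.
rewrite -(@cvg_shiftn c _ (fun n : nat => n%:R / (n - c)%:R : R)).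
have h : ((n + c)%N%:R / (n + c - c)%N%:R : R) @[n --> \oo] --> (1 : R).
  apply: (@cvg_trans _ ((1 + c%:R * n%:R^-1 : R) @[n --> \oo])).
    apply: near_eq_cvg; apply: filterS (nbhs_infty_gt 0) => n n0.
    by rewrite addnK natrD mulrDl divff // pnatr_eq0 -lt0n.
  have e : (1 : R) + c%:R * 0 = 1 by rewrite mulr0 addr0.
  suff h : (1 + c%:R / n%:R : R) @[n --> \oo] --> (1 + c%:R * 0 : R) by rewrite e in h.
  apply: cvgD; first exact: cvg_cst.
  apply: cvgMl_tmp; exact: invn_cvg0.
exact: h.
Qed.

Lemma big_shift (F : nat -> R) a b :
  \sum_(a <= i < b) F i = \sum_(0 <= i < b - a) F (i + a)%N.
Proof. by rewrite -[X in \sum_(X <= _ < _) _](add0n a) big_addn. Qed.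

Lemma sum_quadratic (f g : nat -> R) (c : R) n :
  \sum_(0 <= t < n) (1 + f t - 2 * c * g t + c ^+ 2) =
  n%:R + \sum_(0 <= t < n) f t - 2 * c * (\sum_(0 <= t < n) g t) + n%:R * c ^+ 2.
Proof.
elim: n => [|n IH]; first by rewrite !big_geq //; ring.
by rewrite !big_nat_recr //= IH -(natr1 n); ring.
Qed.

Lemma sum_quadratic_prod (f g f' g' : nat -> R) (c : R) n :
  \sum_(0 <= t < n) (1 + f t - 2 * c * g t + c ^+ 2) * (1 + f' t - 2 * c * g' t + c ^+ 2) =
  n%:R * (1 + c ^+ 2) ^+ 2 +
  (1 + c ^+ 2) * (\sum_(0 <= t < n) f t + \sum_(0 <= t < n) f' t
    - 2 * c * (\sum_(0 <= t < n) g t + \sum_(0 <= t < n) g' t)) +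
  \sum_(0 <= t < n) f t * f' t
  - 2 * c * (\sum_(0 <= t < n) f t * g' t + \sum_(0 <= t < n) g t * f' t)
  + 4 * c ^+ 2 * \sum_(0 <= t < n) g t * g' t.
Proof.
elim: n => [|n IH]; first by rewrite !big_geq //; ring.
by rewrite !big_nat_recr //= IH -(natr1 n); ring.
Qed.
End elementary.

(** * Taylor bounds *)

Section taylor.
Context {R : realType}.
Implicit Types (f : R -> R) (M : R).

(** The functions below are the restrictions of a function of several variables to a
    segment from x to x + z, hence the restriction to the unit interval. *)
Lemma mvt_bound f f' M :
  (forall x : R, x \in `[0, 1]%R -> is_derive x (1 : R) f (f' x)) ->
  (forall x : R, x \in `[0, 1]%R -> `|f' x| <= M) ->
  forall t : R, t \in `[0, 1]%R -> `|f t - f 0| <= M.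
Proof.
move=> df f'M t; rewrite in_itv /= => /andP[t0 t1].
have sub01 x : x \in `[0, t]%R -> x \in `[0, 1]%R.
  by rewrite !in_itv /= => /andP[-> xt]; exact: le_trans xt t1.
have df0 (x : R) (xt : x \in `]0, t[%R) : is_derive x (1 : R) f (f' x).
  by apply: df; apply: sub01; exact: subset_itv_oo_cc.
have cf : {within `[0, t], continuous f}.
  apply: derivable_within_continuous => x /sub01 xt.
  by have [] := df x xt.
have [c ct ->] := @MVT_segment R f f' 0 t t0 df0 cf.
rewrite subr0 normrM (ger0_norm t0).
have M0 : 0 <= M by apply: le_trans (f'M c (sub01 _ ct)); exact: normr_ge0.
by rewrite -[leRHS]mulr1 ler_pM // f'M // sub01.
Qed.

(** Subtracting the linear part of f gives a function whose derivative is bounded by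
    the mean value bound for f'.  The factor 1/2 is given up, as is 1/6 below. *)
Lemma taylor2_bound f f' f'' M :
  (forall x : R, x \in `[0, 1]%R -> is_derive x (1 : R) f (f' x)) ->
  (forall x : R, x \in `[0, 1]%R -> is_derive x (1 : R) f' (f'' x)) ->
  (forall x : R, x \in `[0, 1]%R -> `|f'' x| <= M) ->
  `|f 1 - f 0 - f' 0| <= M.
Proof.
move=> df df' f''M.
pose g x := f x - x * f' 0; have -> : f 1 - f 0 - f' 0 = g 1 - g 0 by rewrite /g; ring.
apply: (@mvt_bound g (fun x => f' x - f' 0)).
- rewrite /g; move=> x x01; have dfx := df x x01.
  by apply: is_derive_eq; rewrite /GRing.scale /= mulr0 add0r mulr1.
- by move=> x x01; apply: (mvt_bound df').
- by rewrite in_itv /= ler01 lexx.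
Qed.

Lemma taylor3_bound f f' f'' f''' M :
  (forall x : R, x \in `[0, 1]%R -> is_derive x (1 : R) f (f' x)) ->
  (forall x : R, x \in `[0, 1]%R -> is_derive x (1 : R) f' (f'' x)) ->
  (forall x : R, x \in `[0, 1]%R -> is_derive x (1 : R) f'' (f''' x)) ->
  (forall x : R, x \in `[0, 1]%R -> `|f''' x| <= M) ->
  `|f 1 - f 0 - f' 0 - f'' 0 / 2| <= M.
Proof.
move=> df df' df'' f'''M.
pose g x := f x - x ^+ 2 * (f'' 0 / 2); pose g' x := f' x - x * f'' 0.
have -> : f 1 - f 0 - f' 0 - f'' 0 / 2 = g 1 - g 0 - g' 0 by rewrite /g /g'; ring.
apply: (@taylor2_bound g g' (fun x => f'' x - f'' 0)).
- rewrite /g /g'; move=> x x01; have dfx := df x x01.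
  by apply: is_derive_eq; rewrite /GRing.scale /=; field.
- move=> x x01; have dfx := df' x x01.
  by apply: is_derive_eq; rewrite /GRing.scale /= mulr0 add0r mulr1.
- by move=> x x01; apply: (mvt_bound df'').
Qed.

(** Integrated against the law of a square, this compares a Laplace transform with
    the first two moments. *)
Lemma expRN_taylor3 (t : R) : 0 <= t -> `|expR (- t) - (1 - t + t ^+ 2 / 2)| <= t ^+ 3.
Proof.
move=> t0.
have := @taylor3_bound (fun x => expR (- t * x)) (fun x => - t * expR (- t * x))
  (fun x => t ^+ 2 * expR (- t * x)) (fun x => - t ^+ 3 * expR (- t * x)) (t ^+ 3).
rewrite mulr1 mulr0 expR0 !mulr1.
rewrite (_ : _ - 1 - _ - _ / 2 = expR (- t) - (1 - t + t ^+ 2 / 2)); last by field.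
apply.
- by move=> x _; apply: is_derive_eq; rewrite /GRing.scale /=; ring.
- by move=> x _; apply: is_derive_eq; rewrite /GRing.scale /=; ring.
- by move=> x _; apply: is_derive_eq; rewrite /GRing.scale /=; ring.
- move=> x; rewrite in_itv /= => /andP[x0 x1].
  rewrite normrM normrN normrX (ger0_norm t0) ger0_norm ?expR_ge0 //.
  rewrite -[leRHS]mulr1 ler_wpM2l ?exprn_ge0 // -expR0 ler_expR.
  by rewrite mulNr oppr_le0 mulr_ge0.
Qed.
End taylor.

Section gaussian_decay.
Context {R : realType}.
Implicit Types (r y : R).

(** A cube suffices: the polynomials to be dominated by exp(-y) grow at most like
    y^2. *)
Lemma expR_ge_cube y : 0 <= y -> (1 + y / 3) ^+ 3 <= expR y.
Proof.
move=> y0; rewrite (_ : expR y = expR (y / 3) ^+ 3); last first.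
  by rewrite -expRM_natl; congr expR; field.
by rewrite lerXn2r ?nnegrE ?expR_ge0 ?expR_ge1Dx // addr_ge0 // divr_ge0.
Qed.

Lemma expRN_le y c : 0 <= y -> c <= (1 + y / 3) ^+ 3 -> c * expR (- y) <= 1.
Proof.
move=> y0 cy; rewrite expRN ler_pdivrMr ?expR_gt0 // mul1r.
exact: le_trans cy (expR_ge_cube y0).
Qed.

Lemma gauss_decay1 r : 0 <= r -> r * expR (- r ^+ 2) <= 1.
Proof.
move=> r0; apply: expRN_le; first exact: sqr_ge0.
have := sqr_ge0 (r - 1); have := sqr_ge0 (r ^+ 2); have := sqr_ge0 (r ^+ 3).
rewrite -!exprM /=; nra.
Qed.

Lemma gauss_decay3 r : 0 <= r -> r ^+ 3 * expR (- r ^+ 2) <= 1.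
Proof.
move=> r0; apply: expRN_le; first exact: sqr_ge0.
have := sqr_ge0 (r * (r - 3 / 2)); have := sqr_ge0 (r ^+ 3).
rewrite -!exprM /=; nra.
Qed.

Lemma expRN_decay1 y : 0 <= y -> y * expR (- y) <= 1.
Proof.
move=> y0; apply: expRN_le => //.
by have := sqr_ge0 y; nra.
Qed.

Lemma expRN_decay2 y : 0 <= y -> y ^+ 2 * expR (- y) <= 3.
Proof.
move=> y0.
have h : y ^+ 2 / 3 * expR (- y) <= 1.
  apply: expRN_le => //; have : 0 <= y ^+ 3 by exact: exprn_ge0.
  nra.
rewrite (_ : _ * _ = 3 * (y ^+ 2 / 3 * expR (- y))); last by field.
by rewrite -[leRHS]mulr1 ler_wpM2l.
Qed.
End gaussian_decay.

(** * The test functions exp(-|x|^2) *)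

Section gaussian_function.
Context {R : realType}.
Variable I : seq nat.
Implicit Types (x z : nat -> R) (s t : R).

Definition sqnorm x := \sum_(i <- I) x i ^+ 2.
Definition dotp x z := \sum_(i <- I) x i * z i.
Definition norm1 x := \sum_(i <- I) `|x i|.
Definition gauss x := expR (- sqnorm x).

Lemma sqnorm_ge0 x : 0 <= sqnorm x.
Proof. by apply: sumr_ge0 => i _; exact: sqr_ge0. Qed.

Lemma norm1_ge0 x : 0 <= norm1 x.
Proof. by apply: sumr_ge0. Qed.

Lemma coord_le_sqnorm x i : i \in I -> `|x i| <= Num.sqrt (sqnorm x).
Proof.
move=> iI; rewrite -sqrtr_sqr ler_wsqrtr // /sqnorm (big_rem i) //=.
by rewrite lerDl sumr_ge0 // => j _; exact: sqr_ge0.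
Qed.

Lemma coord_le_norm1 x i : i \in I -> `|x i| <= norm1 x.
Proof. by move=> iI; rewrite /norm1 (big_rem i) //= lerDl sumr_ge0. Qed.

Lemma dotp_bound x z : `|dotp x z| <= Num.sqrt (sqnorm x) * norm1 z.
Proof.
apply: (le_trans (ler_norm_sum _ _ _)).
rewrite /norm1 mulr_sumr big_seq [leRHS]big_seq; apply: ler_sum => i iI.
by rewrite normrM ler_wpM2r // coord_le_sqnorm.
Qed.

Lemma sqnorm_le_norm1 x : sqnorm x <= norm1 x ^+ 2.
Proof.
rewrite expr2 {1}/norm1 mulr_suml /sqnorm big_seq [leRHS]big_seq.
apply: ler_sum => i iI.
by rewrite -real_normK ?num_real // expr2 ler_wpM2l // coord_le_norm1.
Qed.

Lemma sqnorm_line x z s :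
  sqnorm (fun i => x i + s * z i) = sqnorm x + s * (2 * dotp x z) + s ^+ 2 * sqnorm z.
Proof.
rewrite /sqnorm /dotp !mulr_sumr -!big_split /=.
by apply: eq_bigr => i _; ring.
Qed.

Lemma dotp_line x z s :
  dotp (fun i => x i + s * z i) z = dotp x z + s * sqnorm z.
Proof.
rewrite /sqnorm /dotp !mulr_sumr -!big_split /=.
by apply: eq_bigr => i _; ring.
Qed.

Lemma gaussE x : gauss x = expR (- Num.sqrt (sqnorm x) ^+ 2).
Proof. by rewrite sqr_sqrtr // sqnorm_ge0. Qed.

Let g x z s := expR (- (sqnorm x + s * (2 * dotp x z) + s ^+ 2 * sqnorm z)).

Let gE x z s : g x z s = gauss (fun i => x i + s * z i).
Proof. by rewrite /gauss sqnorm_line. Qed.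

Let g0 x z : g x z 0 = gauss x.
Proof. by rewrite /g /gauss; congr expR; ring. Qed.

Let g1 x z : g x z 1 = gauss (fun i => x i + z i).
Proof. by rewrite gE; congr gauss; apply/funext => i; rewrite mul1r. Qed.

Let dg x z s : is_derive s (1 : R) (g x z)
  (- 2 * (dotp x z + s * sqnorm z) * g x z s).
Proof.
by rewrite /g; apply: is_derive_eq; rewrite /GRing.scale /=; ring.
Qed.

(** The error does not involve x because the third derivative of exp(-|x|^2), a
    cubic polynomial times the Gaussian itself, is bounded. *)
Lemma gauss_taylor3 x z :
  `|gauss (fun i => x i + z i) - gauss x + 2 * dotp x z * gauss x
    - (2 * dotp x z ^+ 2 - sqnorm z) * gauss x| <= 20 * norm1 z ^+ 3.
Proof.
set q := dotp x z; set r := sqnorm z.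
pose f1 s := - 2 * (q + s * r) * g x z s.
pose f2 s := (4 * (q + s * r) ^+ 2 - 2 * r) * g x z s.
pose f3 s := (- 8 * (q + s * r) ^+ 3 + 12 * (q + s * r) * r) * g x z s.
have -> : gauss (fun i => x i + z i) - gauss x + 2 * q * gauss x
    - (2 * q ^+ 2 - r) * gauss x = g x z 1 - g x z 0 - f1 0 - f2 0 / 2.
  by rewrite /f1 /f2 g1 !g0; field.
apply: (@taylor3_bound _ (g x z) f1 f2 f3).
- by move=> s _; exact: dg.
- move=> s _; have ds := dg x z s; rewrite /f1 /f2.
  by apply: is_derive_eq; rewrite /GRing.scale /= -/q -/r; ring.
- move=> s _; have ds := dg x z s; rewrite /f2 /f3.
  by apply: is_derive_eq; rewrite /GRing.scale /= -/q -/r; ring.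
move=> s _; rewrite /f3 gE gaussE -dotp_line.
set y := fun i => x i + s * z i; set rho := Num.sqrt _.
have rho0 : 0 <= rho by exact: sqrtr_ge0.
have d0 := norm1_ge0 z; set d := norm1 z in d0 *.
have hq : `|dotp y z| <= rho * d by exact: dotp_bound.
have hr : r <= d ^+ 2 by exact: sqnorm_le_norm1.
have r0 : 0 <= r by exact: sqnorm_ge0.
have e0 := expR_ge0 (- rho ^+ 2).
have h1 := gauss_decay1 rho0; have h3 := gauss_decay3 rho0.
set e := expR _ in e0 h1 h3 *.
rewrite normrM (ger0_norm e0).
apply: (@le_trans _ _ ((8 * (rho * d) ^+ 3 + 12 * (rho * d) * d ^+ 2) * e)).
  rewrite ler_wpM2r //; apply: (le_trans (ler_normD _ _)); apply: lerD.
    by rewrite normrM normrN normrX (@ger0_norm _ 8) // ler_wpM2l // lerXn2r ?nnegrE // mulr_ge0.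
  by rewrite !normrM (ger0_norm r0) (@ger0_norm _ 12) // ler_pM // ?ler_wpM2l // mulr_ge0.
rewrite (_ : _ * e = d ^+ 3 * (8 * (rho ^+ 3 * e) + 12 * (rho * e))); last by ring.
rewrite (mulrC 20) ler_wpM2l ?exprn_ge0 //; lra.
Qed.

Lemma gauss_lipschitz x z :
  `|gauss (fun i => x i + z i) - gauss x| <= 2 * norm1 z.
Proof.
rewrite -(g1 x z) -(g0 x z).
apply: (@mvt_bound _ (g x z) (fun s => - 2 * (dotp x z + s * sqnorm z) * g x z s)).
- by move=> s _; exact: dg.
- move=> s _; rewrite gE gaussE -dotp_line.
  set y := fun i => x i + s * z i; set rho := Num.sqrt _.
  have rho0 : 0 <= rho by exact: sqrtr_ge0.
  have hq : `|dotp y z| <= rho * norm1 z by exact: dotp_bound.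
  have h1 := gauss_decay1 rho0.
  rewrite !normrM normrN (@ger0_norm _ 2) // (ger0_norm (expR_ge0 _)).
  rewrite -mulrA ler_wpM2l //.
  apply: (@le_trans _ _ (rho * norm1 z * expR (- rho ^+ 2))).
    by rewrite ler_wpM2r // expR_ge0.
  by rewrite mulrAC -[leRHS]mul1r ler_wpM2r // norm1_ge0.
- by rewrite in_itv /= ler01 lexx.
Qed.

(** Up to constant factors, the second derivatives of the Gaussian are these functions,
    plus the Gaussian itself on the diagonal. *)
Lemma gauss_quad_lipschitz x z i j : i \in I -> j \in I ->
  `|(x i + z i) * (x j + z j) * gauss (fun i => x i + z i)
    - x i * x j * gauss x| <= 4 * norm1 z.
Proof.
move=> iI jI.
pose f s := (x i + s * z i) * (x j + s * z j) * g x z s.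
pose f' s := (z i * (x j + s * z j) + (x i + s * z i) * z j
  - 2 * ((x i + s * z i) * (x j + s * z j) * (dotp x z + s * sqnorm z))) * g x z s.
have -> : (x i + z i) * (x j + z j) * gauss (fun i => x i + z i) - x i * x j * gauss x
    = f 1 - f 0 by rewrite /f g1 g0; ring.
apply: (@mvt_bound _ f f'); last by rewrite in_itv /= ler01 lexx.
  move=> s _; have ds := dg x z s; rewrite /f /f'.
  by apply: is_derive_eq; rewrite /GRing.scale /=; ring.
move=> s _; rewrite /f' gE gaussE -dotp_line.
set y := fun i => x i + s * z i; set rho := Num.sqrt _.
have rho0 : 0 <= rho by exact: sqrtr_ge0.
have d0 := norm1_ge0 z; set d := norm1 z in d0 *.
have hq : `|dotp y z| <= rho * d by exact: dotp_bound.
have yi : `|x i + s * z i| <= rho by exact: (@coord_le_sqnorm y i iI).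
have yj : `|x j + s * z j| <= rho by exact: (@coord_le_sqnorm y j jI).
have zi : `|z i| <= d by exact: coord_le_norm1.
have zj : `|z j| <= d by exact: coord_le_norm1.
have e0 := expR_ge0 (- rho ^+ 2).
have h1 := gauss_decay1 rho0; have h3 := gauss_decay3 rho0.
set e := expR _ in e0 h1 h3 *.
rewrite normrM (ger0_norm e0).
apply: (@le_trans _ _ ((d * rho + rho * d + 2 * (rho * rho * (rho * d))) * e)).
  rewrite ler_wpM2r //; apply: (le_trans (ler_normB _ _)); apply: lerD.
    apply: (le_trans (ler_normD _ _)); apply: lerD; rewrite normrM; exact: ler_pM.
  rewrite normrM (@ger0_norm _ 2) // ler_wpM2l // normrM ler_pM //.
  by rewrite normrM ler_pM.
rewrite (_ : _ * e = d * (2 * (rho * e) + 2 * (rho ^+ 3 * e))); last by ring.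
rewrite (mulrC 4) ler_wpM2l //; lra.
Qed.
End gaussian_function.

(** * One step of the heat flow *)

Section heat_step.
Context {R : realType}.
Variables (k : nat) (w : R).
Hypothesis w0 : 0 <= w.

(** The integral of exp(-|x + g|^2) over a centred Gaussian vector g with
    covariance t Id in dimension k, as a function of w = |x|^2; the exponential form
    of the factor (1 + 2 t)^(-k/2) is the one that is convenient to differentiate. *)
Let v (t : R) := expR (- (k%:R / 2) * ln (1 + 2 * t) - w / (1 + 2 * t)).

Lemma sqrtVX_expR (t : R) : 0 < t -> (Num.sqrt t)^-1 ^+ k = expR (- (k%:R / 2) * ln t).
Proof.
move=> t0; rewrite -powR12_sqrt ?ltW // /powR gt_eqF // -expRN -expRM_natl.
by congr expR; field.
Qed.

Let vE t : 0 <= t ->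
  v t = (Num.sqrt (1 + 2 * t))^-1 ^+ k * expR (- (w / (1 + 2 * t))).
Proof.
by move=> t0; rewrite sqrtVX_expR -?expRD // ltr_wpDr // mulr_ge0.
Qed.

Let v' t := (2 * (w / (1 + 2 * t)) - k%:R) / (1 + 2 * t) * v t.
Let v'' t := ((2 * (w / (1 + 2 * t)) - k%:R) ^+ 2
   - 8 * (w / (1 + 2 * t)) + 2 * k%:R) / (1 + 2 * t) ^+ 2 * v t.

Let dv (t : R) : 0 <= t -> is_derive t (1 : R) v (v' t).
Proof.
move=> t0; have th : 0 < 1 + 2 * t by rewrite ltr_wpDr // mulr_ge0.
have dth : is_derive t (1 : R) (fun s => 1 + 2 * s) 2.
  by apply: is_derive_eq; rewrite /GRing.scale /=; ring.
have dln : is_derive t (1 : R) (fun s => ln (1 + 2 * s)) (2 / (1 + 2 * t)).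
  have dl := is_derive1_ln th.
  by apply: is_derive_eq; rewrite /GRing.scale /=; ring.
have dV : is_derive t (1 : R) (fun s => (1 + 2 * s)^-1) (- 2 / (1 + 2 * t) ^+ 2).
  have th0 : 1 + 2 * t != 0 by rewrite gt_eqF.
  by apply: is_derive_eq; rewrite /GRing.scale /=; field.
rewrite /v /v'; apply: is_derive_eq; rewrite /GRing.scale /= -/(v t).
by field; rewrite gt_eqF.
Qed.

Let dv' (t : R) : 0 <= t -> is_derive t (1 : R) v' (v'' t).
Proof.
move=> t0; have th : 0 < 1 + 2 * t by rewrite ltr_wpDr // mulr_ge0.
have dvt := dv t0.
have dV : is_derive t (1 : R) (fun s => (1 + 2 * s)^-1) (- 2 / (1 + 2 * t) ^+ 2).
  have th0 : 1 + 2 * t != 0 by rewrite gt_eqF.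
  by apply: is_derive_eq; rewrite /GRing.scale /=; field.
rewrite /v' /v''; apply: is_derive_eq; rewrite /GRing.scale /= /v'.
by field; rewrite gt_eqF.
Qed.

Let v''_bound (t : R) : 0 <= t -> `|v'' t| <= k%:R ^+ 2 + 6 * k%:R + 20.
Proof.
move=> t0; rewrite /v'' vE //.
have k0 : 0 <= k%:R :> R by [].
have th : 1 <= 1 + 2 * t by rewrite lerDl mulr_ge0.
set th' := 1 + 2 * t in th *.
have y0 : 0 <= w / th' by rewrite divr_ge0 // (le_trans _ th).
set y := w / th' in y0 *.
have h1 := expRN_decay1 y0; have h2 := expRN_decay2 y0.
have e0 := expR_ge0 (- y).
have e1 : expR (- y) <= 1 by rewrite -expR0 ler_expR oppr_le0.
set e := expR _ in e0 e1 h1 h2 *.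
have c01 : 0 <= (Num.sqrt th')^-1 ^+ k <= 1.
  rewrite exprn_ge0 ?invr_ge0 ?sqrtr_ge0 //= exprn_ile1 ?invr_ge0 ?sqrtr_ge0 //.
  by rewrite invf_le1 ?sqrtr_gt0 ?(lt_le_trans _ th) // -sqrtr1 ler_wsqrtr.
have i01 : 0 <= (th' ^+ 2)^-1 <= 1.
  by rewrite invr_ge0 exprn_ge0 ?(le_trans _ th) //= invf_le1 ?exprn_ege1 // exprn_gt0 // (lt_le_trans _ th).
rewrite !normrM (@ger0_norm _ (_^-1)); last by case/andP: i01.
rewrite (ger0_norm e0) (@ger0_norm _ (_ ^+ k)); last by case/andP: c01.
set a := `|_|; set i := _^-1; set c := _ ^+ k.
have a0 : 0 <= a by exact: normr_ge0.
have ha : a <= 4 * y ^+ 2 + 4 * k%:R * y + k%:R ^+ 2 + 8 * y + 2 * k%:R.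
  rewrite /a ler_norml; apply/andP; split.
    have := sqr_ge0 (2 * y - k%:R); have := sqr_ge0 y; have := sqr_ge0 (k%:R : R).
    have : 0 <= k%:R * y by exact: mulr_ge0.
    by nra.
  have : 0 <= k%:R * y by exact: mulr_ge0.
  by nra.
case/andP: i01 => i0 i1; case/andP: c01 => c0 c1.
have ic1 : i * c <= 1 by rewrite mulr_ile1.
rewrite (_ : a * i * (c * e) = (i * c) * (a * e)); last by ring.
apply: (@le_trans _ _ (a * e)); first by rewrite ler_piMl // mulr_ge0.
apply: (@le_trans _ _ ((4 * y ^+ 2 + 4 * k%:R * y + k%:R ^+ 2 + 8 * y + 2 * k%:R) * e)).
  by rewrite ler_wpM2r.
rewrite (_ : _ * e = 4 * (y ^+ 2 * e) + 4 * (k%:R * (y * e)) + k%:R ^+ 2 * e + 8 * (y * e) + 2 * (k%:R * e)); last by ring.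
have : k%:R * (y * e) <= k%:R by rewrite ler_piMr.
have : k%:R * e <= k%:R by rewrite ler_piMr.
have : k%:R ^+ 2 * e <= k%:R ^+ 2 by rewrite ler_piMr // exprn_ge0.
lra.
Qed.

(** The linear term is half of the Laplacian of exp(-|x|^2), as for any heat flow.
    The bound is uniform in w because the second derivative in t is a quadratic
    polynomial in y = w / (1 + 2 t) times exp(-y). *)
Lemma heat_step (e : R) : 0 <= e ->
  `|(Num.sqrt (1 + 2 * e))^-1 ^+ k * expR (- (w / (1 + 2 * e)))
    - expR (- w) - e * ((2 * w - k%:R) * expR (- w))|
  <= (k%:R ^+ 2 + 6 * k%:R + 20) * e ^+ 2.
Proof.
move=> e0; rewrite -vE //.
have v0 : v 0 = expR (- w).
  by rewrite vE // mulr0 addr0 divr1 sqrtr1 invr1 expr1n mul1r.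
have v'0 : v' 0 = (2 * w - k%:R) * expR (- w).
  by rewrite /v' v0 mulr0 addr0 !divr1.
rewrite -v'0 -v0.
have es x : x \in `[0, 1]%R -> 0 <= x * e.
  by rewrite in_itv /= => /andP[x0 _]; rewrite mulr_ge0.
have dl (x : R) : is_derive x (1 : R) (fun x => x * e) e.
  by apply: is_derive_eq; rewrite /GRing.scale /=; ring.
have := @taylor2_bound _ (fun x => v (x * e)) (fun x => v' (x * e) * e) (fun x => v'' (x * e) * e * e)
  ((k%:R ^+ 2 + 6 * k%:R + 20) * e ^+ 2).
rewrite mul1r mul0r (mulrC _ e); apply.
- move=> x /es x0; have dvx := dv x0.
  by apply: is_derive_eq; rewrite /GRing.scale /=; ring.
- move=> x /es x0; have dvx := dv' x0.
  by apply: is_derive_eq; rewrite /GRing.scale /=; ring.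
- move=> x /es x0; rewrite -mulrA (normrM (v'' _)) (normrM e) (ger0_norm e0) -expr2.
  by rewrite ler_wpM2r ?exprn_ge0 // v''_bound.
Qed.
End heat_step.

(** * Bernstein polynomials *)

Section bernstein.
Context {R : realType}.
Implicit Types (f g H : nat -> R) (u c : R) (N : nat).

(** The expectation of f at the number of heads in N tosses of a coin of bias u; the
    recursion is on the first toss. *)
Fixpoint bernstein N f u : R :=
  if N is N'.+1 then
    u * bernstein N' (fun i => f i.+1) u + (1 - u) * bernstein N' f u
  else f 0%N.

Lemma bernstein_le N f g u : 0 <= u <= 1 -> (forall i, f i <= g i) ->
  bernstein N f u <= bernstein N g u.
Proof.
move=> /andP[u0 u1]; elim: N f g => [|N IH] f g fg //=.
by apply: lerD; rewrite ler_wpM2l ?subr_ge0 // IH.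
Qed.

Lemma bernstein_affine N f u a c :
  bernstein N (fun i => a * f i + c) u = a * bernstein N f u + c.
Proof. by elim: N f => [|N IH] f //=; rewrite !IH; ring. Qed.

(** The variance of the binomial law plus the square of its bias with respect to c. *)
Lemma bernstein_variance N c u :
  bernstein N (fun i => (i%:R - c) ^+ 2) u = N%:R * (u * (1 - u)) + (N%:R * u - c) ^+ 2.
Proof.
elim: N c => [|N IH] c /=; first by ring.
have -> : (fun i => (i.+1%:R - c) ^+ 2) = (fun i => (i%:R - (c - 1)) ^+ 2).
  by apply/funext => i; rewrite -natr1; ring.
by rewrite !IH -natr1; ring.
Qed.

(** Since |t| <= (M t^2 + 1/M) / 2, the Lipschitz bound on the error is affine in the
    squared deviation, whose average is the binomial variance, at most M^2 for M^2
    tosses.  Taking a square number of tosses keeps square roots away. *)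
Lemma bernstein_approx (h : R -> R) (L u : R) (M : nat) : (0 < M)%N -> 0 <= u <= 1 ->
  0 <= L -> (forall x y, `|h x - h y| <= L * `|x - y|) ->
  `|bernstein (M ^ 2) (fun i => h (i%:R / M%:R ^+ 2)) u - h u| <= L / M%:R.
Proof.
move=> M0 u01 L0 hL.
have m0 : 0 < M%:R :> R by rewrite ltr0n.
have N0 : (M ^ 2)%:R = M%:R ^+ 2 :> R by rewrite natrX.
have v1 : u * (1 - u) <= 1 by case/andP: u01 => ? ?; nra.
pose b i : R := L / (2 * M%:R ^+ 3) * (i%:R - M%:R ^+ 2 * u) ^+ 2 + L / (2 * M%:R).
have hb i : `|h (i%:R / M%:R ^+ 2) - h u| <= b i.
  apply: (le_trans (hL _ _)).
  set t : R := `|_ - _|.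
  have -> : b i = L * ((M%:R * t ^+ 2 + M%:R^-1) / 2).
    rewrite /b /t real_normK ?num_real //; field.
    by rewrite pnatr_eq0 -lt0n M0.
  rewrite ler_wpM2l // ler_pdivlMr // -subr_ge0.
  rewrite (_ : _ - _ = M%:R * (t - M%:R^-1) ^+ 2); first by rewrite mulr_ge0 ?sqr_ge0 ?ltW.
  by field; rewrite pnatr_eq0 -lt0n M0.
have bE : bernstein (M ^ 2) b u <= L / M%:R.
  rewrite /b bernstein_affine bernstein_variance N0 subrr expr0n /= addr0.
  rewrite (_ : L / M%:R = L / (2 * M%:R) * 1 + L / (2 * M%:R)); last by field; rewrite pnatr_eq0 -lt0n M0.
  rewrite lerD2r (_ : _ * _ = L / (2 * M%:R) * (u * (1 - u))).
    by rewrite ler_wpM2l // divr_ge0 // mulr_ge0 // ltW.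
  by field; rewrite pnatr_eq0 -lt0n M0.
set f := fun i : nat => _.
have up : bernstein (M ^ 2) f u <= 1 * bernstein (M ^ 2) b u + h u.
  rewrite -bernstein_affine; apply: bernstein_le => // i.
  by have := hb i; rewrite ler_norml -/(f i) => /andP[_]; lra.
have lo : -1 * bernstein (M ^ 2) b u + h u <= bernstein (M ^ 2) f u.
  rewrite -bernstein_affine; apply: bernstein_le => // i.
  by have := hb i; rewrite ler_norml -/(f i) => /andP[+ _]; lra.
by rewrite ler_norml; apply/andP; split; lra.
Qed.
End bernstein.

Section ramp.
Context {R : realType}.

(** For a < b: 0 up to a, 1 from b on and linear in between. *)
Definition ramp (a b u : R) : R := Num.max 0 (Num.min 1 ((u - a) / (b - a))).

Lemma ramp_ge0 a b u : 0 <= ramp a b u.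
Proof. by rewrite /ramp le_max lexx. Qed.

Lemma ramp_le1 a b u : ramp a b u <= 1.
Proof. by rewrite /ramp ge_max ler01 ge_min lexx. Qed.

Lemma ramp_eq1 a b u : a < b -> b <= u -> ramp a b u = 1.
Proof.
move=> ab bu; have d0 : 0 < b - a by rewrite subr_gt0.
rewrite /ramp; have -> : Num.min 1 ((u - a) / (b - a)) = 1; last exact/max_idPr.
by apply/min_idPl; rewrite ler_pdivlMr // mul1r lerB.
Qed.

Lemma ramp_eq0 a b u : a < b -> u <= a -> ramp a b u = 0.
Proof.
move=> ab ua; have d0 : 0 < b - a by rewrite subr_gt0.
apply/max_idPl; rewrite ge_min; apply/orP; right.
by rewrite pmulr_lle0 ?invr_gt0 // subr_le0.
Qed.

Lemma ramp_lipschitz a b x y : a < b -> `|ramp a b x - ramp a b y| <= (b - a)^-1 * `|x - y|.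
Proof.
move=> ab; have d0 : 0 < b - a by rewrite subr_gt0.
have clamp (s t : R) :
    `|Num.max 0 (Num.min 1 s) - Num.max 0 (Num.min 1 t)| <= `|s - t|.
  rewrite !maxEle !minEle.
  have [st|st] := leP 0 (s - t); [rewrite (ger0_norm st)|rewrite (ltr0_norm st)];
    have [h1|h1] := leP 1 s; have [h2|h2] := leP 1 t; rewrite ?ler01;
    have [h3|h3] := leP 0 s; have [h4|h4] := leP 0 t;
    rewrite ler_norml; apply/andP; split; lra.
apply: (le_trans (clamp _ _)).
rewrite -mulrBl (_ : x - a - (y - a) = x - y); last by ring.
by rewrite normrM (gtr0_norm (x := (b - a)^-1)) ?invr_gt0 // mulrC.
Qed.
End ramp.

(** * Normal laws *)

Section normal_density.
Context {R : realType}.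
Implicit Types (m s : R) (f : R -> R).
Local Notation leb := (@lebesgue_measure R).

(** [normal_pdf] is a Radon-Nikodym derivative of the normal law. *)
Lemma integral_normal_prob_integrable m s (f : measurableTypeR R -> \bar R) : 
  (normal_prob m s).-integrable setT f ->
  (\int[normal_prob m s]_x f x = \int[leb]_x (f x * (normal_pdf m s x)%:E))%E.
Proof.
move=> iF; have mf := measurable_int _ iF.
have dom := normal_prob_dominates m s.
rewrite -(Radon_Nikodym_change_of_variables dom) //=.
apply: ae_eq_integral => //.
- by apply: emeasurable_funM => //; apply: (measurable_int leb); exact: Radon_Nikodym_integrable.
- by apply: emeasurable_funM => //; apply/measurable_EFinP; exact: measurable_normal_pdf.
apply: ae_eqe_mul2l => /=; rewrite Radon_NikodymE //=.
case: cid => /= h [h1 h2 h3].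
apply: integral_ae_eq => //=.
- by apply/measurable_EFinP; exact: measurable_normal_pdf.
- by move=> E _ mE; rewrite -h3.
Qed.

(** Truncating f at n gives bounded, hence integrable functions; monotone convergence
    then removes the truncation without assuming f integrable. *)
Lemma ge0_integral_normal_prob m s f : measurable_fun setT f ->
  (forall x, 0 <= f x) ->
  (\int[normal_prob m s]_x (f x)%:E =
   \int[leb]_x (f x * normal_pdf m s x)%:E)%E.
Proof.
move=> mf f0.
pose g (n : nat) (x : R) := Num.min (f x) n%:R.
have mg n : measurable_fun setT (g n) by exact: measurable_minr.
have g0 n x : 0 <= g n x by rewrite /g le_min f0 ler0n.
have ndg x : {homo g ^~ x : a b / (a <= b)%N >-> a <= b}.
  move=> a b ab; rewrite /g le_min !ge_min lexx /= ler_nat ab.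
  by rewrite orbT.
have gf x : \forall n \near \oo, g n x = f x.
  near=> n; rewrite /g; apply/min_idPl.
  near: n; exact: nbhs_infty_ger.
have gE n : (\int[normal_prob m s]_x (g n x)%:E =
    \int[leb]_x (g n x * normal_pdf m s x)%:E)%E.
  rewrite integral_normal_prob_integrable; last first.
    apply: measurable_bounded_integrable => //.
      by rewrite (le_lt_trans (probability_le1 (normal_prob m s) measurableT)) ?ltry.
      exact: mg.
    exists n%:R; split; first exact: num_real.
    move=> M nM x _ /=; rewrite ger0_norm // (le_trans _ (ltW nM)) //.
    by rewrite /g ge_min lexx orbT.
  by apply: eq_integral => x _; rewrite EFinM.
have limE (h : R -> R) x : 0 <= h x ->
    limn (fun n => (g n x * h x)%:E) = (f x * h x)%:E.
  move=> _; apply/cvg_lim => //; apply: cvg_near_cst.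
  by apply: filterS (gf x) => n ->.
have pdf0 := normal_pdf_ge0 m s.
transitivity (\int[normal_prob m s]_x limn (fun n => (g n x)%:E))%E.
  apply: eq_integral => x _; apply/esym/cvg_lim => //; apply: cvg_near_cst.
  by apply: filterS (gf x) => n ->.
rewrite monotone_convergence //; last 3 first.
- by move=> n; apply/measurable_EFinP; exact: mg.
- by move=> n x _; rewrite lee_fin.
- by move=> x _ a b ab; rewrite lee_fin; exact: ndg.
under eq_fun do rewrite gE.
rewrite -monotone_convergence //; last 3 first.
- move=> n; apply/measurable_EFinP; apply: measurable_funM; first exact: mg.
  exact: measurable_normal_pdf.
- by move=> n x _; rewrite lee_fin mulr_ge0.
- by move=> x _ a b ab; rewrite lee_fin ler_wpM2r //; exact: ndg.
apply: eq_integral => x _; apply/cvg_lim => //; apply: cvg_near_cst.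
by apply: filterS (gf x) => n ->.
Unshelve. all: by end_near. Qed.

(** Completing the square: the factor exp(-l z^2) only shrinks the standard deviation.
    For l between -1/2 and 0 it yields exponential moments of z^2. *)
Lemma normal_pdf_tilt m s l x : 0 < s -> 0 < 1 + 2 * l ->
  expR (- l * ((x - m) / s) ^+ 2) * normal_pdf m s x =
  (Num.sqrt (1 + 2 * l))^-1 * normal_pdf m (s / Num.sqrt (1 + 2 * l)) x.
Proof.
move=> s0 l0; set q := Num.sqrt _.
have q0 : 0 < q by rewrite sqrtr_gt0.
have qE : q ^+ 2 = 1 + 2 * l by rewrite sqr_sqrtr // ltW.
have pdfE t : 0 < t -> normal_pdf m t x = normal_peak t * normal_fun m t x.
  by move=> t0; rewrite normal_pdfE // gt_eqF.
rewrite !pdfE ?divr_gt0 // /normal_fun mulrCA -expRD.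
have -> : normal_peak (s / q) = q * normal_peak s.
  rewrite /normal_peak expr_div_n.
  have -> : s ^+ 2 / q ^+ 2 * pi *+ 2 = (s ^+ 2 * pi *+ 2) / q ^+ 2 by field; rewrite gt_eqF.
  rewrite sqrtrM; last by rewrite mulrn_wge0 // mulr_ge0 ?sqr_ge0 ?pi_ge0.
  by rewrite sqrtrV ?sqr_ge0 // sqrtr_sqr gtr0_norm // invfM invrK mulrC.
rewrite -mulrA mulKf ?gt_eqF //; congr (_ * expR _).
rewrite (expr_div_n s q) qE; field.
by rewrite gt_eqF //= gt_eqF.
Qed.
Lemma normal_laplace m s l : 0 < s -> 0 < 1 + 2 * l ->
  (\int[normal_prob m s]_x (expR (- l * ((x - m) / s) ^+ 2))%:E =
   (Num.sqrt (1 + 2 * l))^-1%:E)%E.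
Proof.
move=> s0 l0; rewrite (@ge0_integral_normal_prob m s (fun x => expR (- l * ((x - m) / s) ^+ 2))) //; last first.
  apply: measurableT_comp => //; apply: measurable_funM => //.
  by apply: measurable_funX; apply: measurable_funM => //; exact: measurable_funB.
under eq_integral do rewrite normal_pdf_tilt // EFinM.
rewrite integralZl //; last exact: integrable_normal_pdf.
by rewrite integral_normal_pdf mule1.
Qed.
End normal_density.

Section gaussian_variable.
Context d (T : measurableType d) (R : realType) (P : probability T R).
Variables (Y : {RV P >-> R}) (m s : R).
Hypothesis s0 : 0 < s.
Hypothesis Y_normal : forall A, measurable A ->
  distribution P Y A = normal_prob m s A.

Let Z w : R := (Y w - m) / s.

Lemma ge0_integral_gaussian (f : R -> R) : measurable_fun setT f ->
  (forall x, 0 <= f x) ->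
  (\int[P]_w (f (Y w))%:E = \int[normal_prob m s]_x (f x)%:E)%E.
Proof.
move=> mf f0.
have mY : measurable_fun setT (Y : T -> measurableTypeR R).
  by move=> mT A mA; have mY0 : measurable_fun setT Y by []; exact: (mY0 mT A mA).
pose Y' : {mfun T >-> measurableTypeR R} := mfun_Sub (mem_set mY : (Y : T -> measurableTypeR R) \in mfun).
rewrite (@eq_measure_integral _ (measurableTypeR R) R setT (distribution P Y')).
  rewrite (@ge0_integral_distribution _ _ _ _ _ P Y' (EFin \o f)) //.
  exact/measurable_EFinP.
by move=> A mA _; rewrite /= -Y_normal.
Qed.

Lemma gaussian_laplace l : 0 < 1 + 2 * l ->
  (\int[P]_w (expR (- l * Z w ^+ 2))%:E = (Num.sqrt (1 + 2 * l))^-1%:E)%E.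
Proof.
move=> l0; rewrite -(normal_laplace m s0 l0).
rewrite (@ge0_integral_gaussian (fun x => expR (- l * ((x - m) / s) ^+ 2))) //.
apply: measurableT_comp => //; apply: measurable_funM => //.
by apply: measurable_funX; apply: measurable_funM => //; exact: measurable_funB.
Qed.
End gaussian_variable.

(** * Moments of a normal variable *)

Section real_integrable.
Context d (T : measurableType d) (R : realType) (P : probability T R).
Implicit Types f g : T -> R.
Local Notation integrable f := (P.-integrable setT (EFin \o f)).

Lemma Rintegrable_cst (c : R) : integrable (fun=> c).
Proof. exact: finite_measure_integrable_cst. Qed.

Lemma RintegrableD f g : integrable f -> integrable g ->
  integrable (fun w => f w + g w).
Proof. by move=> iF iG; exact: (integrableD measurableT iF iG). Qed.

Lemma RintegrableB f g : integrable f -> integrable g ->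
  integrable (fun w => f w - g w).
Proof. by move=> iF iG; exact: (integrableB measurableT iF iG). Qed.

Lemma RintegrableZ c f : integrable f -> integrable (fun w => c * f w).
Proof. by move=> iF; exact: (integrableZl measurableT c iF). Qed.

Lemma Rintegrable_bounded f M : measurable_fun setT f ->
  (forall w, `|f w| <= M) -> integrable f.
Proof.
move=> mf fM; apply: measurable_bounded_integrable => //.
  by rewrite (le_lt_trans (probability_le1 P measurableT)) ?ltry.
exists M; split; first exact: num_real.
by move=> N MN w _ /=; rewrite (le_trans (fM w)) // ltW.
Qed.

Lemma Rintegrable_indic (A : set T) : measurable A ->
  P.-integrable setT (EFin \o (\1_A : T -> R)).
Proof.
move=> mA; apply: (@Rintegrable_bounded _ 1); first exact: measurable_indic.
by move=> w; rewrite indicE; case: (_ \in _); rewrite /= ?normr1 ?normr0.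
Qed.

Lemma Rintegral_indic (A : set T) : measurable A -> \int[P]_w (\1_A w : R) = fine (P A).
Proof. by move=> mA; rewrite /Rintegral integral_indic // setIT. Qed.
End real_integrable.

Section gaussian_moments.
Context d (T : measurableType d) (R : realType) (P : probability T R).
Variables (Y : {RV P >-> R}) (m s : R).
Hypothesis s0 : 0 < s.
Hypothesis Y_normal : forall A, measurable A ->
  distribution P Y A = normal_prob m s A.

Let Z w : R := (Y w - m) / s.

Let mZ : measurable_fun setT Z.
Proof. by apply: measurable_funM => //; exact: measurable_funB. Qed.

Lemma powerN_le_expR (p : nat) (x : R) :
  `|x| ^+ p <= 1 + (4 * p%:R) ^+ p * expR (x ^+ 2 / 4).
Proof.
have e0 := expR_ge0 (x ^+ 2 / 4).
have [x1|x1] := leP `|x| 1.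
  by rewrite ler_wpDr ?exprn_ile1 // mulr_ge0 // exprn_ge0 // mulr_ge0.
rewrite ler_wpDl //.
case: p => [|p]; first by rewrite !expr0 mul1r -expR0 ler_expR divr_ge0 ?sqr_ge0.
have -> : expR (x ^+ 2 / 4) = expR (x ^+ 2 / (4 * p.+1%:R)) ^+ p.+1.
  rewrite -expRM_natl; congr expR; field.
  by rewrite nat1r pnatr_eq0.
rewrite -exprMn lerXn2r ?nnegrE //.
have := expR_ge1Dx (x ^+ 2 / (4 * p.+1%:R)).
have p0 : (0 : R) < 4 * p.+1%:R by rewrite mulr_gt0.
move/(ler_wpM2l (ltW p0)); apply: le_trans.
rewrite mulrDr mulr1 mulrCA divff ?gt_eqF // mulr1 ler_wpDl ?(ltW p0) //.
by rewrite -(@real_normK _ x) ?num_real // expr2 ler_peMl // ltW.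
Qed.

(** exp(Z^2 / 4), which is integrable by the Laplace transform at -1/4, dominates
    every power of Z. *)
Lemma gaussian_moments_fin (p : nat) :
  P.-integrable setT (fun w => (`|Z w| ^+ p)%:E).
Proof.
have iE : P.-integrable setT (EFin \o (fun w => expR (Z w ^+ 2 / 4))).
  apply/integrableP; split.
    apply/measurable_EFinP; apply: measurableT_comp => //.
    by apply: measurable_funM => //; exact: measurable_funX.
  under eq_integral do rewrite /= ger0_norm ?expR_ge0 //.
  have -> : (\int[P]_w (expR (Z w ^+ 2 / 4))%:E =
      \int[P]_w (expR (- (- (1 / 4)) * Z w ^+ 2))%:E)%E.
    by apply: eq_integral => w _; congr (expR _)%:E; field.
  by rewrite (gaussian_laplace s0 Y_normal) ?ltry //; lra.
have iB : P.-integrable setT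
    (EFin \o (fun w => 1 + (4 * p%:R) ^+ p * expR (Z w ^+ 2 / 4))).
  by apply: RintegrableD; [exact: Rintegrable_cst|exact: RintegrableZ].
apply: le_integrable iB => //.
  by apply/measurable_EFinP; apply: measurable_funX; exact: measurableT_comp.
move=> w _ /=; rewrite lee_fin normrX normr_id (le_trans (powerN_le_expR p _)) //.
exact: ler_norm.
Qed.

Let integrable_power (p : nat) : P.-integrable setT (EFin \o (fun w => Z w ^+ p)).
Proof.
apply: le_integrable (gaussian_moments_fin p) => //.
  by apply/measurable_EFinP; exact: measurable_funX.
by move=> w _; rewrite /= !normrX normr_id.
Qed.

(** Dividing by x and letting x tend to 0, twice. *)
Lemma cubic_comparison (a b C : R) :
  (forall x, 0 < x -> x <= 1 -> `|a * x + b * x ^+ 2| <= C * x ^+ 3) ->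
  a = 0 /\ b = 0.
Proof.
move=> h.
have small (c K : R) : (forall x, 0 < x -> x <= 1 -> `|c| <= K * x) -> c = 0.
  move=> cK; apply/eqP; rewrite -normr_le0; apply/ler_addgt0Pl => e e0.
  rewrite addr0; pose x := Num.min 1 (e / (`|K| + 1)).
  have K0 : 0 < `|K| + 1 by rewrite ltr_wpDl.
  have x0 : 0 < x by rewrite lt_min ltr01 divr_gt0.
  apply: (le_trans (cK x x0 _)); first by rewrite ge_min lexx.
  apply: (@le_trans _ _ ((`|K| + 1) * x)).
    by rewrite (ler_wpM2r (ltW x0)) // (le_trans (ler_norm K)) // lerDl.
  by rewrite mulrC -ler_pdivlMr // ge_min lexx orbT.
have C0 : 0 <= C.
  by have := le_trans (normr_ge0 _) (h 1 ltr01 (lexx _)); rewrite !expr1n !mulr1.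
have a0 : a = 0.
  apply: (small _ (`|b| + C)) => x x0 x1.
  rewrite -(ler_pM2r x0); have := h x x0 x1.
  have : `|b * x ^+ 2| = `|b| * x ^+ 2 by rewrite normrM (ger0_norm (sqr_ge0 x)).
  have : `|a * x| = `|a| * x by rewrite normrM (gtr0_norm x0).
  have := ler_normB (a * x + b * x ^+ 2) (b * x ^+ 2).
  rewrite addrK => H1 H2 H3 H4.
  have x32 : x ^+ 3 <= x ^+ 2 by rewrite exprS ler_piMl ?sqr_ge0.
  have := ler_wpM2l C0 x32.
  by rewrite -H2; rewrite H3 in H1; move: H1 H4; rewrite expr2; lra.
split => //; apply: (small _ C) => x x0 x1.
have := h x x0 x1; rewrite a0 mul0r add0r normrM (ger0_norm (sqr_ge0 x)).
by move=> H; rewrite -(ler_pM2r (exprn_gt0 2 x0)) -mulrA -exprS.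
Qed.

Lemma sqrtV_taylor (l : R) : 0 <= l -> l <= 1 ->
  `|(Num.sqrt (1 + 2 * l))^-1 - (1 - l + 3 / 2 * l ^+ 2)| <= 3 * l ^+ 3.
Proof.
move=> l0 l1; set q := Num.sqrt _.
have qE : q ^+ 2 = 1 + 2 * l by rewrite sqr_sqrtr // addr_ge0 // mulr_ge0.
have q1 : 1 <= q by rewrite -sqrtr1 ler_wsqrtr // lerDl mulr_ge0.
have q0 : 0 < q by lra.
pose e := q - 1.
have e0 : 0 <= e by rewrite subr_ge0.
have lE : l = e + e ^+ 2 / 2 by rewrite /e; lra.
have el : e <= l by rewrite lE lerDl divr_ge0 ?sqr_ge0.
have -> : q^-1 - (1 - l + 3 / 2 * l ^+ 2) = - (e ^+ 3 * (q^-1 + 3 / 2 + 3 / 8 * e)).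
  by rewrite lE /e; field; rewrite gt_eqF.
have qV : q^-1 <= 1 by rewrite invf_le1.
have qV0 : 0 <= q^-1 by rewrite invr_ge0 ltW.
rewrite normrN ger0_norm; last by rewrite mulr_ge0 ?exprn_ge0 //; lra.
rewrite mulrC ler_pM ?exprn_ge0 //; try lra.
by rewrite lerXn2r ?nnegrE.
Qed.

(** The Laplace transform (1 + 2 l)^(-1/2) = 1 - l + 3/2 l^2 + O(l^3) of Z^2 is also
    1 - l E Z^2 + l^2/2 E Z^4 + O(l^3), as the sixth moment is finite. *)
Lemma gaussian_moments24 : \int[P]_w (Z w ^+ 2) = 1 /\ \int[P]_w (Z w ^+ 4) = 3.
Proof.
set m2 := \int[P]_w _; set m4 := \int[P]_w _; pose m6 := \int[P]_w (Z w ^+ 6).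
suff [] : 1 - m2 = 0 /\ (m4 - 3) / 2 = 0 by split; lra.
apply: (@cubic_comparison _ _ (m6 + 3)) => l l0 l1.
have q0 : 0 < 1 + 2 * l by lra.
have iL : P.-integrable setT (EFin \o (fun w => expR (- (l * Z w ^+ 2)))).
  apply: (@Rintegrable_bounded _ _ _ _ _ 1).
    apply: measurableT_comp => //; apply: measurableT_comp => //.
    by apply: measurable_funM => //; exact: measurable_funX.
  move=> w; rewrite ger0_norm ?expR_ge0 // -expR0 ler_expR oppr_le0.
  by rewrite mulr_ge0 ?sqr_ge0 // ltW.
have i2 : P.-integrable setT (EFin \o (fun w => l * Z w ^+ 2)).
  exact/RintegrableZ/integrable_power.
have i4 : P.-integrable setT (EFin \o (fun w => l ^+ 2 / 2 * Z w ^+ 4)).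
  exact/RintegrableZ/integrable_power.
have i12 : P.-integrable setT (EFin \o (fun w => 1 - l * Z w ^+ 2)).
  by apply: RintegrableB => //; exact: Rintegrable_cst.
have iP : P.-integrable setT (EFin \o (fun w => 1 - l * Z w ^+ 2 + l ^+ 2 / 2 * Z w ^+ 4)).
  exact: RintegrableD.
have LE : \int[P]_w expR (- (l * Z w ^+ 2)) = (Num.sqrt (1 + 2 * l))^-1.
  rewrite /Rintegral -[RHS]/(fine _%:E) -(gaussian_laplace s0 Y_normal q0).
  by congr fine; apply: eq_integral => w _; rewrite mulNr.
have PE : \int[P]_w (1 - l * Z w ^+ 2 + l ^+ 2 / 2 * Z w ^+ 4) = 1 - l * m2 + l ^+ 2 / 2 * m4.
  rewrite RintegralD // RintegralB //; last exact: Rintegrable_cst.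
  rewrite !RintegralZl //; [|exact: integrable_power..].
  by rewrite Rintegral_cst //= probability_setT mulr1.
have : `|\int[P]_w (expR (- (l * Z w ^+ 2)) - (1 - l * Z w ^+ 2 + l ^+ 2 / 2 * Z w ^+ 4))| <= l ^+ 3 * m6.
  have iD : P.-integrable setT (EFin \o (fun w => expR (- (l * Z w ^+ 2)) - (1 - l * Z w ^+ 2 + l ^+ 2 / 2 * Z w ^+ 4))).
    exact: RintegrableB.
  apply: (le_trans (le_normr_Rintegral measurableT iD)).
  have -> : l ^+ 3 * m6 = \int[P]_w (l ^+ 3 * Z w ^+ 6).
    by rewrite RintegralZl //; exact: integrable_power.
  apply: le_Rintegral => //.
  - exact: integrable_norm.
  - exact/RintegrableZ/integrable_power.
  move=> w _; have := expRN_taylor3 (mulr_ge0 (ltW l0) (sqr_ge0 (Z w))).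
  rewrite (_ : (l * Z w ^+ 2) ^+ 2 / 2 = l ^+ 2 / 2 * Z w ^+ 4); last by ring.
  by rewrite (_ : (l * Z w ^+ 2) ^+ 3 = l ^+ 3 * Z w ^+ 6) //; ring.
rewrite RintegralB // LE PE => H1.
have H2 := sqrtV_taylor (ltW l0) l1.
rewrite mulrDl; move: H1 H2; rewrite !ler_norml => /andP[? ?] /andP[? ?].
by apply/andP; split; lra.
Qed.
End gaussian_moments.

Section gaussian_mean.
Context d (T : measurableType d) (R : realType) (P : probability T R).
Variables (Y : {RV P >-> R}) (m s : R).
Hypothesis s0 : 0 < s.
Hypothesis Y_normal : forall A, measurable A ->
  distribution P Y A = normal_prob m s A.

Let Z w : R := (Y w - m) / s.

Lemma normal_pdf_shift a x :
  expR (a * ((x - m) / s)) * normal_pdf m s x = expR (a ^+ 2 / 2) * normal_pdf (m + a * s) s x.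
Proof.
rewrite !normal_pdfE ?gt_eqF // /normal_fun !(mulrCA _ (normal_peak s)) -!expRD.
by congr (_ * expR _); field; rewrite gt_eqF.
Qed.

Lemma gaussian_mgf a : (\int[P]_w (expR (a * Z w))%:E = (expR (a ^+ 2 / 2))%:E)%E.
Proof.
have mf : measurable_fun setT (fun x : R => expR (a * ((x - m) / s))).
  by apply: measurableT_comp => //; apply: measurable_funM => //;
     apply: measurable_funM => //; exact: measurable_funB.
rewrite (ge0_integral_gaussian Y_normal mf) //.
rewrite (@ge0_integral_normal_prob _ m s _ mf) //.
under eq_integral do rewrite normal_pdf_shift EFinM.
rewrite integralZl //; last exact: integrable_normal_pdf.
by rewrite integral_normal_pdf mule1.
Qed.

(** Integrating 1 + a Z <= exp(a Z) gives a E Z <= exp(a^2 / 2) - 1 <= a^2 for small a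
    of either sign. *)
Lemma gaussian_mean : \int[P]_w Z w = 0.
Proof.
have iZ : P.-integrable setT (EFin \o Z).
  apply: le_integrable (gaussian_moments_fin s0 Y_normal 1) => //.
    apply/measurable_EFinP; apply: measurable_funM => //; exact: measurable_funB.
  by move=> w _; rewrite /= expr1 normr_id.
have key a : `|a| <= 1 -> a * \int[P]_w Z w <= a ^+ 2.
  move=> a1; have iE : P.-integrable setT (EFin \o (fun w => expR (a * Z w))).
    apply/integrableP; split.
      apply/measurable_EFinP; apply: measurableT_comp => //.
      apply: measurable_funM => //; apply: measurable_funM => //.
      exact: measurable_funB.
    under eq_integral do rewrite /= ger0_norm ?expR_ge0 //.
    by rewrite gaussian_mgf ltry.
  have a21 : a ^+ 2 <= 1 by rewrite -(@real_normK _ a) ?num_real // exprn_ile1.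
  have h : \int[P]_w (1 + a * Z w) <= \int[P]_w expR (a * Z w).
    apply: le_Rintegral => //.
      by apply: RintegrableD; [exact: Rintegrable_cst|exact: RintegrableZ].
    by move=> w _; exact: expR_ge1Dx.
  move: h; rewrite RintegralD //; [|exact: Rintegrable_cst|exact: RintegrableZ].
  rewrite RintegralZl // Rintegral_cst //= probability_setT mulr1.
  rewrite [in X in _ <= X -> _]/Rintegral gaussian_mgf /=.
  have q0 := expR_gt0 (a ^+ 2 / 2).
  have h2 := expR_ge1Dx (- (a ^+ 2 / 2)).
  rewrite expRN in h2; have h3 : expR (a ^+ 2 / 2) * (expR (a ^+ 2 / 2))^-1 = 1.
    by rewrite divff // gt_eqF.
  have h4 := ler_wpM2l (ltW q0) h2; rewrite h3 in h4.
  move: (expR _) q0 h4 => q q0 h4; have := sqr_ge0 a; move: a21 h4.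
  move: (a ^+ 2) (a * _) => b c *; nra.
set e := \int[P]_w Z w in key *.
apply/eqP; rewrite -normr_le0; apply/ler_addgt0Pl => r r0; rewrite addr0.
pose x := Num.min 1 r.
have x0 : 0 < x by rewrite lt_min ltr01.
have x1 : x <= 1 by rewrite ge_min lexx.
have xr : x <= r by rewrite ge_min lexx orbT.
apply: le_trans xr; rewrite ler_norml.
have := key x; have := key (- x); rewrite normrN gtr0_norm // sqrrN => /(_ x1) h1 /(_ x1) h2.
apply/andP; split; rewrite -(ler_pM2l x0); lra.
Qed.
End gaussian_mean.

(** * The Laplace transform of the chi-squared law *)

Section chi_squared_laplace.
Context {R : realType}.

Lemma chi_squared_ge0 (k : nat) : chi_squared (R := R) k `]-oo, 0[%classic = 0%E.
Proof.
elim: k => [|k IH] /=.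
  by rewrite /dirac /= indicE mem_setE in_itv /= ltxx.
apply/eqP; rewrite -measure_le0 -[X in (_ <= X)%E](_ : (chi_squared k \x normal_prob 0 1)%E
   (`]-oo, (0 : R)[%classic `*` [set: measurableTypeR R]) = 0%E); last first.
  rewrite product_measure1E //.
  transitivity (0 * normal_prob 0 1 [set: measurableTypeR R])%E; last exact: mul0e.
  by congr (_ * _)%E; exact: IH.
rewrite /distribution /pushforward; apply: le_measure.
- rewrite inE -[X in measurable X]setTI; exact: measurable_add_sqr.
- by rewrite inE; exact: measurableX.
move=> [x z] /=; rewrite !in_itv /= /add_sqr /= => h; split => //.
by rewrite (le_lt_trans _ h) // lerDl sqr_ge0.
Qed.

(** For the functions of the induction below, which are only identified for x >= 0. *)
Lemma eq_integral_chi_squared k (f g : R -> \bar R) :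
  measurable_fun setT f -> measurable_fun setT g ->
  (forall x, 0 <= x -> f x = g x) ->
  (\int[chi_squared k]_x f x = \int[chi_squared k]_x g x)%E.
Proof.
move=> mf mg fg; apply: ae_eq_integral => //.
exists `]-oo, 0[%classic; split => //; first exact: chi_squared_ge0.
move=> x /= h; rewrite in_itv /= ltNge; apply/negP => x0; apply: h => _.
exact: fg.
Qed.

(** The absolute value makes the integrand bounded on the whole line, and the law only
    charges x >= 0.  By independence each squared normal variable contributes the
    factor of [normal_laplace]. *)
Lemma chi_squared_laplace k (l : R) : 0 <= l ->
  (\int[chi_squared k]_x (expR (- (l * `|x|)))%:E =
   ((Num.sqrt (1 + 2 * l))^-1 ^+ k)%:E)%E.
Proof.
move=> l0; have ml : measurable_fun setT (fun x : R => expR (- (l * `|x|))).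
  apply: measurableT_comp => //; apply: measurableT_comp => //.
  by apply: measurable_funM => //; exact: normr_measurable.
elim: k => [|k IH] /=.
  rewrite integral_dirac //; last exact/measurable_EFinP.
  by rewrite normr0 mulr0 oppr0 expR0 diracT mul1e expr0.
rewrite ge0_integral_distribution //; last exact/measurable_EFinP.
pose c : R := (Num.sqrt (1 + 2 * l))^-1.
have mE : measurable_fun setT (fun z : R * measurableTypeR R => (expR (- (l * `|add_sqr z|)))%:E).
  apply/measurable_EFinP; apply: (measurableT_comp ml); exact: measurable_add_sqr.
rewrite fubini_tonelli1 //; last by move=> z; rewrite /= lee_fin expR_ge0.
rewrite (@eq_integral_chi_squared k _ (fun x => ((expR (- (l * `|x|)))%:E * c%:E)%E)).
- rewrite ge0_integralZr //; last 2 first.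
  + exact/measurable_EFinP.
  + by rewrite lee_fin invr_ge0.
  by rewrite IH -EFinM exprSr.
- by apply: measurable_fun_fubini_tonelli_F => // z; rewrite /= lee_fin expR_ge0.
- by apply: emeasurable_funM => //; exact/measurable_EFinP.
move=> x x0; rewrite /fubini_F /=.
have l2 : 0 < 1 + 2 * l by rewrite ltr_wpDr // mulr_ge0.
rewrite -(normal_laplace 0 ltr01 l2) -ge0_integralZl //; last first.
  apply/measurable_EFinP; apply: measurableT_comp => //; apply: measurable_funM => //.
  by apply: measurable_funX; apply: measurable_funM => //; exact: measurable_funB.
apply: eq_integral => z _; rewrite -EFinM -expRD; congr (expR _)%:E.
rewrite /add_sqr /= ger0_norm ?addr_ge0 ?sqr_ge0 // ger0_norm //.
by rewrite subr0 divr1; ring.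
Qed.
End chi_squared_laplace.

(** * From moments of exp(-x) to distribution functions *)

Lemma sandwich_dist {R : realFieldType} (f fn fu fl eu enu el enl e : R) :
  fn <= enu -> eu <= fu -> fl <= el -> enl <= fn ->
  `|eu - enu| <= e / 2 -> `|el - enl| <= e / 2 ->
  `|f - fu| <= e / 2 -> `|f - fl| <= e / 2 -> `|f - fn| <= e.
Proof.
rewrite !ler_norml => ? ? ? ? /andP[? ?] /andP[? ?] /andP[? ?] /andP[? ?].
by apply/andP; split; lra.
Qed.

Section moments_determine_law.
Context {R : realType}.
Implicit Types (nu : probability R R).

Let E nu (f : R -> R) : R := \int[nu]_x f x.
Let U (x : R) : R := expR (- `|x|).

Let U01 x : 0 <= U x <= 1.
Proof. by rewrite expR_ge0 /= -expR0 ler_expR oppr_le0. Qed.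

Let mU : measurable_fun setT U.
Proof. by apply: measurableT_comp => //; apply: measurableT_comp => //; exact: normr_measurable. Qed.

Lemma measurable_bernstein N f : measurable_fun setT (fun x => bernstein N f (U x)).
Proof.
elim: N f => [|N IH] f /=; first exact: measurable_cst.
apply: measurable_funD; apply: measurable_funM => //.
exact: measurable_funB.
Qed.

Lemma bernstein_bounded N (f : nat -> R) : exists M, forall x, `|bernstein N f (U x)| <= M.
Proof.
elim: N f => [|N IH] f /=; first by exists `|f 0%N|.
have [M1 h1] := IH (fun i => f i.+1); have [M2 h2] := IH f.
exists (M1 + M2) => x; have /andP[u0 u1] := U01 x.
apply: (le_trans (ler_normD _ _)); rewrite !normrM (ger0_norm u0).
rewrite (@ger0_norm _ (1 - _)) ?subr_ge0 //.
by apply: lerD; [apply: le_trans (h1 x)|apply: le_trans (h2 x)]; rewrite ler_piMl // gerBl.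
Qed.

Variables (nu_ : nat -> probability R R) (nu : probability R R).
Hypothesis moments_cvg :
  forall j : nat, E (nu_ n) (fun x => U x ^+ j) @[n --> \oo] --> E nu (fun x => U x ^+ j).

(** The additional power U^j absorbs the factors u and 1 - u of the recursive
    definition, so that induction on N ends with moments of U. *)
Lemma bernstein_cvg N f j :
  E (nu_ n) (fun x => U x ^+ j * bernstein N f (U x)) @[n --> \oo] -->
  E nu (fun x => U x ^+ j * bernstein N f (U x)).
Proof.
have mX k : measurable_fun setT (fun x => U x ^+ k) by exact: measurable_funX.
have X01 k x : 0 <= U x ^+ k <= 1.
  by have /andP[u0 u1] := U01 x; rewrite exprn_ge0 //= exprn_ile1.
have ib (m : probability R R) k (K : nat) (g : nat -> R) :
    m.-integrable setT (EFin \o (fun x => U x ^+ k * bernstein K g (U x))).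
  have [M hM] := bernstein_bounded K g.
  apply: (@Rintegrable_bounded _ _ _ m _ M) => [|x].
    by apply: measurable_funM => //; exact: measurable_bernstein.
  have /andP[x0 x1] := X01 k x.
  by rewrite normrM (ger0_norm x0) (le_trans _ (hM x)) // ler_piMl.
elim: N f j => [|N IH] f j /=.
  have EZ m : E m (fun x => U x ^+ j * f 0%N) = E m (fun x => U x ^+ j) * f 0%N.
    rewrite /E RintegralZr //; apply: (@Rintegrable_bounded _ _ _ m _ 1) => // x.
    by have /andP[x0 x1] := X01 j x; rewrite ger0_norm.
  by rewrite EZ; under eq_fun do rewrite EZ; apply: cvgMr_tmp.
have ED m : E m (fun x => U x ^+ j * (U x * bernstein N (fun i => f i.+1) (U x) +
      (1 - U x) * bernstein N f (U x))) =
    E m (fun x => U x ^+ j.+1 * bernstein N (fun i => f i.+1) (U x)) +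
    (E m (fun x => U x ^+ j * bernstein N f (U x)) -
     E m (fun x => U x ^+ j.+1 * bernstein N f (U x))).
  transitivity (E m (fun x => U x ^+ j.+1 * bernstein N (fun i => f i.+1) (U x) +
      (U x ^+ j * bernstein N f (U x) - U x ^+ j.+1 * bernstein N f (U x)))).
    by apply: eq_Rintegral => x _; rewrite exprS; ring.
  rewrite /E RintegralD ?RintegralB //; first exact: ib.
  - exact: ib.
  - exact: ib.
  - by apply: RintegrableB; exact: ib.
rewrite ED; under eq_fun do rewrite ED.
by apply: cvgD => //; apply: cvgB.
Qed.

Lemma lipschitz_cvg (h : R -> R) L : (0 <= L) ->
  (forall x y, `|h x - h y| <= L * `|x - y|) -> measurable_fun setT (h \o U) ->
  E (nu_ n) (h \o U) @[n --> \oo] --> E nu (h \o U).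
Proof.
move=> L0 hL mh; apply/cvgrPdist_le => e e0.
pose M := (Num.truncn (3 * L / e)).+1.
have m0 : 0 < M%:R :> R by rewrite ltr0n.
have LM : L / M%:R <= e / 3.
  rewrite ler_pdivrMr // mulrC -ler_pdivrMr ?divr_gt0 //.
  rewrite (_ : L / (e / 3) = 3 * L / e); last by field; rewrite gt_eqF.
  by apply: ltW; exact: truncnS_gt.
pose b x := bernstein (M ^ 2) (fun i => h (i%:R / M%:R ^+ 2)) (U x).
have bh x : `|b x - h (U x)| <= e / 3.
  by apply: le_trans LM; exact: bernstein_approx.
have mb : measurable_fun setT b by exact: measurable_bernstein.
have [K bK] := bernstein_bounded (M ^ 2) (fun i => h (i%:R / M%:R ^+ 2)).
have ib (m : probability R R) : m.-integrable setT (EFin \o b) by exact: (@Rintegrable_bounded _ _ _ m _ K).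
have ih (m : probability R R) : m.-integrable setT (EFin \o (h \o U)).
  apply: (@Rintegrable_bounded _ _ _ m _ (K + e / 3)) => // x /=.
  have := ler_normB (b x) (b x - h (U x)); rewrite opprB addrC subrK => H.
  by apply: (le_trans H); apply: lerD => //; exact: bK.
have Eb (m : probability R R) : `|E m b - E m (h \o U)| <= e / 3.
  have iD := RintegrableB (ib m) (ih m).
  have -> : E m b - E m (h \o U) = \int[m]_x (b x - (h \o U) x).
    exact/esym/(RintegralB measurableT (ib m) (ih m)).
  apply: (le_trans (le_normr_Rintegral measurableT iD)).
  have -> : e / 3 = \int[m]_x (e / 3).
    by rewrite Rintegral_cst //= probability_setT mulr1.
  by apply: le_Rintegral => //; [exact: integrable_norm|exact: Rintegrable_cst].
have b0 : E (nu_ n) b @[n --> \oo] --> E nu b.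
  have := @bernstein_cvg (M ^ 2) (fun i => h (i%:R / M%:R ^+ 2)) 0.
  have E0 (m : probability R R) : E m (fun x => U x ^+ 0 * b x) = E m b.
    by apply: eq_Rintegral => x _; rewrite expr0 mul1r.
  by rewrite E0; under eq_fun do rewrite E0.
move: b0 => /cvgrPdist_le /(_ (e / 3)); rewrite divr_gt0 // => /(_ isT).
apply: filterS => n H.
have H1 := Eb nu; have H2 := Eb (nu_ n).
rewrite -/b in H; move: H H1 H2; rewrite !ler_norml.
by move=> /andP[? ?] /andP[? ?] /andP[? ?]; apply/andP; split; lra.
Qed.

Hypothesis nu_ge0_ : forall n, nu_ n `]-oo, 0[%classic = 0%E.
Hypothesis nu_ge0 : nu `]-oo, 0[%classic = 0%E.

Let F (m : probability R R) (s : R) : R := fine (m `]-oo, s]%classic).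

Lemma measurable_ramp a b : measurable_fun setT (ramp a b \o U).
Proof.
apply: measurable_maxr => //; apply: measurable_minr => //.
by apply: measurable_funM => //; exact: measurable_funB.
Qed.

Let integrable_ramp (m : probability R R) a b :
  m.-integrable setT (EFin \o (ramp a b \o U)).
Proof.
apply: (@Rintegrable_bounded _ _ _ m _ 1); first exact: measurable_ramp.
by move=> x /=; rewrite ger0_norm ?ramp_ge0 ?ramp_le1.
Qed.

(** On the half-line x >= 0, where m is carried, x <= s means exp(-s) <= U x. *)
Lemma cdf_le_ramp (m : probability R R) (s t : R) : s < t ->
  m `]-oo, 0[%classic = 0%E ->
  F m s <= E m (ramp (expR (- t)) (expR (- s)) \o U).
Proof.
move=> st m0; have ab : expR (- t) < expR (- s) by rewrite ltr_expR ltrN2.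
have iD := RintegrableD (integrable_ramp m (expR (- t)) (expR (- s)))
  (Rintegrable_indic m (measurable_itv `]-oo, (0 : R)[)).
rewrite -[leRHS]addr0 -[X in _ + X]/(fine 0%E) -m0 -Rintegral_indic // /F.
rewrite -Rintegral_indic // -RintegralD //; last first.
- exact: Rintegrable_indic.
- exact: integrable_ramp.
apply: le_Rintegral => //; first exact: Rintegrable_indic.
move=> x _ /=; rewrite !indicE !mem_setE !in_itv /=.
have r0 := ramp_ge0 (expR (- t)) (expR (- s)) (U x).
have [xs|] := leP x s; last by rewrite addr_ge0.
have [x0|x0] := ltP x 0; first by rewrite lerDr.
by rewrite addr0 ramp_eq1 // /U ler_expR lerN2 ger0_norm.
Qed.

Lemma ramp_le_cdf (m : probability R R) (s t : R) : s < t ->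
  E m (ramp (expR (- t)) (expR (- s)) \o U) <= F m t.
Proof.
move=> st; have ab : expR (- t) < expR (- s) by rewrite ltr_expR ltrN2.
rewrite /F -Rintegral_indic //.
apply: le_Rintegral => //; [exact: integrable_ramp|exact: Rintegrable_indic|].
move=> x _ /=; rewrite indicE mem_setE in_itv /=.
have [xt|tx] := leP x t; first exact: ramp_le1.
by rewrite ramp_eq0 // /U ler_expR lerN2 (le_trans (ltW tx)) // ler_norm.
Qed.

(** For r - delta < r < r + delta, the distribution function at r lies between the
    integrals of two ramps, which converge; continuity of the limit at r lets delta
    tend to 0. *)
Lemma moments_cvg_cdf (r : R) :
  {for r, continuous (fun s : R => nu `]-oo, s]%classic)} ->
  nu_ n `]-oo, r]%classic @[n --> \oo] --> nu `]-oo, r]%classic.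
Proof.
move=> cr.
have fin (m : probability R R) s : m `]-oo, s]%classic \is a fin_num.
  exact: fin_num_measure.
have FE (m : probability R R) s : m `]-oo, s]%classic = (F m s)%:E by rewrite fineK.
have cF : F nu s @[s --> r] --> F nu r.
  by apply: fine_cvg; rewrite -FE.
rewrite FE; apply: cvg_EFin; first by near=> n; exact: fin.
have ramp_cvg s t : s < t ->
    E (nu_ n) (ramp (expR (- t)) (expR (- s)) \o U) @[n --> \oo] -->
    E nu (ramp (expR (- t)) (expR (- s)) \o U).
  move=> st; have ab : expR (- t) < expR (- s) by rewrite ltr_expR ltrN2.
  apply: (@lipschitz_cvg _ (expR (- s) - expR (- t))^-1).
  - by rewrite invr_ge0 subr_ge0 ltW.
  - by move=> x y; exact: ramp_lipschitz.
  - exact: measurable_ramp.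
apply/cvgrPdist_le => e e0.
have e20 : 0 < e / 2 by rewrite divr_gt0.
move/cvgrPdist_le : (cF) => /(_ _ e20) /nbhs_ballP[dl /= dl0 hdl].
have hF s : `|r - s| < dl -> `|F nu r - F nu s| <= e / 2 by move=> ?; exact: hdl.
pose dd := dl / 2.
have d0 : 0 < dd by rewrite divr_gt0.
have ddl : dd < dl by rewrite /dd ltr_pdivrMr // ltr_pMr // ltr1n.
have rd : r - dd < r by rewrite ltrBlDr ltrDl.
have rd' : r < r + dd by rewrite ltrDl.
have hu : `|F nu r - F nu (r + dd)| <= e / 2.
  by apply: hF; rewrite opprD addNKr normrN gtr0_norm.
have hl : `|F nu r - F nu (r - dd)| <= e / 2.
  by apply: hF; rewrite opprB addrC subrK gtr0_norm.
have /cvgrPdist_le/(_ _ e20) Hu := ramp_cvg _ _ rd'.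
have /cvgrPdist_le/(_ _ e20) Hl := ramp_cvg _ _ rd.
apply: filterS2 Hu Hl => n Hu' Hl'.
have A1 := cdf_le_ramp rd' (nu_ge0_ n).
have A2 := ramp_le_cdf nu rd'.
have A3 := cdf_le_ramp rd nu_ge0.
have A4 := ramp_le_cdf (nu_ n) rd.
exact: (sandwich_dist A1 A2 A3 A4 Hu' Hl' hu hl).
Unshelve. all: by end_near. Qed.

End moments_determine_law.

(** * Variables depending on the past *)

Section adapted.
Context d (T : measurableType d) (R : realType) (P : probability T R).
Variable y : nat -> {RV P >-> R}.
Hypothesis y_indep : mutually_independent y.

(** Cylinders rather than the sigma-algebra of the first j observations: they form a
    pi-system on which independence is the product rule, and [<<s past j >>] is the
    sigma-algebra. *)
Definition past (j : nat) : set (set T) :=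
  [set A | exists B : nat -> set R, (forall i, measurable (B i)) /\
     A = \bigcap_(i in [set i | (i < j)%N]) (y i @^-1` B i)].

Lemma past_setI_closed j : setI_closed (past j).
Proof.
move=> _ _ [B [mB ->]] [C [mC ->]]; exists (fun i => B i `&` C i); split.
  by move=> i; exact: measurableI.
apply/seteqP; split => w.
  by move=> [hB hC] i ij; split; [exact: hB|exact: hC].
by move=> h; split => i ij; have [] := h i ij.
Qed.

Lemma past_measurable j : past j `<=` measurable.
Proof.
move=> _ [B [mB ->]]; apply: bigcap_measurableType => //.
by move=> i _; exact: measurable_funPTI.
Qed.

Lemma past_mono i j : (i <= j)%N -> past i `<=` past j.
Proof.
move=> ij _ [B [mB ->]]; exists (fun k => if (k < i)%N then B k else setT).
split; first by move=> k; case: ifP.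
apply/seteqP; split => w h k /=.
  by case: ifPn => // ki _; exact: h.
by move=> ki; have := h k (leq_trans ki ij); rewrite /= ki.
Qed.

Lemma gen_past_measurable j : <<s past j >> `<=` measurable.
Proof.
apply: smallest_sub; [exact: sigma_algebra_measurable|exact: past_measurable].
Qed.

(** For cylinders this is an instance of mutual independence; the events A for which
    it holds form a Dynkin system. *)
Lemma past_indep j A B : <<s past j >> A -> measurable B ->
  P (A `&` y j @^-1` B) = (P A * P (y j @^-1` B))%E.
Proof.
move=> + mB; have mYB : measurable (y j @^-1` B) by exact: measurable_funPTI.
move: A; apply: (@dynkin_induction _ (g_sigma_algebraType (past j)) (past j)
  (fun A => P (A `&` y j @^-1` B) = (P A * P (y j @^-1` B))%E)) => //.
- exact: past_setI_closed.
- by rewrite setTI probability_setT mul1e.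
- move=> _ [C [mC ->]].
  pose C' i := if i == j then B else C i.
  have mC' i : measurable (C' i) by rewrite /C'; case: ifP.
  pose J := [fset i in iota 0 j]%fset.
  have JE : [set` J] = [set i | (i < j)%N].
    by apply/seteqP; split=> i /=; rewrite !inE /= mem_iota add0n.
  have jJ : j \notin J by rewrite !inE /= mem_iota /= ltnn.
  have := y_indep (j |` J)%fset mC'.
  rewrite big_fsetU1 //= /C' eqxx.
  rewrite (@eq_big_seq _ _ _ _ _ _ (fun i => P (y i @^-1` C i))); last first.
    by move=> i iJ; have /negPf -> : i != j by apply: contraNneq jJ => <-.
  rewrite -y_indep // JE muleC => <-; congr (P _).
  apply/seteqP; split => w.
    move=> [h1 h2] i /=; rewrite in_fset1U => /orP[/eqP ->|iJ]; first by rewrite eqxx.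
    have ij : (i < j)%N by have : [set` J] i by []; rewrite JE.
    by rewrite ltn_eqF //; exact: h1.
  move=> h; split.
    move=> i ij; have := h i; rewrite /= (ltn_eqF ij); apply.
    by rewrite in_fset1U; apply/orP; right; have : [set i | (i < j)%N] i by []; rewrite -JE.
  by have := h j; rewrite /= eqxx; apply; rewrite in_fset1U eqxx.
- move=> A mA IH; have mA' : d.-measurable (A : set T) by exact: (gen_past_measurable mA).
  rewrite setIC -setDE measureD ?ltey_eq ?fin_num_measure//.
  rewrite [X in (_ - P X)%E]setIC IH probability_setC //.
  rewrite muleBl ?mul1e ?fin_num_measure//.
- move=> F mF tF IH.
  have mF' n : d.-measurable (F n : set T) by exact: (gen_past_measurable (mF n)).
  rewrite setI_bigcupl measure_bigcup//; last 2 first.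
  + by move=> i _; exact: measurableI.
  + exact: trivIset_setIr.
  rewrite measure_bigcup //.
  rewrite muleC -(@fineK _ (P (y j @^-1` B))) ?fin_num_measure//.
  rewrite -nneseriesZl //; apply: eq_eseriesr => i _.
  by rewrite fineK ?fin_num_measure// muleC; exact: IH.
Qed.

(** Requiring all moments makes adapted variables an algebra, so that expectations of
    polynomials in the observations split without further integrability conditions. *)
Definition adapted (j : nat) (X : T -> R) : Prop :=
  @measurable_fun _ _ (g_sigma_algebraType (past j)) R setT X /\
  forall p : nat, P.-integrable setT (fun w => (`|X w| ^+ p)%:E).

Lemma adapted_measurable j X : adapted j X -> measurable_fun setT X.
Proof.
move=> [mX _] _ B mB; apply: (@gen_past_measurable j).
exact: (mX measurableT B mB).
Qed.

Lemma integrable_dominated (X Y : T -> R) : measurable_fun setT X ->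
  P.-integrable setT (EFin \o Y) -> (forall w, `|X w| <= Y w) ->
  P.-integrable setT (EFin \o X).
Proof.
move=> mX iY XY; apply: le_integrable iY => //; first exact/measurable_EFinP.
by move=> w _ /=; rewrite lee_fin (le_trans (XY w)) // ler_norm.
Qed.

Lemma adapted_integrable j X : adapted j X -> P.-integrable setT (EFin \o X).
Proof.
move=> aX; have [_ iX] := aX.
apply: (integrable_dominated (adapted_measurable aX) (iX 1%N)) => w.
by rewrite expr1.
Qed.

Lemma adapted_mono i j X : (i <= j)%N -> adapted i X -> adapted j X.
Proof.
move=> ij [mX iX]; split => // mT B mB.
have := mX measurableT B mB; apply: sub_smallest2r; last exact: past_mono.
exact: smallest_sigma_algebra.
Qed.

Lemma adapted_cst j (c : R) : adapted j (fun=> c).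
Proof.
split; first exact: measurable_cst.
by move=> p; exact: finite_measure_integrable_cst.
Qed.

Lemma adaptedM j X Y : adapted j X -> adapted j Y ->
  adapted j (fun w => X w * Y w).
Proof.
move=> aX aY; have [mX iX] := aX; have [mY iY] := aY; split.
  exact: measurable_funM.
move=> p; apply: (@integrable_dominated _
  (fun w => `|X w| ^+ (2 * p) + `|Y w| ^+ (2 * p))).
- apply: measurable_funX; apply: measurableT_comp => //.
  by apply: measurable_funM; [exact: adapted_measurable aX|exact: adapted_measurable aY].
- exact: (integrableD _ (iX _) (iY _)).
- move=> w; rewrite normrX normr_id normrM exprMn mulnC !exprM.
  set a := _ ^+ p; set b := _ ^+ p.
  have a0 : 0 <= a by exact: exprn_ge0.
  have b0 : 0 <= b by exact: exprn_ge0.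
  nra.
Qed.

Lemma adaptedD j X Y : adapted j X -> adapted j Y ->
  adapted j (fun w => X w + Y w).
Proof.
move=> aX aY; have [mX iX] := aX; have [mY iY] := aY; split.
  exact: measurable_funD.
move=> p; apply: (@integrable_dominated _
  (fun w => 2 ^+ p * (`|X w| ^+ p + `|Y w| ^+ p))).
- apply: measurable_funX; apply: measurableT_comp => //.
  by apply: measurable_funD; [exact: adapted_measurable aX|exact: adapted_measurable aY].
- exact: (integrableZl measurableT (2 ^+ p) (integrableD measurableT (iX p) (iY p))).
- move=> w; rewrite normrX normr_id.
  have : `|X w + Y w| <= 2 * Num.max `|X w| `|Y w|.
    apply: (le_trans (ler_normD _ _)); rewrite mulr_natl mulr2n.
    by apply: lerD; rewrite le_max lexx ?orbT.
  move/(lerXn2r p); rewrite !nnegrE => /(_ _ _)/le_trans; apply => //.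
  rewrite exprMn ler_pM2l ?exprn_gt0 //.
  by have [_|_] := leP `|X w| `|Y w|; rewrite ?lerDl ?lerDr exprn_ge0.
Qed.

Lemma adapted_sum j (I : eqType) (r : seq I) (Q : pred I) (X : I -> T -> R) :
  (forall i, i \in r -> Q i -> adapted j (X i)) ->
  adapted j (fun w => \sum_(i <- r | Q i) X i w).
Proof.
elim: r => [|i r IH] aX.
  by under eq_fun do rewrite big_nil; exact: adapted_cst.
have {}IH : adapted j (fun w => \sum_(i <- r | Q i) X i w).
  by apply: IH => k kr; apply: aX; rewrite inE kr orbT.
have [Qi|/negPf Qi] := boolP (Q i); last by under eq_fun do rewrite big_cons Qi.
under eq_fun do rewrite big_cons Qi.
by apply: adaptedD => //; apply: aX => //; rewrite inE eqxx.
Qed.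

Lemma adaptedZ j c X : adapted j X -> adapted j (fun w => c * X w).
Proof. exact/adaptedM/adapted_cst. Qed.

Lemma adaptedN j X : adapted j X -> adapted j (fun w => - X w).
Proof. by move=> /(adaptedZ (-1)); under eq_fun do rewrite mulN1r. Qed.

Lemma adaptedB j X Y : adapted j X -> adapted j Y ->
  adapted j (fun w => X w - Y w).
Proof. by move=> aX aY; apply: adaptedD => //; exact: adaptedN. Qed.

Lemma adaptedX j X p : adapted j X -> adapted j (fun w => X w ^+ p).
Proof.
move=> aX; elim: p => [|p IH]; first exact: adapted_cst.
by under eq_fun do rewrite exprS; exact: adaptedM.
Qed.

Lemma adapted_norm j X : adapted j X -> adapted j (fun w => `|X w|).
Proof.
move=> [mX iX]; split; first exact: measurableT_comp.
by move=> p; under eq_fun do rewrite normr_id.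
Qed.

Lemma adapted_bounded j (X : T -> R) (c : R) :
  @measurable_fun _ _ (g_sigma_algebraType (past j)) R setT X ->
  (forall w, `|X w| <= c) -> adapted j X.
Proof.
move=> mX Xc; split => // p.
have mX' : @measurable_fun _ _ T R setT X.
  by move=> _ B mB; apply: (@gen_past_measurable j); exact: (mX measurableT B mB).
apply: (@integrable_dominated _ (fun=> c ^+ p)).
- by apply: measurable_funX; exact: measurableT_comp.
- exact: finite_measure_integrable_cst.
- by move=> w; rewrite normrX normr_id lerXn2r // nnegrE ?normr_ge0 // (le_trans _ (Xc w)).
Qed.

Lemma adapted_obs i j (f : R -> R) : (i < j)%N -> measurable_fun setT f ->
  (forall p : nat, P.-integrable setT (fun w => (`|f (y i w)| ^+ p)%:E)) ->
  adapted j (fun w => f (y i w)).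
Proof.
move=> ij mf iY; split => // _ B mB; apply: sub_sigma_algebra; rewrite setTI.
exists (fun k => if k == i then f @^-1` B else setT); split.
  by move=> k; case: ifP => // _; rewrite -[X in measurable X]setTI; exact: mf.
apply/seteqP; split => w /=.
  by move=> h k _; case: eqP => // ->.
by move=> /(_ i ij); rewrite /= eqxx.
Qed.

Definition Ex (X : T -> R) : R := \int[P]_w X w.

(** The joint law is the product of the two laws, so Fubini's theorem applies. *)
Lemma indep_Ex (X Y : T -> R) :
  measurable_fun setT X -> measurable_fun setT Y ->
  (forall A B : set R, measurable A -> measurable B ->
     P (X @^-1` A `&` Y @^-1` B) = (P (X @^-1` A) * P (Y @^-1` B))%E) ->
  P.-integrable setT (EFin \o X) -> P.-integrable setT (EFin \o Y) ->
  P.-integrable setT (fun w => (X w * Y w)%:E) ->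
  Ex (fun w => X w * Y w) = Ex X * Ex Y.
Proof.
move=> mX mY XY iX iY iXY.
pose XM : {mfun T >-> R} := mfun_Sub (mem_set mX : X \in mfun).
pose YM : {mfun T >-> R} := mfun_Sub (mem_set mY : Y \in mfun).
have mXY : measurable_fun setT (fun w => (X w, Y w)) by exact: measurable_fun_pair.
pose XYM : {mfun T >-> (R * R)%type} := mfun_Sub (mem_set mXY : (fun w => (X w, Y w)) \in mfun).
pose f (z : R * R) := (z.1 * z.2)%:E.
have mf : measurable_fun setT f.
  by apply/measurable_EFinP; exact: measurable_funM.
have prodE A : measurable A ->
    (distribution P XM \x distribution P YM)%E A = distribution P XYM A.
  apply: product_measure_unique => B C mB mC.
  exact: XY.
have intE (g : R * R -> \bar R) :
    (\int[distribution P XM \x distribution P YM]_z g z =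
     \int[distribution P XYM]_z g z)%E.
  by apply: eq_measure_integral => A mA _; exact: prodE.
have if_ : (distribution P XM \x distribution P YM)%E.-integrable setT f.
  apply/integrableP; split => //; rewrite intE ge0_integral_distribution //.
    by have /integrableP[] := iXY.
  exact: measurableT_comp.
rewrite /Ex /Rintegral -[X in fine X](@integral_distribution _ _ _ _ _ P XYM f) //.
rewrite -intE -integral12_prod_meas1 // /f /=.
have iX' : (distribution P XM).-integrable setT EFin by exact: integrable_pushforward.
have iY' : (distribution P YM).-integrable setT EFin by exact: integrable_pushforward.
have -> : (\int[P]_x (X x)%:E = \int[distribution P XM]_x x%:E)%E.
  by rewrite integral_distribution.
have -> : (\int[P]_x (Y x)%:E = \int[distribution P YM]_x x%:E)%E.
  by rewrite integral_distribution.
rewrite -fineM ?integrable_fin_num //; congr fine.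
under eq_integral => x _.
  rewrite /fubini_F /=; under eq_integral do rewrite EFinM.
  rewrite integralZl //.
  over.
rewrite -[X in _ = (_ * X)%E]fineK ?integrable_fin_num // -integralZr //.
by apply: eq_integral => x _; rewrite fineK ?integrable_fin_num.
Qed.

(** Multiplying by an arbitrary X from the past plays the part of conditioning on
    it. *)
Lemma Ex_past_obs j X (f : R -> R) : measurable_fun setT f ->
  (forall p : nat, P.-integrable setT (fun w => (`|f (y j w)| ^+ p)%:E)) ->
  adapted j X ->
  Ex (fun w => X w * f (y j w)) = Ex X * Ex (fun w => f (y j w)).
Proof.
move=> mf iY aX.
have aY : adapted j.+1 (fun w => f (y j w)) by exact: adapted_obs.
have aX' : adapted j.+1 X by exact: adapted_mono aX.
apply: indep_Ex.
- exact: adapted_measurable aX.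
- exact: adapted_measurable aY.
- move=> A B mA mB; rewrite (_ : _ @^-1` B = y j @^-1` (f @^-1` B)) //.
  apply: past_indep; last by rewrite -[X in measurable X]setTI; exact: mf.
  by have [/(_ measurableT A mA)] := aX; rewrite setTI.
- exact: adapted_integrable aX.
- exact: adapted_integrable aY.
- exact: adapted_integrable (adaptedM aX' aY).
Qed.

Lemma ExD j X Y : adapted j X -> adapted j Y ->
  Ex (fun w => X w + Y w) = Ex X + Ex Y.
Proof.
move=> aX aY; rewrite /Ex RintegralD //.
  exact: adapted_integrable aX.
exact: adapted_integrable aY.
Qed.

Lemma ExZ j c X : adapted j X -> Ex (fun w => c * X w) = c * Ex X.
Proof. by move=> aX; rewrite /Ex RintegralZl //; exact: adapted_integrable aX. Qed.

Lemma ExB j X Y : adapted j X -> adapted j Y ->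
  Ex (fun w => X w - Y w) = Ex X - Ex Y.
Proof.
move=> aX aY; rewrite /Ex RintegralB //.
  exact: adapted_integrable aX.
exact: adapted_integrable aY.
Qed.

Lemma Ex_cst c : Ex (fun=> c) = c.
Proof. by rewrite /Ex Rintegral_cst //= probability_setT mulr1. Qed.

Lemma Ex_sum j (I : eqType) (r : seq I) (X : I -> T -> R) :
  (forall i, i \in r -> adapted j (X i)) ->
  Ex (fun w => \sum_(i <- r) X i w) = \sum_(i <- r) Ex (X i).
Proof.
elim: r => [|i r IH] aX.
  by rewrite big_nil; under eq_fun do rewrite big_nil; exact: Ex_cst.
have aX' k : k \in r -> adapted j (X k) by move=> kr; apply: aX; rewrite inE kr orbT.
rewrite big_cons -IH // -(@ExD j); last 2 first.
- by apply: aX; rewrite inE eqxx.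
- by apply: adapted_sum => k kr _; exact: aX'.
by congr Ex; apply/funext => w; rewrite big_cons.
Qed.

Lemma Ex_le j X Y : adapted j X -> adapted j Y -> (forall w, X w <= Y w) ->
  Ex X <= Ex Y.
Proof.
move=> aX aY XY; rewrite /Ex le_Rintegral //.
  exact: adapted_integrable aX.
exact: adapted_integrable aY.
Qed.

Lemma Ex_ge0 X : (forall w, 0 <= X w) -> 0 <= Ex X.
Proof. by move=> X0; rewrite /Ex Rintegral_ge0. Qed.

Lemma Ex_norm_le j X Y : adapted j X -> adapted j Y ->
  (forall w, `|X w| <= Y w) -> `|Ex X| <= Ex Y.
Proof.
move=> aX aY XY; rewrite ler_norml -mulN1r -(ExZ _ aY).
apply/andP; split; apply: (@Ex_le j) => //; try exact: adaptedZ.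
  by move=> w; rewrite mulN1r; have := XY w; rewrite ler_norml => /andP[].
by move=> w; apply: le_trans (XY w); exact: ler_norm.
Qed.
End adapted.

(** * Lindeberg's method for lagged products *)

Lemma adapted_expRN d (T : measurableType d) (R : realType) (P : probability T R)
    (y : nat -> {RV P >-> R}) j X : adapted y j X -> (forall w, 0 <= X w) ->
  adapted y j (fun w => expR (- X w)).
Proof.
move=> [mX _] X0; apply: (@adapted_bounded _ _ _ _ _ _ _ 1).
  by apply: measurableT_comp => //; exact: measurableT_comp.
by move=> w; rewrite ger0_norm ?expR_ge0 // -expR0 ler_expR oppr_le0.
Qed.

Lemma exists_max (R : realDomainType) (I : eqType) (s : seq I) (a : I -> R) :
  s != [::] -> exists2 i, i \in s & forall k, k \in s -> a k <= a i.
Proof.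
elim: s => // i s IH _; have [->|/IH[k ks kM]] := eqVneq s [::].
  by exists i; rewrite ?inE // => k; rewrite inE => /eqP ->.
have [ik|ki] := leP (a i) (a k).
  exists k; first by rewrite inE ks orbT.
  by move=> l; rewrite inE => /predU1P[->//|]; exact: kM.
exists i; first by rewrite inE eqxx.
move=> l; rewrite inE => /predU1P[->//|ls].
exact: le_trans (kM l ls) (ltW ki).
Qed.

Lemma sum_pow_le (R : realDomainType) (I : eqType) (s : seq I) (a : I -> R) p :
  (forall i, 0 <= a i) ->
  (\sum_(i <- s) a i) ^+ p.+1 <= (size s)%:R ^+ p.+1 * \sum_(i <- s) a i ^+ p.+1.
Proof.
move=> a0; have [->|/exists_max-/(_ R a)[i si iM]] := eqVneq s [::].
  by rewrite !big_nil expr0n /= mulr0.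
apply: (@le_trans _ _ (((size s)%:R * a i) ^+ p.+1)).
  rewrite lerXn2r ?nnegrE ?sumr_ge0 ?mulr_ge0 //.
  have -> : (size s)%:R * a i = \sum_(k <- s) a i.
    by rewrite big_const_seq count_predT iter_addr_0 mulr_natl.
  rewrite big_seq [leRHS]big_seq.
  by apply: ler_sum => k ks; exact: iM.
rewrite exprMn ler_wpM2l ?exprn_ge0 // (big_rem i) //= lerDl.
by apply: sumr_ge0 => k _; rewrite exprn_ge0.
Qed.

Section lindeberg.
Context d (T : measurableType d) (R : realType) (P : probability T R).
Variables (y : nat -> {RV P >-> R}) (u : nat -> T -> R) (K : nat -> R).
Local Notation E := (Ex P).
Local Notation adapted := (adapted y).
Hypothesis u_adapted : forall t, adapted t.+1 (u t).
Hypothesis u_mean : forall t X, adapted t X -> E (fun w => X w * u t w) = 0.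
Hypothesis u_var : forall t X, adapted t X -> E (fun w => X w * u t w ^+ 2) = 2 * E X.
Hypothesis u_moment : forall t p, E (fun w => `|u t w| ^+ p) <= K p.

Variables (I : seq nat) (m : nat).
Hypothesis I_uniq : uniq I.
Hypothesis I_lags : forall tau, tau \in I -> (0 < tau <= m)%N.
Let k := size I.

Let K_ge0 p : 0 <= K p.
Proof. by apply: le_trans (u_moment 0 p); apply: Ex_ge0 => w; rewrite exprn_ge0. Qed.

Let au t j : (t < j)%N -> adapted j (u t).
Proof. by move=> tj; exact: adapted_mono (u_adapted t). Qed.

(** Indices may coincide here and below, so these bounds come from the inequality
    between means and not from independence. *)
Lemma cross_moment2 a b : E (fun w => `|u a w * u b w|) <= K 2.
Proof.
pose j := (maxn a b).+1.
have aa : adapted j (u a) by apply: au; rewrite ltnS leq_maxl.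
have ab : adapted j (u b) by apply: au; rewrite ltnS leq_maxr.
have a2 X : adapted j X -> adapted j (fun w => `|X w| ^+ 2).
  by move=> aX; exact/adaptedX/adapted_norm.
apply: (@le_trans _ _ (E (fun w => 2^-1 * (`|u a w| ^+ 2 + `|u b w| ^+ 2)))).
  apply: (@Ex_le _ _ _ _ y j); [exact/adapted_norm/adaptedM| |].
    by apply: adaptedZ; apply: adaptedD; exact: a2.
  move=> w; rewrite normrM; have := sqr_ge0 (`|u a w| - `|u b w|); nra.
rewrite (ExZ (y := y) (j := j)); last by apply: adaptedD; exact: a2.
rewrite (ExD (a2 _ aa) (a2 _ ab)).
have := u_moment a 2; have := u_moment b 2; lra.
Qed.

Lemma cross_moment6 a b : E (fun w => `|u a w * u b w| ^+ 3) <= K 6.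
Proof.
pose j := (maxn a b).+1.
have aa : adapted j (u a) by apply: au; rewrite ltnS leq_maxl.
have ab : adapted j (u b) by apply: au; rewrite ltnS leq_maxr.
have a2 X : adapted j X -> adapted j (fun w => `|X w| ^+ 6).
  by move=> aX; exact/adaptedX/adapted_norm.
apply: (@le_trans _ _ (E (fun w => 2^-1 * (`|u a w| ^+ 6 + `|u b w| ^+ 6)))).
  apply: (@Ex_le _ _ _ _ y j); [exact/adaptedX/adapted_norm/adaptedM| |].
    by apply: adaptedZ; apply: adaptedD; exact: a2.
  move=> w; rewrite normrM exprMn; have := sqr_ge0 (`|u a w| ^+ 3 - `|u b w| ^+ 3).
  by rewrite sqrrB -!exprM; lra.
rewrite (ExZ (y := y) (j := j)); last by apply: adaptedD; exact: a2.
rewrite (ExD (a2 _ aa) (a2 _ ab)).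
have := u_moment a 6; have := u_moment b 6; lra.
Qed.

Lemma cross_moment4 a b c e :
  E (fun w => `|u a w * u b w| * `|u c w * u e w|) <= K 4.
Proof.
pose j := (maxn (maxn a b) (maxn c e)).+1.
have aa : adapted j (u a) by apply: au; rewrite ltnS !leq_max leqnn.
have ab : adapted j (u b) by apply: au; rewrite ltnS !leq_max leqnn ?orbT.
have ac : adapted j (u c) by apply: au; rewrite ltnS !leq_max leqnn ?orbT.
have ae : adapted j (u e) by apply: au; rewrite ltnS !leq_max leqnn ?orbT.
have a2 X : adapted j X -> adapted j (fun w => `|X w| ^+ 4).
  by move=> aX; exact/adaptedX/adapted_norm.
apply: (@le_trans _ _ (E (fun w => 4^-1 * ((`|u a w| ^+ 4 + `|u b w| ^+ 4) +
    (`|u c w| ^+ 4 + `|u e w| ^+ 4))))).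
  apply: (@Ex_le _ _ _ _ y j).
  - by apply: adaptedM; exact/adapted_norm/adaptedM.
  - by apply: adaptedZ; apply: adaptedD; apply: adaptedD; exact: a2.
  move=> w; rewrite !normrM.
  set A := `|u a w|; set B := `|u b w|; set C := `|u c w|; set D := `|u e w|.
  have := sqr_ge0 (A * B - C * D); have := sqr_ge0 (A ^+ 2 - B ^+ 2).
  have := sqr_ge0 (C ^+ 2 - D ^+ 2); rewrite !sqrrB -!exprM !exprMn /=; lra.
rewrite (ExZ (y := y) (j := j)); last by apply: adaptedD; apply: adaptedD; exact: a2.
rewrite (ExD (y := y) (j := j)); last 2 first.
  by apply: adaptedD; exact: a2.
  by apply: adaptedD; exact: a2.
rewrite (ExD (a2 _ aa) (a2 _ ab)) (ExD (a2 _ ac) (a2 _ ae)).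
have := u_moment a 4; have := u_moment b 4; have := u_moment c 4; have := u_moment e 4; lra.
Qed.

(* The i-th increment D i of the sums uses the observation i + m, so that all its
   partners at lags up to m exist; e j tau is the coefficient of u (j + m) in D j tau
   and only depends on earlier observations. *)
Let e j tau w := u (j + m - tau)%N w.
Let D i tau w := u (i + m)%N w * e i tau w.
Let S j tau w := \sum_(0 <= i < j) D i tau w.

Let ae j tau : tau \in I -> adapted (j + m) (e j tau).
Proof. by move=> /I_lags/andP[t0 tm]; apply: au; lia. Qed.

Let aD i j tau : tau \in I -> (i < j)%N -> adapted (j + m) (D i tau).
Proof.
move=> tI ij; apply: adaptedM; first by apply: au; rewrite ltn_add2r.
by apply: adapted_mono (ae i tI); rewrite leq_add2r ltnW.
Qed.

Let aS j tau : tau \in I -> adapted (j + m) (S j tau).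
Proof.
by move=> tI; apply: adapted_sum => i; rewrite mem_index_iota => ij _; exact: aD.
Qed.

Let aSm j tau : tau \in I -> adapted j (S (j - m) tau).
Proof.
move=> tI; have [mj|jm] := leqP m j.
  by have := aS (j - m) tI; rewrite subnK.
have -> : S (j - m) tau = fun=> 0.
  apply/funext => w; rewrite /S; move: (ltnW jm); rewrite -subn_eq0 => /eqP ->.
  by rewrite big_geq.
exact: adapted_cst.
Qed.

Let agauss j (x : nat -> T -> R) : (forall tau, tau \in I -> adapted j (x tau)) ->
  adapted j (fun w => gauss I (fun tau => x tau w)).
Proof.
move=> ax; apply: adapted_expRN; last by move=> w; exact: sqnorm_ge0.
by apply: adapted_sum => tau tI _; apply: adaptedX; exact: ax.
Qed.

(* Half of the Hessian matrix of the Gaussian. *)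
Let psi (v : nat -> R) (a b : nat) := (2 * (v a * v b) - (a == b)%:R) * gauss I v.

Let psi_lipschitz v z a b : a \in I -> b \in I ->
  `|psi (fun i => v i + z i) a b - psi v a b| <= 10 * norm1 I z.
Proof.
move=> aI bI; have h1 := @gauss_quad_lipschitz _ I v z a b aI bI.
have h2 := @gauss_lipschitz _ I v z.
rewrite /psi; set g' := gauss I _ in h1 h2 *; set g := gauss I v in h1 h2 *.
rewrite (_ : _ - _ = 2 * ((v a + z a) * (v b + z b) * g' - v a * v b * g)
   - (a == b)%:R * (g' - g)); last by ring.
apply: (le_trans (ler_normB _ _)); rewrite !normrM !normr_nat.
have : (a == b)%:R * `|g' - g| <= `|g' - g|.
  by rewrite ler_piMl //; case: eqP.
move: h1 h2; set A := `|_|; set B := `|_|; lra.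
Qed.

Let apsi j (x : nat -> T -> R) a b : a \in I -> b \in I ->
  (forall tau, tau \in I -> adapted j (x tau)) ->
  adapted j (fun w => psi (fun tau => x tau w) a b).
Proof.
move=> aI bI ax; apply: adaptedM; last exact: agauss.
apply: adaptedB; last exact: adapted_cst.
by apply: adaptedZ; apply: adaptedM; exact: ax.
Qed.

(* X only sees the first j observations, while e j a and e j b are u at times at
   least j; these times differ if a and b do. *)
Let uncorrelated j X a b : a \in I -> b \in I -> adapted j X ->
  E (fun w => X w * (e j a w * e j b w - 2 * (a == b)%:R)) = 0.
Proof.
move=> aI bI aX; have /andP[a0 am] := I_lags aI; have /andP[b0 bm] := I_lags bI.
have aX' : adapted (j + m) X by apply: adapted_mono aX; exact: leq_addr.
have aee : adapted (j + m) (fun w => X w * (e j a w * e j b w)).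
  by apply: adaptedM => //; apply: adaptedM; exact: ae.
have -> : E (fun w => X w * (e j a w * e j b w - 2 * (a == b)%:R)) =
    E (fun w => X w * (e j a w * e j b w)) - 2 * (a == b)%:R * E X.
  rewrite -(ExZ _ aX') -(ExB aee); last exact: adaptedZ.
  by congr (Ex P); apply/funext => w; ring.
have aXt t : (j <= t)%N -> adapted t X by move=> ?; exact: adapted_mono aX.
have [<-|ab] := eqVneq a b.
  have := @u_var (j + m - a)%N X (aXt _ _).
  rewrite mulr1 => H; rewrite -H ?subrr //; last by lia.
rewrite mulr0 mul0r subr0.
have sep (a' b' : nat) : (0 < a')%N -> (a' <= m)%N -> (b' <= m)%N -> (b' < a')%N ->
    E (fun w => X w * (e j a' w * e j b' w)) = 0.
  move=> ha ha' hb ba; rewrite -(@u_mean (j + m - b')%N (fun w => X w * e j a' w)).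
    by congr (Ex P); apply/funext => w; rewrite mulrA.
  apply: adaptedM; first by apply: aXt; lia.
  by apply: au; lia.
case: (ltngtP b a) => [ba|ba|ba]; first exact: sep.
  by rewrite -(sep b a) //; congr (Ex P); apply/funext => w; rewrite (mulrC (e j b w)).
by rewrite ba eqxx in ab.
Qed.

Let B := K 4 + 2 * K 2.

(** The covariance 2 e_a e_b of the increment given the past is not independent of the
    sums, but it is independent of the sums without their last m terms.  Dropping
    these terms costs a multiple of c because psi is Lipschitz. *)
Lemma decorrelation (c : R) j a b : 0 <= c -> a \in I -> b \in I ->
  `|E (fun w => psi (fun tau => c * S j tau w) a b *
       (e j a w * e j b w - 2 * (a == b)%:R))| <= c * (10 * (k * m)%:R * B).
Proof.
move=> c0 aI bI.
pose F w := e j a w * e j b w - 2 * (a == b)%:R.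
pose X w := psi (fun tau => c * S j tau w) a b.
pose X0 w := psi (fun tau => c * S (j - m) tau w) a b.
have aX : adapted (j + m) X by apply: apsi => // tau tI; apply: adaptedZ; exact: aS.
have aX0' : adapted j X0 by apply: apsi => // tau tI; apply: adaptedZ; exact: aSm.
have aX0 : adapted (j + m) X0 by apply: adapted_mono aX0'; exact: leq_addr.
have aF : adapted (j + m) F.
  by apply: adaptedB; [apply: adaptedM; exact: ae|exact: adapted_cst].
have E0 : E (fun w => X0 w * F w) = 0 by exact: uncorrelated.
have -> : E (fun w => X w * F w) = E (fun w => (X w - X0 w) * F w).
  rewrite -[LHS]subr0 -E0 -(ExB (adaptedM aX aF) (adaptedM aX0 aF)).
  by congr (Ex P); apply/funext => w; ring.
pose G w := \sum_(tau <- I) \sum_(j - m <= i < j) (10 * c) *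
   (`|D i tau w| * `|e j a w * e j b w| + 2 * `|D i tau w|).
have aDm i tau : tau \in I -> i \in index_iota (j - m) j -> adapted (j + m) (D i tau).
  by rewrite mem_index_iota => tI /andP[_ ij]; exact: aD.
have aG1 i tau : tau \in I -> i \in index_iota (j - m) j -> adapted (j + m)
    (fun w => `|D i tau w| * `|e j a w * e j b w| + 2 * `|D i tau w|).
  move=> tI ij; have aDi := adapted_norm (aDm _ _ tI ij).
  apply: adaptedD; last exact: adaptedZ.
  by apply: adaptedM => //; apply: adapted_norm; apply: adaptedM; exact: ae.
have aG2 tau : tau \in I -> adapted (j + m) (fun w => \sum_(j - m <= i < j) (10 * c) *
   (`|D i tau w| * `|e j a w * e j b w| + 2 * `|D i tau w|)).
  by move=> tI; apply: adapted_sum => i ij _; apply: adaptedZ; exact: aG1.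
have aG : adapted (j + m) G by apply: adapted_sum => tau tI _; exact: aG2.
apply: (@le_trans _ _ (E G)).
  apply: (Ex_norm_le (adaptedM (adaptedB aX aX0) aF) aG) => w.
  have XX : `|X w - X0 w| <= 10 * norm1 I (fun tau => c * \sum_(j - m <= i < j) D i tau w).
    rewrite /X (_ : (fun tau => c * S j tau w) =
      (fun tau => c * S (j - m) tau w + c * \sum_(j - m <= i < j) D i tau w)).
      exact: psi_lipschitz.
    by apply/funext => tau; rewrite -mulrDr /S -big_cat_nat // leq_subr.
  have FF : `|F w| <= `|e j a w * e j b w| + 2.
    apply: (le_trans (ler_normB _ _)); rewrite lerD2l normrM !normr_nat.
    by case: eqP => _; rewrite ?mulr1 ?mulr0.
  rewrite normrM; apply: (le_trans (ler_pM _ _ XX FF)) => //.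
  rewrite /norm1 mulr_sumr mulr_suml; apply: ler_sum => tau _.
  rewrite -mulr_sumr normrM (ger0_norm c0) mulrA -(mulrA (10 * c)).
  rewrite ler_wpM2l ?mulr_ge0 //.
  apply: (@le_trans _ _ ((\sum_(j - m <= i < j) `|D i tau w|) * (`|e j a w * e j b w| + 2))).
    by rewrite ler_wpM2r ?addr_ge0 // ler_norm_sum.
  rewrite mulr_suml; apply: ler_sum => i _.
  by rewrite mulrDr (mulrC _ 2).
rewrite (Ex_sum aG2).
have -> : c * (10 * (k * m)%:R * B) = \sum_(tau <- I) (10 * c * B * m%:R).
  by rewrite big_const_seq count_predT iter_addr_0 -mulr_natr natrM; ring.
rewrite big_seq [leRHS]big_seq; apply: ler_sum => tau tI.
rewrite (Ex_sum (y := y) (j := j + m)); last by move=> i ij; apply: adaptedZ; exact: aG1.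
apply: (@le_trans _ _ (\sum_(j - m <= i < j) (10 * c * B))).
  rewrite big_seq [leRHS]big_seq; apply: ler_sum => i ij.
  rewrite (ExZ _ (aG1 _ _ tI ij)) ler_wpM2l ?mulr_ge0 //.
  have aDi := adapted_norm (aDm _ _ tI ij).
  have aee : adapted (j + m) (fun w => `|e j a w * e j b w|).
    by apply: adapted_norm; apply: adaptedM; exact: ae.
  rewrite (ExD (adaptedM aDi aee) (adaptedZ 2 aDi)) (ExZ _ aDi).
  by apply: lerD; [exact: cross_moment4|rewrite ler_wpM2l // cross_moment2].
rewrite sumr_const_nat -[X in X <= _]mulr_natr ler_wpM2l //.
  by rewrite !mulr_ge0 ?addr_ge0 ?mulr_ge0 ?K_ge0.
by rewrite ler_nat; lia.
Qed.

Let sum_diag (f : nat -> R) a : a \in I -> \sum_(b <- I) (a == b)%:R * f b = f a.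
Proof.
move=> aI; rewrite (bigD1_seq a) //= eqxx mul1r big1 ?addr0 // => b ba.
by rewrite eq_sym (negPf ba) mul0r.
Qed.

Let psi_quad v z : \sum_(a <- I) \sum_(b <- I) psi v a b * (z a * z b) =
  (2 * dotp I v z ^+ 2 - sqnorm I z) * gauss I v.
Proof.
rewrite mulrBl expr2 {1}/dotp mulr_suml mulr_sumr mulr_suml /sqnorm mulr_suml.
rewrite -sumrB big_seq [RHS]big_seq; apply: eq_bigr => a aI.
rewrite -(sum_diag (fun b => z b ^+ 2) aI) /dotp !mulr_sumr !mulr_suml -sumrB.
apply: eq_bigr => b _; rewrite /psi.
by case: eqP => [->|_] /=; ring.
Qed.

Let psi_trace v : \sum_(a <- I) \sum_(b <- I) psi v a b * (2 * (a == b)%:R) =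
  2 * ((2 * sqnorm I v - k%:R) * gauss I v).
Proof.
transitivity (\sum_(a <- I) 2 * (2 * v a ^+ 2 - 1) * gauss I v).
  rewrite big_seq [RHS]big_seq; apply: eq_bigr => a aI.
  rewrite -(sum_diag (fun b => 2 * (2 * v b ^+ 2 - 1) * gauss I v) aI).
  by apply: eq_bigr => b _; rewrite /psi; case: eqP => [->|_] /=; ring.
rewrite -mulr_suml -mulr_sumr sumrB -mulr_sumr mulrA; congr (_ * (_ - _) * _).
by rewrite big_const_seq count_predT iter_addr_0.
Qed.

Let phi (c : R) j w := gauss I (fun tau => c * S j tau w).

Let C1 := 20 * (k%:R ^+ 3 * (k%:R * K 6)) + 2 * (k%:R * (k%:R * (10 * (k * m)%:R * B))).

Let B_ge0 : 0 <= B.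
Proof. by rewrite addr_ge0 ?mulr_ge0 ?K_ge0. Qed.

(** In the Taylor expansion of the Gaussian at c S j, the linear term has mean zero, and
    [decorrelation] replaces the quadratic one by its value for an increment of
    covariance 4 c^2 Id.  This value is 4 c^2 times half of the Laplacian. *)
Lemma gauss_step (c : R) j : 0 <= c ->
  `|E (phi c j.+1) - E (phi c j)
    - 4 * c ^+ 2 * E (fun w => (2 * sqnorm I (fun tau => c * S j tau w) - k%:R) * phi c j w)|
  <= C1 * c ^+ 3.
Proof.
move=> c0.
pose J := (j + m)%N.
pose x tau w := c * S j tau w; pose z tau w := c * D j tau w.
have ax tau : tau \in I -> adapted J (x tau).
  by move=> tI; apply: adaptedZ; exact: aS.
have ax1 tau : tau \in I -> adapted J.+1 (x tau).
  by move=> tI; apply: adapted_mono (ax _ tI).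
have az tau : tau \in I -> adapted J.+1 (z tau).
  by move=> tI; apply: adaptedZ; apply: (@aD j j.+1).
pose M w := gauss I (x^~ w).
have aM : adapted J M by exact: agauss.
have aM1 : adapted J.+1 M by exact: adapted_mono aM.
have aN : adapted J.+1 (phi c j.+1).
  by apply: (@agauss J.+1 (fun tau w => c * S j.+1 tau w)) => tau tI; apply: adaptedZ; exact: (aS j.+1 tI).
have phi1 w : phi c j.+1 w = gauss I (fun tau => x tau w + z tau w).
  congr (gauss I _); apply/funext => tau.
  by rewrite /S big_nat_recr //= mulrDr.
pose lin w := \sum_(a <- I) c * (x a w * e j a w) * M w.
have alin : adapted J lin.
  apply: adapted_sum => a aI _; apply: adaptedM => //; apply: adaptedZ.
  by apply: adaptedM; [exact: ax|exact: ae].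
pose quad w := \sum_(a <- I) \sum_(b <- I) psi (x^~ w) a b * (e j a w * e j b w).
have aquad1 a b : a \in I -> b \in I ->
    adapted J (fun w => psi (x^~ w) a b * (e j a w * e j b w)).
  move=> aI bI; apply: adaptedM; first exact: apsi.
  by apply: adaptedM; exact: ae.
have aquad : adapted J quad.
  by apply: adapted_sum => a aI _; apply: adapted_sum => b bI _; exact: aquad1.
pose V w := (2 * sqnorm I (x^~ w) - k%:R) * M w.
have aV : adapted J V.
  apply: adaptedM => //; apply: adaptedB; last exact: adapted_cst.
  by apply: adaptedZ; apply: adapted_sum => a aI _; apply: adaptedX; exact: ax.
pose Q w := quad w - 2 * V w.
have aQ : adapted J Q by apply: adaptedB => //; exact: adaptedZ.
have aQ1 a b : a \in I -> b \in I ->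
    adapted J (fun w => psi (x^~ w) a b * (e j a w * e j b w - 2 * (a == b)%:R)).
  move=> aI bI; apply: adaptedM; first exact: apsi.
  by apply: adaptedB; [apply: adaptedM; exact: ae|exact: adapted_cst].
have EQ : `|E Q| <= c * (k%:R * (k%:R * (10 * (k * m)%:R * B))).
  have -> : Q = fun w => \sum_(a <- I) \sum_(b <- I)
      psi (x^~ w) a b * (e j a w * e j b w - 2 * (a == b)%:R).
    apply/funext => w; rewrite /Q /V -psi_trace /quad -sumrB; apply: eq_bigr => a _.
    by rewrite -sumrB; apply: eq_bigr => b _; rewrite mulrBr.
  rewrite (Ex_sum (y := y) (j := J)); last first.
    by move=> a aI; apply: adapted_sum => b bI _; exact: aQ1.
  have cst_sum (r : R) : \sum_(a <- I) r = k%:R * r.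
    by rewrite big_const_seq count_predT iter_addr_0 mulr_natl.
  rewrite (_ : c * _ = k%:R * (k%:R * (c * (10 * (k * m)%:R * B)))); last by ring.
  rewrite -[leRHS]cst_sum; apply: (le_trans (ler_norm_sum _ _ _)).
  rewrite big_seq [leRHS]big_seq; apply: ler_sum => a aI.
  rewrite (Ex_sum (y := y) (j := J)); last by move=> b bI; exact: aQ1.
  rewrite -[leRHS]cst_sum; apply: (le_trans (ler_norm_sum _ _ _)).
  rewrite big_seq [leRHS]big_seq; apply: ler_sum => b bI.
  exact: decorrelation.
have Elin : E (fun w => lin w * u J w) = 0 by exact: u_mean.
have Equad : E (fun w => quad w * u J w ^+ 2) = 2 * E quad by exact: u_var.
have auJ : adapted J.+1 (u J) by exact: u_adapted.
have alin1 : adapted J.+1 (fun w => lin w * u J w).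
  by apply: adaptedM => //; exact: adapted_mono alin.
have aquad2 : adapted J.+1 (fun w => quad w * u J w ^+ 2).
  by apply: adaptedM; [exact: adapted_mono aquad|exact: adaptedX].
pose Rem w := phi c j.+1 w - M w + 2 * (lin w * u J w) - c ^+ 2 * (quad w * u J w ^+ 2).
have aPM : adapted J.+1 (fun w => phi c j.+1 w - M w) by exact: adaptedB.
have aRem : adapted J.+1 Rem.
  by apply: adaptedB; [apply: adaptedD => //; exact: adaptedZ|exact: adaptedZ].
have ERem : E Rem = E (phi c j.+1) - E (phi c j) - 4 * c ^+ 2 * E V - 2 * c ^+ 2 * E Q.
  rewrite (ExB (adaptedD aPM (adaptedZ 2 alin1)) (adaptedZ _ aquad2)).
  rewrite (ExD aPM (adaptedZ 2 alin1)) (ExB aN aM1) (ExZ 2 alin1) (ExZ _ aquad2).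
  rewrite Elin Equad (ExB aquad (adaptedZ 2 aV)) (ExZ 2 aV) -/(phi c j).
  have -> : E (phi c j) = E M by [].
  by move: (E (phi c j.+1)) (E M) (E V) (E quad) => p1 p2 p3 p4; ring.
have anz : adapted J.+1 (fun w => norm1 I (z^~ w)).
  by apply: adapted_sum => a aI _; apply: adapted_norm; exact: az.
have RemE w : Rem w = gauss I (fun tau => x tau w + z tau w) - gauss I (x^~ w) +
    2 * dotp I (x^~ w) (z^~ w) * gauss I (x^~ w) -
    (2 * dotp I (x^~ w) (z^~ w) ^+ 2 - sqnorm I (z^~ w)) * gauss I (x^~ w).
  rewrite /Rem phi1 -psi_quad; congr (_ - _ + _ - _).
    rewrite /lin /dotp -/(M w) !mulr_suml !mulr_sumr mulr_suml.
    by apply: eq_bigr => a _; rewrite /z /D -/J; ring.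
  rewrite /quad mulr_suml mulr_sumr; apply: eq_bigr => a _.
  rewrite mulr_suml mulr_sumr; apply: eq_bigr => b _.
  by rewrite /z /D -/J; ring.
have HRem : `|E Rem| <= 20 * (k%:R ^+ 3 * (k%:R * K 6)) * c ^+ 3.
  apply: (@le_trans _ _ (E (fun w => 20 * norm1 I (z^~ w) ^+ 3))).
    apply: (Ex_norm_le aRem); first by apply: adaptedZ; exact: adaptedX.
    by move=> w; rewrite RemE; exact: gauss_taylor3.
  have aD3 a : a \in I -> adapted J.+1 (fun w => `|u J w * e j a w| ^+ 3).
    move=> aI; apply: adaptedX; apply: adapted_norm; apply: adaptedM => //.
    by apply: adapted_mono (ae j aI).
  have aD3s : adapted J.+1 (fun w => \sum_(a <- I) `|u J w * e j a w| ^+ 3).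
    by apply: adapted_sum => a aI _; exact: aD3.
  apply: (@le_trans _ _ (E (fun w => 20 * c ^+ 3 * k%:R ^+ 3 *
      \sum_(a <- I) `|u J w * e j a w| ^+ 3))).
    apply: (@Ex_le _ _ _ _ y J.+1); [by apply: adaptedZ; exact: adaptedX|exact: adaptedZ|].
    move=> w; rewrite -(mulrA (20 * c ^+ 3)) -(mulrA 20) ler_wpM2l //.
    have -> : norm1 I (z^~ w) = c * \sum_(a <- I) `|u J w * e j a w|.
      rewrite /norm1 mulr_sumr; apply: eq_bigr => a _.
      by rewrite /z normrM (ger0_norm c0).
    by rewrite exprMn ler_wpM2l ?exprn_ge0 // sum_pow_le.
  rewrite (ExZ _ aD3s) (Ex_sum aD3).
  rewrite [leRHS](_ : _ = 20 * c ^+ 3 * k%:R ^+ 3 * (k%:R * K 6)); last by ring.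
  rewrite ler_wpM2l ?mulr_ge0 ?exprn_ge0 //.
  have -> : k%:R * K 6 = \sum_(a <- I) K 6.
    by rewrite big_const_seq count_predT iter_addr_0 mulr_natl.
  by rewrite big_seq [leRHS]big_seq; apply: ler_sum => a aI; exact: cross_moment6.
have -> : E (phi c j.+1) - E (phi c j) - 4 * c ^+ 2 * E V = E Rem + 2 * c ^+ 2 * E Q.
  by rewrite ERem subrK.
apply: (le_trans (ler_normD _ _)).
have -> : C1 * c ^+ 3 = 20 * (k%:R ^+ 3 * (k%:R * K 6)) * c ^+ 3 +
    2 * (c ^+ 2 * (c * (k%:R * (k%:R * (10 * (k * m)%:R * B))))) by rewrite /C1; ring.
apply: lerD => //.
have c20 : 0 <= 2 * c ^+ 2 by rewrite mulr_ge0 ?exprn_ge0.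
by rewrite normrM (ger0_norm c20) -(mulrA 2) ler_wpM2l // ler_wpM2l ?exprn_ge0.
Qed.

Let phiE c j w : phi c j w = expR (- (c ^+ 2 * sqnorm I (fun tau => S j tau w))).
Proof.
rewrite /phi /gauss /sqnorm mulr_sumr; congr (expR (- _)).
by apply: eq_bigr => tau _; rewrite exprMn.
Qed.

Let aphi c j : adapted (j + m) (phi c j).
Proof. by apply: agauss => tau tI; apply: adaptedZ; exact: aS. Qed.

Let C2 : R := k%:R ^+ 2 + 6 * k%:R + 20.

(** To first order in c^2, adding an increment and applying the heat flow for the time
    4 c^2 change the expectation by the same amount. *)
Lemma gauss_flow_step (c c' : R) j : 0 <= c -> c' ^+ 2 = c ^+ 2 / (1 + 8 * c ^+ 2) ->
  `|E (phi c j.+1) - (Num.sqrt (1 + 8 * c ^+ 2))^-1 ^+ k * E (phi c' j)|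
  <= C1 * c ^+ 3 + C2 * (4 * c ^+ 2) ^+ 2.
Proof.
move=> c0 c'E; set s := _^-1 ^+ k.
pose V w := (2 * sqnorm I (fun tau => c * S j tau w) - k%:R) * phi c j w.
have aV : adapted (j + m) V.
  apply: adaptedM; last exact: aphi.
  apply: adaptedB; last exact: adapted_cst.
  apply: adaptedZ; apply: adapted_sum => tau tI _; apply: adaptedX.
  by apply: adaptedZ; exact: aS.
have e0 : 0 <= 4 * c ^+ 2 by rewrite mulr_ge0 ?sqr_ge0.
pose H w := s * phi c' j w - phi c j w - 4 * c ^+ 2 * V w.
have aH1 : adapted (j + m) (fun w => s * phi c' j w - phi c j w).
  by apply: adaptedB => //; exact: adaptedZ.
have aH : adapted (j + m) H by apply: adaptedB => //; exact: adaptedZ.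
have EH : E H = s * E (phi c' j) - E (phi c j) - 4 * c ^+ 2 * E V.
  rewrite (ExB aH1 (adaptedZ _ aV)) (ExB (adaptedZ _ (aphi c' j)) (aphi c j)).
  by rewrite (ExZ _ (aphi c' j)) (ExZ _ aV).
have HH : `|E H| <= C2 * (4 * c ^+ 2) ^+ 2.
  rewrite -[leRHS](Ex_cst P); apply: (Ex_norm_le aH); first exact: adapted_cst.
  move=> w; set q := sqnorm I (fun tau => c * S j tau w).
  have qE : q = c ^+ 2 * sqnorm I (fun tau => S j tau w).
    by rewrite /q /sqnorm mulr_sumr; apply: eq_bigr => tau _; rewrite exprMn.
  have := @heat_step _ k q (sqnorm_ge0 _ _) _ e0.
  rewrite (_ : 1 + 2 * (4 * c ^+ 2) = 1 + 8 * c ^+ 2); last by ring.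
  rewrite (_ : expR (- (q / (1 + 8 * c ^+ 2))) = phi c' j w) //.
  by rewrite phiE c'E qE; congr (expR (- _)); ring.
have G := gauss_step j c0.
rewrite (_ : E (phi c j.+1) - s * E (phi c' j) =
  (E (phi c j.+1) - E (phi c j) - 4 * c ^+ 2 * E V) - E H).
  by apply: (le_trans (ler_normB _ _)); apply: lerD.
rewrite EH; move: (E (phi c j.+1)) (E (phi c' j)) (E (phi c j)) (E V) => p1 p2 p3 p4.
by ring.
Qed.

(** Each step removes one increment and moves the scale c along the heat flow, whose
    accumulated factors form the Laplace transform of the normal limit. *)
Lemma lindeberg_bound (l h : R) (N : nat) : 0 <= l -> 0 <= h ->
  `|E (phi (Num.sqrt (l * h / 4)) N) - (Num.sqrt (1 + 2 * l * (N%:R * h)))^-1 ^+ k|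
  <= N%:R * (C1 * Num.sqrt (l * h / 4) ^+ 3 + C2 * (l * h) ^+ 2).
Proof.
(* Solution of c'^2 = c^2 / (1 + 8 c^2) started from l h / 4: after r steps,
   c^2 = (l h / 4) / th r. *)
move=> l0 h0; pose th (r : nat) := 1 + 2 * l * (r%:R * h).
have th1 r : 1 <= th r by rewrite lerDl !mulr_ge0.
have th0 r : 0 < th r by rewrite (lt_le_trans _ (th1 r)).
pose c r := Num.sqrt (l * h / 4 / th r).
have c0 r : 0 <= c r by exact: sqrtr_ge0.
have lh0 : 0 <= l * h / 4 by rewrite divr_ge0 ?mulr_ge0.
have c2 r : c r ^+ 2 = l * h / 4 / th r by rewrite sqr_sqrtr // divr_ge0 // ltW.
have c2S r : c r.+1 ^+ 2 = c r ^+ 2 / (1 + 8 * c r ^+ 2).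
  have t0 : th r != 0 by rewrite gt_eqF.
  have t1 : th r.+1 != 0 by rewrite gt_eqF.
  have E1 : 1 + 8 * (l * h / 4 / th r) = th r.+1 / th r.
    have -> : th r.+1 = th r + 2 * l * h by rewrite /th -natr1; ring.
    by field.
  by rewrite !c2 E1; field; rewrite t0.
pose g r := (Num.sqrt (th r))^-1 ^+ k.
have g01 r : 0 <= g r <= 1.
  rewrite exprn_ge0 ?invr_ge0 ?sqrtr_ge0 //= exprn_ile1 ?invr_ge0 ?sqrtr_ge0 //.
  by rewrite invf_le1 ?sqrtr_gt0 // -sqrtr1 ler_wsqrtr.
have gS r : g r * (Num.sqrt (1 + 8 * c r ^+ 2))^-1 ^+ k = g r.+1.
  rewrite /g -exprMn -invfM -sqrtrM ?(ltW (th0 r)) //; congr (_^-1 ^+ k); congr Num.sqrt.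
  have t0 : th r != 0 by rewrite gt_eqF.
  rewrite c2; have -> : th r.+1 = th r + 2 * l * h by rewrite /th -natr1; ring.
  by field.
have C10 : 0 <= C1.
  by rewrite /C1 !(addr_ge0, mulr_ge0, exprn_ge0) ?K_ge0 ?B_ge0.
have C20 : 0 <= C2 by rewrite /C2 !(addr_ge0, mulr_ge0, exprn_ge0).
set eta := C1 * _ + _.
have c_le r : c r <= Num.sqrt (l * h / 4).
  by rewrite ler_wsqrtr // ler_pdivrMr // ler_peMr.
have eta_ge r : C1 * c r ^+ 3 + C2 * (4 * c r ^+ 2) ^+ 2 <= eta.
  apply: lerD; rewrite ler_wpM2l // lerXn2r ?nnegrE ?mulr_ge0 ?sqr_ge0 //.
  rewrite c2 (_ : 4 * _ = l * h / th r); last by field; rewrite gt_eqF.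
  by rewrite ler_pdivrMr // ler_peMr // mulr_ge0.
(* After r steps the factor g r has been collected and j increments remain. *)
suff tele j r : `|g r * E (phi (c r) j) - g (r + j)%N| <= j%:R * eta.
  have := tele N 0%N; rewrite add0n /g /c {1 2}/th mul0r mulr0 addr0.
  by rewrite divr1 sqrtr1 invr1 expr1n mul1r.
elim: j r => [|j IH] r.
  have -> : E (phi (c r) 0) = 1.
    rewrite -[RHS](Ex_cst P); congr (Ex P); apply/funext => w.
    rewrite phiE (_ : sqnorm _ _ = 0) ?mulr0 ?oppr0 ?expR0 //.
    by rewrite /sqnorm big1 // => tau _; rewrite /S big_geq // expr0n.
  by rewrite addn0 mulr1 subrr normr0 mul0r.
rewrite addnS -addSn -natr1 mulrDl mul1r [leRHS]addrC.
have H := gauss_flow_step j (c0 r) (c2S r).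
have := IH r.+1; rewrite -gS => IHr.
have /andP[g0 g1] := g01 r.
rewrite (_ : _ - _ = g r * (E (phi (c r) j.+1) - (Num.sqrt (1 + 8 * c r ^+ 2))^-1 ^+ k * E (phi (c r.+1) j))
   + (g r * (Num.sqrt (1 + 8 * c r ^+ 2))^-1 ^+ k * E (phi (c r.+1) j) - g (r.+1 + j)%N)); last first.
  move: (E _) (E _) => p1 p2; ring.
apply: (le_trans (ler_normD _ _)); apply: lerD => //.
rewrite normrM (ger0_norm g0); apply: (le_trans (ler_piMl _ _)) => //.
exact: le_trans H (eta_ge r).
Qed.

(** With steps h = 1/n the errors of the n - m steps add up to O(n^(-1/2)). *)
Lemma lindeberg_clt (l : R) : 0 <= l ->
  E (fun w => expR (- (l * \sum_(tau <- I)
    ((2 * Num.sqrt n%:R)^-1 * \sum_(0 <= i < n - m) u (i + m)%N w * u (i + m - tau)%N w) ^+ 2)))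
  @[n --> \oo] --> (Num.sqrt (1 + 2 * l))^-1 ^+ k.
Proof.
move=> l0.
have nV := @invn_cvg0 R.
have phi_cvg : E (phi (Num.sqrt (l * n%:R^-1 / 4)) (n - m)) @[n --> \oo] -->
    (Num.sqrt (1 + 2 * l))^-1 ^+ k.
  have sq0 : Num.sqrt (l * n%:R^-1 / 4) @[n --> \oo] --> (0 : R).
    rewrite -(@sqrtr0 R); apply: continuous_cvg; first exact: sqrt_continuous.
    rewrite [X in _ --> X](_ : 0 = l * 0 / 4); last by rewrite mulr0 mul0r.
    by apply: cvgMr_tmp; apply: cvgMl_tmp.
  have nm : (n - m)%:R * n%:R^-1 @[n --> \oo] --> (1 : R).
    have : 1 - m%:R * n%:R^-1 @[n --> \oo] --> (1 : R).
      rewrite [X in _ --> X](_ : 1 = 1 - m%:R * 0); last by rewrite mulr0 subr0.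
      by apply: cvgB; [exact: cvg_cst|apply: cvgMl_tmp].
    apply: cvg_trans; apply: near_eq_cvg; near=> n.
    rewrite natrB; last by near: n; exact: nbhs_infty_ge.
    rewrite mulrBl divff // pnatr_eq0 -lt0n; near: n; exact: nbhs_infty_gt.
  have g_cvg : (Num.sqrt (1 + 2 * l * ((n - m)%:R * n%:R^-1)))^-1 ^+ k @[n --> \oo] -->
      (Num.sqrt (1 + 2 * l))^-1 ^+ k.
    have base : (Num.sqrt (1 + 2 * l * ((n - m)%:R * n%:R^-1)))^-1 @[n --> \oo] -->
        (Num.sqrt (1 + 2 * l))^-1.
      apply: cvgV; first by rewrite gt_eqF // sqrtr_gt0 ltr_wpDr // mulr_ge0.
      apply: continuous_cvg; first exact: sqrt_continuous.
      apply: cvgD; first exact: cvg_cst.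
      by rewrite -[X in _ --> X]mulr1; apply: cvgMl_tmp.
    elim: (k) => [|p IH]; first by under eq_fun do rewrite expr0; exact: cvg_cst.
    by under eq_fun do rewrite exprS; rewrite exprS; exact: cvgM.
  pose eta (n : nat) : R := C1 * (l / 4) * Num.sqrt (l * n%:R^-1 / 4) + C2 * l ^+ 2 * n%:R^-1.
  have eta_cvg : eta n @[n --> \oo] --> (0 : R).
    rewrite [X in _ --> X](_ : 0 = C1 * (l / 4) * 0 + C2 * l ^+ 2 * 0); last by rewrite !mulr0 addr0.
    by apply: cvgD; apply: cvgMl_tmp.
  have C10 : 0 <= C1.
    by rewrite /C1 !(addr_ge0, mulr_ge0, exprn_ge0) ?K_ge0 ?B_ge0.
  have C20 : 0 <= C2 by rewrite /C2 !(addr_ge0, mulr_ge0, exprn_ge0).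
  have diff n : `|E (phi (Num.sqrt (l * n%:R^-1 / 4)) (n - m)) -
      (Num.sqrt (1 + 2 * l * ((n - m)%:R * n%:R^-1)))^-1 ^+ k| <= eta n.
    have n0 : 0 <= n%:R^-1 :> R by rewrite invr_ge0.
    apply: (le_trans (lindeberg_bound (n - m) l0 n0)).
    set h := n%:R^-1 in n0 *; set s := Num.sqrt _.
    have s0 : 0 <= s by exact: sqrtr_ge0.
    have s2 : s ^+ 2 = l * h / 4 by rewrite sqr_sqrtr // divr_ge0 // mulr_ge0.
    have N1 : (n - m)%:R * h <= 1.
      case: n @h n0 @s s0 s2 => [|n] h n0 s s0 s2; first by rewrite mul0r.
      by rewrite /h ler_pdivrMr // mul1r ler_nat leq_subr.
    rewrite [leLHS](_ : _ = ((n - m)%:R * h) * eta n); last first.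
      by rewrite /eta -/h -/s (exprS s 2) s2 expr2; ring.
    rewrite ler_piMl // /eta addr_ge0 // !mulr_ge0 ?exprn_ge0 //.
  apply/cvgrPdist_le => x x0.
  have x20 : 0 < x / 2 by rewrite divr_gt0.
  move/cvgrPdist_le : g_cvg => /(_ _ x20) G; move/cvgrPdist_le : eta_cvg => /(_ _ x20) H.
  apply: filterS2 G H => n; have := diff n; rewrite sub0r normrN.
  move: (E _) (_ ^+ k) (_ ^+ k) (eta n) => p1 p2 p3 p4.
  by rewrite !ler_norml => /andP[? ?] /andP[? ?] /andP[? ?]; apply/andP; split; lra.
move: phi_cvg; apply: cvg_trans; apply: near_eq_cvg; near=> n.
congr (Ex P); apply/funext => w; rewrite phiE /sqnorm mulr_sumr mulr_sumr.
congr (expR (- _)); apply: eq_bigr => tau _; rewrite exprMn [RHS]mulrA; congr (_ * _).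
rewrite sqr_sqrtr ?divr_ge0 ?mulr_ge0 // exprVn exprMn sqr_sqrtr //.
by field; rewrite pnatr_eq0 -lt0n; near: n; exact: nbhs_infty_gt.
Unshelve. all: by end_near. Qed.

End lindeberg.

(** * Convergence and boundedness in probability *)

Section in_probability.
Context d (T : measurableType d) (R : realType) (P : probability T R).
Implicit Types (X Y V : nat -> T -> R) (c : nat -> R) (Q : nat -> T -> Prop).

(** The exceptional sets are required to be measurable, but X and Q are not: then these
    notions pass to functions of X and to pointwise majorants without measurability
    conditions. *)
Definition with_high_prob Q := forall e : R, 0 < e -> \forall n \near \oo,
  exists2 A, measurable A & (P A <= e%:E)%E /\ forall w, ~ A w -> Q n w.

Definition cvg_prob0 X := forall e : R, 0 < e -> with_high_prob (fun n w => `|X n w| <= e).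

Definition bounded_prob X := forall e : R, 0 < e -> exists M : R,
  \forall n \near \oo,
  exists2 A, measurable A & (P A <= e%:E)%E /\ forall w, ~ A w -> `|X n w| <= M.

Lemma union_small (A B : set T) (e f : R) : measurable A -> measurable B ->
  (P A <= e%:E)%E -> (P B <= f%:E)%E -> (P (A `|` B) <= (e + f)%:E)%E.
Proof.
move=> mA mB PA PB; apply: (le_trans (measureU2 _ mA mB)).
by rewrite EFinD leeD.
Qed.

Lemma with_high_prob_and Q Q' : with_high_prob Q -> with_high_prob Q' -> with_high_prob (fun n w => Q n w /\ Q' n w).
Proof.
move=> q q' e e0; have e2 : 0 < e / 2 by rewrite divr_gt0.
apply: filterS2 (q _ e2) (q' _ e2) => n [A mA [PA qA]] [B mB [PB qB]].
exists (A `|` B); first exact: measurableU.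
split; first by rewrite [e]splitr; exact: union_small.
by move=> w /not_orP[nA nB]; split; [exact: qA|exact: qB].
Qed.

Lemma with_high_prob_imply Q Q' : (\forall n \near \oo, forall w, Q n w -> Q' n w) ->
  with_high_prob Q -> with_high_prob Q'.
Proof.
move=> QQ' q e e0; apply: filterS2 QQ' (q e e0) => n H [A mA [PA qA]].
by exists A => //; split => // w nA; apply: H; exact: qA.
Qed.

Lemma cvg_prob0_ext X Y Q : with_high_prob Q ->
  (\forall n \near \oo, forall w, Q n w -> X n w = Y n w) ->
  cvg_prob0 X -> cvg_prob0 Y.
Proof.
move=> q XY X0 e e0; apply: with_high_prob_imply (with_high_prob_and q (X0 e e0)).
by apply: filterS XY => n H w [Qw]; rewrite H.
Qed.

Lemma cvg_prob0_near X Y : (\forall n \near \oo, forall w, X n w = Y n w) ->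
  cvg_prob0 X -> cvg_prob0 Y.
Proof.
move=> XY X0 e e0; apply: with_high_prob_imply (X0 e e0).
by apply: filterS XY => n H w; rewrite H.
Qed.

Lemma cvg_prob0D X Y : cvg_prob0 X -> cvg_prob0 Y ->
  cvg_prob0 (fun n w => X n w + Y n w).
Proof.
move=> X0 Y0 e e0; have e2 : 0 < e / 2 by rewrite divr_gt0.
apply: with_high_prob_imply (with_high_prob_and (X0 _ e2) (Y0 _ e2)).
apply: nearW => n w [hX hY]; apply: (le_trans (ler_normD _ _)).
by rewrite [e]splitr lerD.
Qed.

Lemma cvg_prob0_bounded X : cvg_prob0 X -> bounded_prob X.
Proof. by move=> X0 e e0; exists 1; exact: (X0 1 ltr01 e e0). Qed.

Lemma bounded_prob_near X Y : (\forall n \near \oo, forall w, X n w = Y n w) ->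
  bounded_prob X -> bounded_prob Y.
Proof.
move=> XY bX e e0; have [M hM] := bX e e0; exists M.
apply: filterS2 XY hM => n H [A mA [PA hA]]; exists A => //; split => // w nA.
by rewrite -H; exact: hA.
Qed.

Lemma bounded_prob2 X Y Z (F : R -> R -> R) :
  (forall a b, 0 <= a -> 0 <= b -> exists M, forall x y, `|x| <= a -> `|y| <= b -> `|F x y| <= M) ->
  (forall n w, Z n w = F (X n w) (Y n w)) ->
  bounded_prob X -> bounded_prob Y -> bounded_prob Z.
Proof.
move=> HF ZF bX bY e e0; have e2 : 0 < e / 2 by rewrite divr_gt0.
have [a ha] := bX _ e2; have [b hb] := bY _ e2.
have [M hM] := HF `|a| `|b| (normr_ge0 _) (normr_ge0 _); exists M.
apply: filterS2 ha hb => n [A mA [PA hA]] [B mB [PB hB]].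
exists (A `|` B); first exact: measurableU.
split; first by rewrite [e]splitr; exact: union_small.
move=> w /not_orP[nA nB]; rewrite ZF; apply: hM.
  exact: le_trans (hA w nA) (ler_norm _).
exact: le_trans (hB w nB) (ler_norm _).
Qed.

Lemma bounded_probD X Y : bounded_prob X -> bounded_prob Y ->
  bounded_prob (fun n w => X n w + Y n w).
Proof.
apply: (@bounded_prob2 X Y _ (fun x y => x + y)) => // a b a0 b0; exists (a + b) => x y xa yb.
by apply: (le_trans (ler_normD _ _)); exact: lerD.
Qed.

Lemma bounded_probM X Y : bounded_prob X -> bounded_prob Y ->
  bounded_prob (fun n w => X n w * Y n w).
Proof.
apply: (@bounded_prob2 X Y _ (fun x y => x * y)) => // a b a0 b0; exists (a * b) => x y xa yb.
by rewrite normrM ler_pM.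
Qed.

Lemma cvg_prob0M X Y : cvg_prob0 X -> bounded_prob Y ->
  cvg_prob0 (fun n w => X n w * Y n w).
Proof.
move=> X0 bY e e0 f f0; have f2 : 0 < f / 2 by rewrite divr_gt0.
have [M hM] := bY _ f2; have M0 : 0 < `|M| + 1 by rewrite ltr_wpDl.
have eM : 0 < e / (`|M| + 1) by rewrite divr_gt0.
apply: filterS2 (X0 _ eM _ f2) hM => n [A mA [PA hA]] [B mB [PB hB]].
exists (A `|` B); first exact: measurableU.
split; first by rewrite [f]splitr; exact: union_small.
move=> w /not_orP[nA nB]; rewrite normrM -[leRHS](@divfK _ (`|M| + 1)) ?gt_eqF //.
apply: ler_pM => //; first exact: hA.
by rewrite (le_trans (hB w nB)) // (le_trans (ler_norm _)) // lerDl.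
Qed.

Lemma cvg_prob0_cst c : c n @[n --> \oo] --> 0 -> cvg_prob0 (fun n _ => c n).
Proof.
move=> /cvgr0Pnorm_le c0 e e0 f f0; apply: filterS (c0 e e0) => n ce.
by exists set0 => //; split; [rewrite measure0 lee_fin ltW|].
Qed.

Lemma bounded_prob_cst (r : R) : bounded_prob (fun _ _ => r).
Proof.
move=> e e0; exists `|r|; apply: nearW => n.
by exists set0 => //; split; [rewrite measure0 lee_fin ltW|].
Qed.

Lemma cvg_prob0_null : cvg_prob0 (fun _ _ => 0).
Proof. by apply: cvg_prob0_cst; exact: cvg_cst. Qed.

Lemma cvg_prob0Z (r : R) X : cvg_prob0 X -> cvg_prob0 (fun n w => r * X n w).
Proof.
move=> X0; have := cvg_prob0M X0 (bounded_prob_cst r).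
by apply: cvg_prob0_near; apply: nearW => n w; rewrite mulrC.
Qed.

Lemma cvg_prob0_sum (I : eqType) (s : seq I) (X : I -> nat -> T -> R) :
  (forall i, i \in s -> cvg_prob0 (X i)) ->
  cvg_prob0 (fun n w => \sum_(i <- s) X i n w).
Proof.
elim: s => [|i s IH] X0.
  by apply: cvg_prob0_near cvg_prob0_null; apply: nearW => n w; rewrite big_nil.
apply: (@cvg_prob0_near (fun n w => X i n w + \sum_(i <- s) X i n w)).
  by apply: nearW => n w; rewrite big_cons.
apply: cvg_prob0D; first by apply: X0; rewrite inE eqxx.
by apply: IH => k ks; apply: X0; rewrite inE ks orbT.
Qed.

Lemma cvg_prob0_continuous X (f : R -> R) :
  f x @[x --> 0] --> 0 -> cvg_prob0 X -> cvg_prob0 (fun n w => f (X n w)).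
Proof.
move=> /cvgr0Pnorm_le f0 X0 e e0; have /nbhs_ballP[r /= r0 hr] := f0 e e0.
have r2 : 0 < r / 2 by rewrite divr_gt0.
apply: with_high_prob_imply (X0 _ r2); apply: nearW => n w Xr; apply: hr.
rewrite /ball /= sub0r normrN (le_lt_trans Xr) //.
by rewrite ltr_pdivrMr // ltr_pMr // ltr1n.
Qed.

Lemma markov_sqr (X : T -> R) (K M : R) : measurable_fun setT X ->
  P.-integrable setT (EFin \o (fun w => X w ^+ 2)) ->
  Ex P (fun w => X w ^+ 2) <= K -> 0 < M ->
  (P [set w | (M <= `|X w|)%R] <= (K / M ^+ 2)%:E)%E.
Proof.
move=> mX iX XK M0; set A := [set w | _].
have mA : measurable A.
  have -> : A = setT `&` (fun w => `|X w|) @^-1` `[M, +oo[%classic.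
    by apply/seteqP; split => w; rewrite /A /= in_itv /= andbT; [|case].
  by apply: (measurableT_comp (@normr_measurable R setT) mX).
have iA : P.-integrable setT (EFin \o (fun w => \1_A w : R)).
  exact: Rintegrable_indic.
rewrite -(@fineK _ (P A)) ?fin_num_measure // lee_fin ler_pdivlMr ?exprn_gt0 //.
apply: le_trans XK.
rewrite -Rintegral_indic //.
rewrite mulrC /Ex -RintegralZl //; apply: le_Rintegral => //.
  exact: RintegrableZ.
move=> w _; rewrite indicE; case: (boolP (w \in A)) => wA; rewrite /= ?mulr0 ?sqr_ge0 //.
rewrite mulr1 -(@real_normK _ (X w)) ?num_real // lerXn2r ?nnegrE ?normr_ge0 ?(ltW M0) //.
by move: wA; rewrite inE.
Qed.

Lemma bounded_prob_L2 X (K : R) : (forall n, measurable_fun setT (X n)) ->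
  (forall n, P.-integrable setT (EFin \o (fun w => X n w ^+ 2))) ->
  (forall n, Ex P (fun w => X n w ^+ 2) <= K) -> bounded_prob X.
Proof.
move=> mX iX XK e e0.
have K0 : 0 <= K by apply: le_trans (XK 0%N); apply: Ex_ge0 => w; exact: sqr_ge0.
pose M := 1 + K / e.
have M1 : 1 <= M by rewrite lerDl divr_ge0 // ltW.
have M0 : 0 < M by rewrite (lt_le_trans _ M1).
exists M; apply: nearW => n; exists [set w | M <= `|X n w|].
  have -> : [set w | M <= `|X n w|] = setT `&` (fun w => `|X n w|) @^-1` `[M, +oo[%classic.
    by apply/seteqP; split => w; rewrite /= in_itv /= andbT; [|case].
  by apply: (measurableT_comp (@normr_measurable R setT) (mX n)).
split.
  apply: (le_trans (markov_sqr (mX n) (iX n) (XK n) M0)).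
  rewrite lee_fin ler_pdivrMr ?exprn_gt0 // expr2 mulrA.
  apply: (@le_trans _ _ (e * M)); last by rewrite ler_peMr // mulr_ge0 // ltW.
  by rewrite /M mulrDr mulr1 mulrC divfK ?gt_eqF // lerDr ltW.
by move=> w /negP; rewrite -ltNge => /ltW.
Qed.

(** exp(-l x) is bounded and Lipschitz on x >= 0. *)
Lemma expRN_perturbation (X Y : nat -> T -> R) (l : R) : 0 <= l ->
  (forall n, measurable_fun setT (X n)) -> (forall n, measurable_fun setT (Y n)) ->
  (forall n w, 0 <= X n w) -> (forall n w, 0 <= Y n w) ->
  cvg_prob0 (fun n w => X n w - Y n w) ->
  Ex P (fun w => expR (- (l * X n w))) - Ex P (fun w => expR (- (l * Y n w))) @[n --> \oo] --> 0.
Proof.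
move=> l0 mX mY X0 Y0 XY; apply/cvgr0Pnorm_le => e e0.
have e2 : 0 < e / 2 by rewrite divr_gt0.
have el : 0 < e / 2 / (l + 1) by rewrite divr_gt0 // ltr_wpDl.
apply: filterS (XY _ el _ e2) => n [A mA [PA hA]].
have ie (Z : T -> R) : measurable_fun setT Z -> (forall w, 0 <= Z w) ->
    P.-integrable setT (EFin \o (fun w => expR (- (l * Z w)))).
  move=> mZ Z0; apply: (@Rintegrable_bounded _ _ _ _ _ 1).
    by apply: measurableT_comp => //; apply: measurableT_comp => //; exact: measurable_funM.
  by move=> w; rewrite ger0_norm ?expR_ge0 // -expR0 ler_expR oppr_le0 mulr_ge0.
have iX := ie _ (mX n) (X0 n); have iY := ie _ (mY n) (Y0 n).
have iA : P.-integrable setT (EFin \o (fun w => \1_A w : R)).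
  exact: Rintegrable_indic.
rewrite /Ex -RintegralB //; apply: (le_trans (le_normr_Rintegral _ _)) => //.
  exact: RintegrableB.
have expB (a b : R) : 0 <= a -> 0 <= b -> `|expR (- a) - expR (- b)| <= `|a - b|.
  have half (x y : R) : 0 <= x -> x <= y -> expR (- x) - expR (- y) <= y - x.
    move=> x0 xy; have -> : expR (- y) = expR (- x) * expR (- (y - x)).
      by rewrite -expRD; congr expR; ring.
    rewrite -[X in X - _]mulr1 -mulrBr.
    have h1 := expR_ge1Dx (- (y - x)).
    have h2 : expR (- x) <= 1 by rewrite -expR0 ler_expR oppr_le0.
    have h3 : expR (- (y - x)) <= 1 by rewrite -expR0 ler_expR oppr_le0 subr_ge0.
    apply: (@le_trans _ _ (1 - expR (- (y - x)))); last by lra.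
    by rewrite ler_piMl // subr_ge0.
  move=> a0 b0; have [ab|/ltW ba] := leP a b.
    rewrite ger0_norm ?subr_ge0 ?ler_expR ?lerN2 // distrC ger0_norm ?subr_ge0 //.
    exact: half.
  by rewrite distrC ger0_norm ?subr_ge0 ?ler_expR ?lerN2 // ger0_norm ?subr_ge0 // half.
apply: (@le_trans _ _ (\int[P]_w (e / 2 + \1_A w))).
  apply: le_Rintegral => //.
  - by apply: integrable_norm; exact: RintegrableB.
  - by apply: RintegrableD => //; exact: Rintegrable_cst.
  move=> w _; rewrite indicE; case: (boolP (w \in A)) => wA /=.
    have a1 (Z : T -> R) : 0 <= Z w -> 0 <= expR (- (l * Z w)) <= 1.
      by move=> Z0; rewrite expR_ge0 -expR0 ler_expR oppr_le0 mulr_ge0.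
    have /andP[? ?] := a1 _ (X0 n w); have /andP[? ?] := a1 _ (Y0 n w).
    by rewrite ler_norml; apply/andP; split; lra.
  rewrite addr0; apply: (le_trans (expB _ _ (mulr_ge0 l0 (X0 n w)) (mulr_ge0 l0 (Y0 n w)))).
  rewrite -mulrBr normrM (ger0_norm l0).
  have nA : ~ A w by move=> Aw; move: wA; rewrite mem_set.
  apply: (@le_trans _ _ ((l + 1) * (e / 2 / (l + 1)))).
    by apply: ler_pM => //; [rewrite lerDl|exact: hA].
  by rewrite mulrC divfK // gt_eqF // ltr_wpDl.
rewrite RintegralD //; last exact: Rintegrable_cst.
rewrite Rintegral_cst //= probability_setT mulr1.
rewrite Rintegral_indic //.
rewrite [leRHS]splitr lerD2l -lee_fin fineK // fin_num_measure //.
Qed.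

End in_probability.

(** * The effect of standardization *)

Section standardization.
Context d (T : measurableType d) (R : realType) (P : probability T R).
Variables (y : nat -> {RV P >-> R}) (z : nat -> T -> R) (Kz Ku : R).
Local Notation E := (Ex P).
Local Notation adapted := (adapted y).
Local Notation cvg0 := (cvg_prob0 P).
Local Notation bnd := (bounded_prob P).
Let u t w := z t w ^+ 2 - 1.
Hypothesis z_adapted : forall t, adapted t.+1 (z t).
Hypothesis z_mean : forall t X, adapted t X -> E (fun w => X w * z t w) = 0.
Hypothesis u_mean : forall t X, adapted t X -> E (fun w => X w * u t w) = 0.
Hypothesis z_moment : forall t, E (fun w => z t w ^+ 4) <= Kz.
Hypothesis u_moment : forall t, E (fun w => u t w ^+ 4) <= Ku.

Let s n : R := Num.sqrt n%:R.

Let s2 n : s n ^+ 2 = n%:R. Proof. by rewrite sqr_sqrtr. Qed.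

(** Each term has mean zero given the past, hence is orthogonal to the sum of the
    previous ones: second moments add up. *)
Lemma orthogonal_sum_L2 (a b : nat -> T -> R) c M N :
  (forall t, adapted (t + c) (a t)) -> (forall t, adapted t.+1 (b t)) ->
  (forall t X, adapted t X -> E (fun w => X w * b t w) = 0) ->
  (forall t, E (fun w => (a t w * b (t + c)%N w) ^+ 2) <= M) ->
  adapted (N + c) (fun w => \sum_(0 <= t < N) a t w * b (t + c)%N w) /\
  E (fun w => (\sum_(0 <= t < N) a t w * b (t + c)%N w) ^+ 2) <= N%:R * M.
Proof.
move=> aa ab b_mean abM; elim: N => [|N [aS ES]].
  have -> : (fun w => \sum_(0 <= t < 0) a t w * b (t + c)%N w) = (fun=> 0).
    by apply/funext => w; rewrite big_geq.
  split; first exact: adapted_cst.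
  have -> : (fun w => (\sum_(0 <= t < 0) a t w * b (t + c)%N w) ^+ 2) = (fun=> 0).
    by apply/funext => w; rewrite big_geq // expr0n.
  by rewrite mul0r Ex_cst.
pose S w := \sum_(0 <= t < N) a t w * b (t + c)%N w.
pose X w := a N w * b (N + c)%N w.
have -> : (fun w => \sum_(0 <= t < N.+1) a t w * b (t + c)%N w) = (fun w => S w + X w).
  by apply/funext => w; rewrite big_nat_recr.
have a1 Y : adapted (N + c) Y -> adapted (N.+1 + c) Y by apply: adapted_mono; rewrite leq_add2r.
have aX : adapted (N.+1 + c) X by apply: adaptedM; [exact: a1|exact: ab].
split; first by apply: adaptedD => //; exact: a1.
have aSa : adapted (N + c) (fun w => S w * a N w) by exact: adaptedM.
have aSX : adapted (N.+1 + c) (fun w => S w * a N w * b (N + c)%N w).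
  by apply: adaptedM; [exact: a1|exact: ab].
have aSS : adapted (N.+1 + c) (fun w => S w ^+ 2) by apply: adaptedX; exact: a1.
have -> : (fun w => (\sum_(0 <= t < N.+1) a t w * b (t + c)%N w) ^+ 2) =
    (fun w => S w ^+ 2 + 2 * (S w * a N w * b (N + c)%N w) + X w ^+ 2).
  by apply/funext => w; rewrite big_nat_recr //= -/(S w) /X; ring.
rewrite (ExD (adaptedD aSS (adaptedZ 2 aSX)) (adaptedX 2 aX)).
rewrite (ExD aSS (adaptedZ 2 aSX)) (ExZ 2 aSX) b_mean // mulr0 addr0.
by rewrite -(natr1 N) mulrDl mul1r; apply: lerD; [exact: ES|exact: abM].
Qed.

Lemma orthogonal_sum_bounded (a b : nat -> T -> R) c M (N : nat -> nat) :
  (forall t, adapted (t + c) (a t)) -> (forall t, adapted t.+1 (b t)) ->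
  (forall t X, adapted t X -> E (fun w => X w * b t w) = 0) ->
  (forall t, E (fun w => (a t w * b (t + c)%N w) ^+ 2) <= M) ->
  (forall n, (N n <= n)%N) ->
  bnd (fun n w => (s n)^-1 * \sum_(0 <= t < N n) a t w * b (t + c)%N w).
Proof.
move=> aa ab b_mean abM Nn.
have H n := orthogonal_sum_L2 (N n) aa ab b_mean abM.
have aX n : adapted (N n + c) (fun w => (s n)^-1 * \sum_(0 <= t < N n) a t w * b (t + c)%N w).
  by apply: adaptedZ; have [] := H n.
have M0 : 0 <= M by apply: le_trans (abM 0%N); apply: Ex_ge0 => w; exact: sqr_ge0.
apply: (@bounded_prob_L2 _ _ _ _ _ M) => n.
- exact: adapted_measurable (aX n).
- exact: adapted_integrable (adaptedX 2 (aX n)).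
have [aS ES] := H n.
have -> : (fun w => ((s n)^-1 * \sum_(0 <= t < N n) a t w * b (t + c)%N w) ^+ 2) =
    (fun w => (s n)^-1 ^+ 2 * (\sum_(0 <= t < N n) a t w * b (t + c)%N w) ^+ 2).
  by apply/funext => w; rewrite exprMn.
rewrite (ExZ _ (adaptedX 2 aS)) exprVn s2.
have [->|n0] := eqVneq n 0%N; first by rewrite invr0 mul0r.
have n0' : 0 < n%:R :> R by rewrite ltr0n lt0n.
rewrite ler_pdivrMl //; apply: (le_trans ES).
by rewrite ler_wpM2r // ler_nat.
Qed.

(** For the boundary terms: a bounded number of summands, divided by sqrt n. *)
Lemma edge_cvg0 (X : nat -> T -> R) (j : nat -> nat) M :
  (forall n, adapted (j n) (X n)) -> (forall n, E (fun w => X n w ^+ 2) <= M) ->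
  cvg0 (fun n w => (s n)^-1 * X n w).
Proof.
move=> aX XM; apply: cvg_prob0M; first by apply: cvg_prob0_cst; exact: sqrtV_cvg0.
apply: (@bounded_prob_L2 _ _ _ _ _ M) => // n.
  exact: adapted_measurable (aX n).
exact: adapted_integrable (adaptedX 2 (aX n)).
Qed.

Let az t j : (t < j)%N -> adapted j (z t).
Proof. by move=> tj; exact: adapted_mono (z_adapted t). Qed.

Let au t j : (t < j)%N -> adapted j (u t).
Proof.
by move=> tj; apply: adaptedB; [apply: adaptedX; exact: az|exact: adapted_cst].
Qed.

Let M0 := Kz + Ku + 1.

Let prod_sqr_le j (X Y : T -> R) : adapted j X -> adapted j Y ->
  E (fun w => X w ^+ 4) <= M0 -> E (fun w => Y w ^+ 4) <= M0 ->
  E (fun w => (X w * Y w) ^+ 2) <= M0.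
Proof.
move=> aX aY EX EY.
apply: (@le_trans _ _ (E (fun w => 2^-1 * (X w ^+ 4 + Y w ^+ 4)))).
  apply: (@Ex_le _ _ _ _ y j); first by apply: adaptedX; exact: adaptedM.
    by apply: adaptedZ; apply: adaptedD; exact: adaptedX.
  move=> w; have := sqr_ge0 (X w ^+ 2 - Y w ^+ 2).
  by rewrite sqrrB -!exprM exprMn; lra.
rewrite (ExZ _ (adaptedD (adaptedX 4 aX) (adaptedX 4 aY))).
rewrite (ExD (adaptedX 4 aX) (adaptedX 4 aY)); lra.
Qed.

Let K0 : 0 <= Kz.
Proof. by apply: le_trans (z_moment 0); apply: Ex_ge0 => w; rewrite (exprM _ 2 2) sqr_ge0. Qed.
Let K1 : 0 <= Ku.
Proof. by apply: le_trans (u_moment 0); apply: Ex_ge0 => w; rewrite (exprM _ 2 2) sqr_ge0. Qed.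

Let z4 t : E (fun w => z t w ^+ 4) <= M0.
Proof. by apply: (le_trans (z_moment t)); rewrite /M0 -addrA lerDl addr_ge0. Qed.
Let u4 t : E (fun w => u t w ^+ 4) <= M0.
Proof. by apply: (le_trans (u_moment t)); rewrite /M0 addrAC lerDr addr_ge0. Qed.
Let one4 : E (fun=> 1 ^+ 4) <= M0.
Proof. by rewrite Ex_cst expr1n /M0 lerDr addr_ge0. Qed.

Variables (tau m : nat) (bessel : bool).
Hypothesis tau_lag : (0 < tau <= m)%N.

Let tau0 : (0 < tau)%N. Proof. by have /andP[] := tau_lag. Qed.
(* Normalized sum over the times that have a partner at lag tau. *)
Let G (f : nat -> T -> R) n w := (s n)^-1 * \sum_(0 <= t < n - tau) f t w.

Let G_bounded (a b : nat -> T -> R) : (forall t, adapted t.+1 (a t)) ->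
  (forall t, adapted t.+1 (b t)) ->
  (forall t X, adapted t X -> E (fun w => X w * b t w) = 0) ->
  (forall t, E (fun w => a t w ^+ 4) <= M0) -> (forall t, E (fun w => b t w ^+ 4) <= M0) ->
  bnd (G (fun t w => a t w * b (t + tau)%N w)).
Proof.
move=> aa ab bm a4 b4; apply: (@orthogonal_sum_bounded a b tau M0) => //.
- by move=> t; apply: adapted_mono (aa t); rewrite -addn1 leq_add2l.
- move=> t; apply: (@prod_sqr_le (t + tau).+1) => //.
  by apply: adapted_mono (aa t); rewrite ltnS leq_addr.
by move=> n; exact: leq_subr.
Qed.

Let Zn n w := (s n)^-1 * \sum_(0 <= t < n) z t w.
Let Un n w := (s n)^-1 * \sum_(0 <= t < n) u t w.

Let centered_sum_bounded (b : nat -> T -> R) (N : nat -> nat) : 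
  (forall t, adapted t.+1 (b t)) ->
  (forall t X, adapted t X -> E (fun w => X w * b t w) = 0) ->
  (forall t, E (fun w => b t w ^+ 4) <= M0) -> (forall n, (N n <= n)%N) ->
  bnd (fun n w => (s n)^-1 * \sum_(0 <= t < N n) b t w).
Proof.
move=> ab bm b4 Nn.
have H : bnd (fun n w => (s n)^-1 * \sum_(0 <= t < N n) (fun _ _ => 1) t w * b (t + 0)%N w).
  apply: (@orthogonal_sum_bounded (fun _ _ => 1) b 0 M0) => //.
    by move=> t; exact: adapted_cst.
  by move=> t; apply: (@prod_sqr_le (t + 0).+1) => //; exact: adapted_cst.
apply: bounded_prob_near H; apply: nearW => n w; congr (_ * _).
by apply: eq_bigr => t _; rewrite mul1r addn0.
Qed.

Let Zn_bounded : bnd Zn.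
Proof. by apply: centered_sum_bounded => // t; exact: az. Qed.

Let Un_bounded : bnd Un.
Proof. by apply: centered_sum_bounded => // t; exact: au. Qed.

Let Gz_bounded : bnd (G z).
Proof. by apply: (@centered_sum_bounded z (subn^~ tau)) => // n; exact: leq_subr. Qed.

Let Gu_bounded : bnd (G u).
Proof. by apply: (@centered_sum_bounded u (subn^~ tau)) => // [t|n]; [exact: au|exact: leq_subr]. Qed.

Let shift_bounded (b : nat -> T -> R) :
  (forall t, adapted t.+1 (b t)) ->
  (forall t X, adapted t X -> E (fun w => X w * b t w) = 0) ->
  (forall t, E (fun w => b t w ^+ 4) <= M0) ->
  bnd (G (fun t => b (t + tau)%N)).
Proof.
move=> ab bm b4.
have H : bnd (G (fun t w => (fun _ _ => 1) t w * b (t + tau)%N w)).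
  by apply: (@G_bounded (fun _ _ => 1) b) => // t; exact: adapted_cst.
apply: bounded_prob_near H; apply: nearW => n w; congr (_ * _).
by apply: eq_bigr => t _; rewrite mul1r.
Qed.

Let zbar n w := (s n)^-1 * Zn n w.

Let zbar_cvg0 : cvg0 zbar.
Proof. by apply: cvg_prob0M; [apply: cvg_prob0_cst; exact: sqrtV_cvg0|exact: Zn_bounded]. Qed.

Lemma sample_variance_expand n w : (bessel < n)%N ->
  sample_variance bessel n (z ^~ w) =
  n%:R / (n - bessel)%:R * (1 + (s n)^-1 * Un n w - zbar n w ^+ 2).
Proof.
move=> bn; have n0 : (0 < n)%N by exact: leq_ltn_trans bn.
have nn : n%:R != 0 :> R by rewrite pnatr_eq0 -lt0n.
have zE : sample_mean n (z ^~ w) = zbar n w.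
  by rewrite /zbar /Zn mulrA -expr2 exprVn s2 mulrC /sample_mean big_mkord.
rewrite /sample_variance zE mulrAC; congr (_ / _).
rewrite /Un mulrA -expr2 exprVn s2.
have -> : \sum_(t < n) (z t w - zbar n w) ^+ 2 =
    \sum_(0 <= t < n) (1 + u t w - 2 * zbar n w * z t w + zbar n w ^+ 2).
  by rewrite big_mkord; apply: eq_bigr => t _; rewrite /u; ring.
rewrite (sum_quadratic (u ^~ w) (z ^~ w)).
have -> : \sum_(0 <= t < n) z t w = n%:R * zbar n w.
  by rewrite -zE /sample_mean mulrC divfK // big_mkord.
by field.
Qed.

Let bes := bessel : nat.
(* The sample variance is 1 + ubar + rem, where ubar is the mean of the u_t: rem
   collects the effect of the divisor and the square of the sample mean. *)
Let rem n w := bes%:R / (n - bes)%:R * (1 + (s n)^-1 * Un n w - zbar n w ^+ 2) - zbar n w ^+ 2.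

Let invs_cvg0 : cvg0 (fun n _ => (s n)^-1).
Proof. by apply: cvg_prob0_cst; exact: sqrtV_cvg0. Qed.

Let s_neq0 n : (0 < n)%N -> s n != 0.
Proof. by move=> n0; rewrite sqrtr_eq0 -ltNge ltr0n. Qed.

Let cvg0_bnd X : cvg0 X -> bnd X. Proof. exact: cvg_prob0_bounded. Qed.

Let bnd1 : bnd (fun _ _ => 1). Proof. exact: bounded_prob_cst. Qed.

Let bndM X Y : bnd X -> bnd Y -> bnd (fun n w => X n w * Y n w).
Proof. exact: bounded_probM. Qed.

Let bndD X Y : bnd X -> bnd Y -> bnd (fun n w => X n w + Y n w).
Proof. exact: bounded_probD. Qed.

Let bndZ (c : R) X : bnd X -> bnd (fun n w => c * X n w).
Proof. by move=> bX; apply: bndM => //; exact: bounded_prob_cst. Qed.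

Let bndX X p : bnd X -> bnd (fun n w => X n w ^+ p).
Proof.
move=> bX; elim: p => [|p IH]; first exact: bnd1.
by apply: bounded_prob_near (bndM bX IH); apply: nearW => n w; rewrite exprS.
Qed.

Let srem_cvg0 : cvg0 (fun n w => s n * rem n w).
Proof.
have b0 : cvg0 (fun n _ => s n * (bes%:R / (n - bes)%:R)).
  apply: cvg_prob0_cst.
  apply: (@cvg_trans _ (((s n)^-1 * (bes%:R * (n%:R / (n - bes)%:R)) : R) @[n --> \oo])).
    apply: near_eq_cvg; apply: filterS2 (nbhs_infty_gt 0) (nbhs_infty_gt bes) => n n0 nb.
    have nb0 : (n - bes)%:R != 0 :> R by rewrite pnatr_eq0 subn_eq0 -ltnNge.
    by rewrite -(s2 n) expr2 mulrCA -!mulrA mulKf ?s_neq0 // mulrCA.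
  have e : (0 : R) * (bes%:R * 1) = 0 by rewrite mul0r.
  suff h : ((s n)^-1 * (bes%:R * (n%:R / (n - bes)%:R)) : R) @[n --> \oo] -->
    (0 * (bes%:R * 1) : R) by rewrite e in h.
  apply: cvgM; first exact: sqrtV_cvg0.
  by apply: cvgMl_tmp; exact: ratio_cvg.
have h1 : bnd (fun n w => 1 + ((s n)^-1 * Un n w + -1 * zbar n w ^+ 2)).
  apply: bndD => //; apply: bndD; first by apply: bndM => //; exact: cvg0_bnd.
  by apply: bndZ; apply: bndX; exact: cvg0_bnd.
have h2 : cvg0 (fun n w => zbar n w * Zn n w) by exact: cvg_prob0M.
apply: cvg_prob0_near (cvg_prob0D (cvg_prob0M b0 h1) (cvg_prob0Z (-1) h2)).
apply: filterS (nbhs_infty_gt 0) => n n0 w; rewrite /rem.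
have -> : Zn n w = s n * zbar n w by rewrite /zbar mulrA divff ?mul1r // s_neq0.
by ring.
Qed.

Let u' t := u (t + tau)%N.
Let z' t := z (t + tau)%N.
Let Tu := G u.
Let Tu' := G u'.
Let Tz := G z.
Let Tz' := G z'.
Let Tuu := G (fun t w => u t w * u (t + tau)%N w).
Let Tuz := G (fun t w => u t w * z (t + tau)%N w).
Let Tzu := G (fun t w => z t w * u (t + tau)%N w).
Let Tzz := G (fun t w => z t w * z (t + tau)%N w).

Let num n w := (n - tau)%:R^-1 * \sum_(0 <= t < n - tau)
  (z t w - zbar n w) ^+ 2 * (z (t + tau)%N w - zbar n w) ^+ 2.

Let v n w := 1 + (s n)^-1 * Un n w + rem n w.

Let k n : R := tau%:R * (n - tau)%:R^-1.

Let mult n w := (1 + k n) * (zbar n w * (Tu n w + Tu' n w)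
  - 2 * (1 + zbar n w ^+ 2) * (Tz n w + Tz' n w) - 2 * (Tuz n w + Tzu n w)
  + 4 * zbar n w * Tzz n w).

(** [num] is the average of the products of squares and [v] the sample variance.  The
    first line is the only one that survives in the limit, through [Tuu]; the
    differences [Tu - Un] and [Tu' - Un] show the cancellation of the linear terms of
    [num] with those of [v ^ 2]. *)
Lemma scaled_deviation_expand n w : (tau < n)%N ->
  s n * (num n w - v n w ^+ 2) =
  Tuu n w + k n * (Tuu n w + Tu n w + Tu' n w) + zbar n w * mult n w
  + (Tu n w - Un n w) + (Tu' n w - Un n w)
  + zbar n w * (Zn n w * (2 + zbar n w ^+ 2))
  - (s n)^-1 * (Un n w + s n * rem n w) ^+ 2 - 2 * (s n * rem n w).
Proof.
move=> tn; have n0 : (0 < n)%N by exact: leq_ltn_trans tn.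
have s0 := s_neq0 n0.
have N0 : (n - tau)%:R != 0 :> R by rewrite pnatr_eq0 subn_eq0 -ltnNge.
have nE : s n ^+ 2 = (n - tau)%:R + tau%:R by rewrite s2 -natrD subnK // ltnW.
have GE f : \sum_(0 <= t < n - tau) f t w = s n * G f n w.
  by rewrite /G mulVKf.
have ZE : Zn n w = s n * zbar n w by rewrite /zbar mulVKf.
have -> : num n w = (n - tau)%:R^-1 * \sum_(0 <= t < n - tau)
    (1 + u t w - 2 * zbar n w * z t w + zbar n w ^+ 2) *
    (1 + u' t w - 2 * zbar n w * z' t w + zbar n w ^+ 2).
  by congr (_ * _); apply: eq_bigr => t _; rewrite /u' /z' /u; congr (_ * _); ring.
rewrite (sum_quadratic_prod (u ^~ w) (z ^~ w) (u' ^~ w) (z' ^~ w)).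
rewrite !GE -/Tu -/Tu' -/Tz -/Tz'.
rewrite (GE (fun t w => u t w * u' t w)) (GE (fun t w => u t w * z' t w)).
rewrite (GE (fun t w => z t w * u' t w)) (GE (fun t w => z t w * z' t w)).
rewrite -/Tuu -/Tuz -/Tzu -/Tzz /mult /v ZE.
rewrite /k.
move: (Tuu n w) (Tuz n w) (Tzu n w) (Tzz n w) (Tu n w) (Tu' n w) (Tz n w) (Tz' n w)
  (zbar n w) (Un n w) (rem n w) => a1 a2 a3 a4 a5 a6 a7 a8 zb U r.
move: N0 nE; move: (n - tau)%:R tau%:R s0 => N t; move: (s n) => S S0 N0 NE.
have -> : t = S ^+ 2 - N by rewrite NE addrAC subrr add0r.
by field; rewrite N0 S0.
Qed.

Let u_sqr t : E (fun w => u t w ^+ 2) <= M0.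
Proof.
have -> : (fun w => u t w ^+ 2) = (fun w => (u t w * 1) ^+ 2).
  by apply/funext => w; rewrite mulr1.
by apply: (@prod_sqr_le t.+1) => //; [exact: au|exact: adapted_cst].
Qed.

Let fixed_edge (X : T -> R) j : adapted j X -> cvg0 (fun n w => (s n)^-1 * X w).
Proof.
move=> aX; apply: (@edge_cvg0 (fun _ => X) (fun _ => j) (E (fun w => X w ^+ 2))) => // n.
Qed.

Let edge_right : cvg0 (fun n w => Tu n w - Un n w).
Proof.
have H : cvg0 (fun n w => \sum_(i <- iota 0 tau) (s n)^-1 * u (n - tau + i)%N w).
  apply: cvg_prob0_sum => i _.
  apply: (@edge_cvg0 (fun n => u (n - tau + i)%N) (fun n => (n - tau + i).+1) M0).
    by move=> n; exact: au.
  by move=> n; exact: u_sqr.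
apply: cvg_prob0_near (cvg_prob0Z (-1) H); apply: filterS (nbhs_infty_gt tau) => n tn w.
rewrite /Tu /Un /G -mulrBr (@big_cat_nat _ _ _ (n - tau)%N 0%N n) //= ?leq_subr //.
rewrite opprD addrA subrr sub0r mulrN mulN1r -mulr_sumr; congr (- (_ * _)).
rewrite big_shift subKn ?(ltnW tn) // /index_iota subn0.
by apply: eq_bigr => i _; rewrite addnC.
Qed.

Let edge_left : cvg0 (fun n w => Tu' n w - Un n w).
Proof.
have a : adapted tau (fun w => \sum_(0 <= t < tau) u t w).
  apply: adapted_sum => i; rewrite mem_index_iota => /andP[_ it] _; exact: au.
apply: cvg_prob0_near (cvg_prob0Z (-1) (fixed_edge a)).
apply: filterS (nbhs_infty_gt tau) => n tn w.
rewrite /Tu' /Un /G -mulrBr (@big_cat_nat _ _ _ tau 0%N n) //= ?(ltnW tn) //.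
rewrite (big_shift _ tau) /u' opprD addrCA subrr addr0 mulrN mulN1r //.
Qed.

(* The sums of the limit theorem start at time m for all lags simultaneously. *)
Let edge_pair : cvg0 (fun n w => Tuu n w
  - (s n)^-1 * \sum_(0 <= i < n - m) u (i + m)%N w * u (i + m - tau)%N w).
Proof.
have a : adapted m (fun w => \sum_(0 <= t < m - tau) u t w * u (t + tau)%N w).
  apply: adapted_sum => i; rewrite mem_index_iota => /andP[_ it] _.
  by apply: adaptedM; apply: au; lia.
apply: cvg_prob0_near (fixed_edge a).
apply: filterS (nbhs_infty_gt m) => n mn w.
rewrite /Tuu /G -mulrBr (@big_cat_nat _ _ _ (m - tau)%N 0%N (n - tau)%N) //=; last by lia.
rewrite (big_shift _ (m - tau)).
have -> : (n - tau - (m - tau) = n - m)%N by lia.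
set B := (X in _ + X - _); set C := (X in _ - X).
have -> : B = C.
  by apply: eq_bigr => i _; rewrite mulrC; congr (u _ w * u _ w); lia.
by rewrite addrK.
Qed.

Let k_cvg0 : cvg0 (fun n _ => k n).
Proof.
apply: cvg_prob0_cst.
have h : (n%:R / (n - tau)%:R - 1 : R) @[n --> \oo] --> (1 - 1 : R).
  by apply: cvgB; [exact: ratio_cvg|exact: cvg_cst].
rewrite subrr in h; apply: cvg_trans h; apply: near_eq_cvg.
apply: filterS (nbhs_infty_gt tau) => n tn.
have N0 : (n - tau)%:R != 0 :> R by rewrite pnatr_eq0 subn_eq0 -ltnNge.
have nE : n%:R = (n - tau)%:R + tau%:R :> R by rewrite -natrD subnK // ltnW.
by rewrite /k [in LHS]nE mulrDl divff // addrAC subrr add0r.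
Qed.

Let mult_bounded : bnd mult.
Proof.
have zb : bnd zbar by exact: cvg0_bnd.
have tz : bnd Tz' by exact: shift_bounded.
have tu : bnd Tu' by apply: shift_bounded => // t; exact: au.
have tuu : bnd Tuu by apply: G_bounded => // t; exact: au.
have tuz : bnd Tuz by apply: G_bounded => // t; exact: au.
have tzu : bnd Tzu by apply: G_bounded => // t; exact: au.
have tzz : bnd Tzz by apply: G_bounded.
have kb : bnd (fun n _ => k n) by exact: cvg0_bnd.
have h : bnd (fun n w => (1 + k n) * (zbar n w * (Tu n w + Tu' n w)
  + -2 * ((1 + zbar n w ^+ 2) * (Tz n w + Tz' n w)) + -2 * (Tuz n w + Tzu n w)
  + 4 * (zbar n w * Tzz n w))).
  apply: bndM; first exact: bndD.
  apply: bndD; last by apply: bndZ; exact: bndM.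
  apply: bndD; last by apply: bndZ; exact: bndD.
  apply: bndD; first by apply: bndM => //; exact: bndD.
  apply: bndZ; apply: bndM; last exact: bndD.
  by apply: bndD => //; exact: bndX.
by apply: bounded_prob_near h; apply: nearW => n w; rewrite /mult; ring.
Qed.

Let S n w := (2 * s n)^-1 * \sum_(0 <= i < n - m) u (i + m)%N w * u (i + m - tau)%N w.

Let dev n w := s n * (num n w - v n w ^+ 2).

Let dev_cvg0 : cvg0 (fun n w => dev n w - 2 * S n w).
Proof.
have zb : bnd zbar by exact: cvg0_bnd.
have tu : bnd Tu' by apply: shift_bounded => // t; exact: au.
have tuu : bnd Tuu by apply: G_bounded => // t; exact: au.
have h1 : cvg0 (fun n w => k n * (Tuu n w + Tu n w + Tu' n w)).
  by apply: cvg_prob0M => //; apply: bndD => //; exact: bndD.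
have h2 : cvg0 (fun n w => zbar n w * mult n w) by exact: cvg_prob0M.
have h3 : cvg0 (fun n w => zbar n w * (Zn n w * (2 + zbar n w ^+ 2))).
  apply: cvg_prob0M => //; apply: bndM => //; apply: bndD; last exact: bndX.
  exact: bounded_prob_cst.
have h4 : cvg0 (fun n w => (s n)^-1 * (Un n w + s n * rem n w) ^+ 2).
  by apply: cvg_prob0M => //; apply: bndX; apply: bndD => //; exact: cvg0_bnd.
have H := cvg_prob0D (cvg_prob0D (cvg_prob0D (cvg_prob0D (cvg_prob0D (cvg_prob0D
  (cvg_prob0D edge_pair h1) h2) edge_right) edge_left) h3) (cvg_prob0Z (-1) h4))
  (cvg_prob0Z (-2) srem_cvg0).
apply: cvg_prob0_near H; apply: filterS (nbhs_infty_gt tau) => n tn w.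
rewrite /dev scaled_deviation_expand // /S.
have -> : (2 * s n)^-1 = 2^-1 * (s n)^-1 by rewrite invfM.
set e := \sum_(_ <= _ < _) _.
move: (mult n w) => b; by field; rewrite s_neq0 //; lia.
Qed.

Let v_cvg : cvg0 (fun n w => v n w - 1).
Proof.
have h : cvg0 (fun n w => (s n)^-1 * (Un n w + s n * rem n w)).
  by apply: cvg_prob0M => //; apply: bndD => //; exact: cvg0_bnd.
apply: cvg_prob0_near h; apply: filterS (nbhs_infty_gt 0) => n n0 w.
by rewrite mulrDr mulKf ?s_neq0 // /v; ring.
Qed.

Let S_bounded : bnd S.
Proof.
have tuu : bnd Tuu by apply: G_bounded => // t; exact: au.
have h : bnd (fun n w => 2^-1 * (Tuu n w + -1 * (Tuu n w
  - (s n)^-1 * \sum_(0 <= i < n - m) u (i + m)%N w * u (i + m - tau)%N w))).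
  by apply: bndZ; apply: bndD => //; apply: bndZ; exact: cvg0_bnd.
apply: bounded_prob_near h; apply: nearW => n w.
by rewrite /S invfM -mulrA; ring.
Qed.

(** The summand is (S + del)^2 / v^4, where half of the deviation s (num - v^2) is
    S + del with del tending to 0, and v tends to 1. *)
Lemma lag_summand_approx : cvg0 (fun n w =>
  n%:R / 4 * ((\sum_(t < n - tau) standardize bessel n (z ^~ w) t ^+ 2 *
     standardize bessel n (z ^~ w) (t + tau)%N ^+ 2 / (n - tau)%:R) - 1) ^+ 2
  - S n w ^+ 2).
Proof.
pose del n w := 2^-1 * (dev n w - 2 * S n w).
have del0 : cvg0 del by exact: cvg_prob0Z.
have f0 : ((1 + x) ^+ 4)^-1 - 1 @[x --> (0 : R)] --> (0 : R).
  have h1 : (1 + x : R) @[x --> (0 : R)] --> (1 + 0 : R).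
    by apply: cvgD; [exact: cvg_cst|exact: cvg_id].
  have h4 : ((1 + x) ^+ 4 : R) @[x --> (0 : R)] --> ((1 + 0) ^+ 4 : R).
    exact: (cvgM h1 (cvgM h1 (cvgM h1 h1))).
  have h : (((1 + x) ^+ 4)^-1 - 1 : R) @[x --> (0 : R)] --> (((1 + 0) ^+ 4)^-1 - 1 : R).
    apply: cvgB; last exact: cvg_cst.
    by apply: cvgV => //; rewrite addr0 expr1n oner_neq0.
  by rewrite addr0 expr1n invr1 subrr in h.
have h1 := cvg_prob0_continuous f0 v_cvg.
have bdel := cvg0_bnd del0.
have h2 : cvg0 (fun n w => (((1 + (v n w - 1)) ^+ 4)^-1 - 1) * (S n w + del n w) ^+ 2
  + del n w * (2 * S n w + del n w)).
  apply: cvg_prob0D; apply: cvg_prob0M => //; first by apply: bndX; exact: bndD.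
  by apply: bndD => //; exact: bndZ.
(* On the event |v - 1| <= 1/2 the variance is non-zero, so that the quotient can be
   simplified. *)
have half : 0 < (2^-1 : R) by [].
apply: (cvg_prob0_ext (v_cvg half)) h2.
apply: filterS2 (nbhs_infty_gt tau) (nbhs_infty_gt bessel) => n tn bn w vn.
have v0 : v n w != 0.
  by apply: contraTneq vn => ->; rewrite sub0r normrN normr1 -ltNge invf_lt1 // ltr1n.
have n0 : (0 < n)%N by exact: leq_ltn_trans tn.
have N0 : (n - tau)%:R != 0 :> R by rewrite pnatr_eq0 subn_eq0 -ltnNge.
have zE : sample_mean n (z ^~ w) = zbar n w.
  by rewrite /zbar /Zn mulrA -expr2 exprVn s2 mulrC /sample_mean big_mkord.
have vE : sample_variance bessel n (z ^~ w) = v n w.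
  rewrite sample_variance_expand // /v /rem /bes.
  have b0 : (n - bessel)%:R != 0 :> R by rewrite pnatr_eq0 subn_eq0 -ltnNge.
  have -> : n%:R = (n - bessel)%:R + bessel%:R :> R by rewrite -natrD subnK // ltnW.
  by rewrite mulrDl divff //; ring.
have vge : 0 <= v n w.
  by rewrite -vE divr_ge0 //; apply: sumr_ge0 => i _; exact: sqr_ge0.
have numE : \sum_(t < n - tau) standardize bessel n (z ^~ w) t ^+ 2 *
     standardize bessel n (z ^~ w) (t + tau)%N ^+ 2 / (n - tau)%:R =
     num n w / v n w ^+ 2.
  rewrite /num big_mkord -mulr_suml mulrC -mulrA; congr (_ * _).
  rewrite mulr_suml; apply: eq_bigr => t _; rewrite /standardize vE zE.
  by rewrite !expr_div_n sqr_sqrtr // mulrACA -invfM.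
have -> : 1 + (v n w - 1) = v n w by ring.
rewrite numE -(s2 n) /del /dev.
move: v0; move: (v n w) => V v0; by move: (num n w) (S n w) (s n) => a b c; field.
Unshelve. all: by end_near. Qed.

End standardization.

(** * The limit law *)

Lemma standardize_affine (R : realType) (bessel : bool) n (y : nat -> R) (m s : R) t :
  0 < s -> (0 < n)%N ->
  standardize bessel n (fun t => (y t - m) / s) t = standardize bessel n y t.
Proof.
move=> s0 n0; have nn : n%:R != 0 :> R by rewrite pnatr_eq0 -lt0n.
have mE : sample_mean n (fun t => (y t - m) / s) = (sample_mean n y - m) / s.
  rewrite /sample_mean -mulr_suml sumrB sumr_const card_ord -(mulr_natr m n).
  by rewrite mulrAC mulrBl mulfK.
have dE i : (y i - m) / s - sample_mean n (fun t => (y t - m) / s) =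
    s^-1 * (y i - sample_mean n y).
  by rewrite mE -mulrBl opprB addrA subrK mulrC.
rewrite /standardize dE.
have -> : sample_variance bessel n (fun t => (y t - m) / s) =
    s ^- 2 * sample_variance bessel n y.
  rewrite /sample_variance mulrA mulr_sumr; congr (_ / _).
  by apply: eq_bigr => i _; rewrite dE exprMn exprVn.
rewrite sqrtrM ?invr_ge0 ?sqr_ge0 // sqrtrV ?sqr_ge0 // sqrtr_sqr gtr0_norm //.
by rewrite invfM invrK mulrACA mulVf ?gt_eqF // mul1r.
Qed.

Section limit_law.
Context d (T : measurableType d) (R : realType) (P : probability T R).
Variables (y : nat -> {RV P >-> R}) (mu sigma : R).
Hypothesis sigma0 : 0 < sigma.
Hypothesis y_indep : mutually_independent y.
Hypothesis y_normal : forall t A, measurable A ->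
  distribution P (y t) A = normal_prob mu sigma A.
Local Notation E := (Ex P).
Local Notation adapted := (adapted y).

Let z t w : R := (y t w - mu) / sigma.
Let u t w := z t w ^+ 2 - 1.

Let std (x : R) := (x - mu) / sigma.

Let mstd : measurable_fun setT std.
Proof. by apply: measurable_funM => //; exact: measurable_funB. Qed.

Let z_moments t := gaussian_moments_fin sigma0 (y_normal t).

Let az t j : (t < j)%N -> adapted j (z t).
Proof. by move=> tj; apply: (adapted_obs tj mstd); exact: z_moments. Qed.

Let au t j : (t < j)%N -> adapted j (u t).
Proof.
by move=> tj; apply: adaptedB; [apply: adaptedX; exact: az|exact: adapted_cst].
Qed.

Let factor (f : R -> R) t X : measurable_fun setT f ->
  adapted t.+1 (fun w => f (y t w)) -> adapted t X ->
  E (fun w => X w * f (y t w)) = E X * E (fun w => f (y t w)).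
Proof. by move=> mf [_ iF] aX; exact: (Ex_past_obs y_indep). Qed.

Let z_mean t X : adapted t X -> E (fun w => X w * z t w) = 0.
Proof.
move=> aX; rewrite (@factor std) //; last exact: az.
by rewrite [X in _ * X](gaussian_mean sigma0 (y_normal t)) mulr0.
Qed.

Let Ez24 t : E (fun w => z t w ^+ 2) = 1 /\ E (fun w => z t w ^+ 4) = 3.
Proof. exact: (gaussian_moments24 sigma0 (y_normal t)). Qed.

Let u_mean t X : adapted t X -> E (fun w => X w * u t w) = 0.
Proof.
move=> aX; rewrite (@factor (fun x => std x ^+ 2 - 1)) //; last exact: au.
  have -> : E (fun w => u t w) = 0.
    rewrite (ExB (adaptedX 2 (az (ltnSn t))) (adapted_cst _ _ 1)).
    by rewrite (Ez24 t).1 Ex_cst subrr.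
  by rewrite mulr0.
by apply: measurable_funB => //; exact: measurable_funX.
Qed.

Let u_var t X : adapted t X -> E (fun w => X w * u t w ^+ 2) = 2 * E X.
Proof.
move=> aX; rewrite (@factor (fun x => (std x ^+ 2 - 1) ^+ 2)) //.
- have -> : E (fun w => u t w ^+ 2) = 2.
    have a := az (ltnSn t).
    have -> : (fun w => u t w ^+ 2) = (fun w => z t w ^+ 4 - 2 * z t w ^+ 2 + 1).
      by apply/funext => w; rewrite /u; ring.
    rewrite (ExD (adaptedB (adaptedX 4 a) (adaptedZ 2 (adaptedX 2 a))) (adapted_cst _ _ 1)).
    rewrite (ExB (adaptedX 4 a) (adaptedZ 2 (adaptedX 2 a))) (ExZ 2 (adaptedX 2 a)).
    by rewrite (Ez24 t).1 (Ez24 t).2 Ex_cst; lra.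
  by rewrite mulrC.
- by apply: measurable_funX; apply: measurable_funB => //; exact: measurable_funX.
- by apply: adaptedX; exact: au.
Qed.

Let same_law (f : R -> R) t : measurable_fun setT f -> (forall x, 0 <= f x) ->
  E (fun w => f (y t w)) = E (fun w => f (y 0%N w)).
Proof.
move=> mf f0; rewrite /Ex /Rintegral.
by rewrite !(ge0_integral_gaussian (y_normal _) mf).
Qed.

Let z_moment t : E (fun w => z t w ^+ 4) <= 3.
Proof. by rewrite (Ez24 t).2. Qed.

Let K p := E (fun w => `|u 0 w| ^+ p).

Let u_moment t p : E (fun w => `|u t w| ^+ p) <= K p.
Proof.
rewrite (@same_law (fun x => `|std x ^+ 2 - 1| ^+ p)) //.
apply: measurable_funX; apply: measurableT_comp => //.
by apply: measurable_funB => //; exact: measurable_funX.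
Qed.

Let u_moment4 t : E (fun w => u t w ^+ 4) <= K 4.
Proof.
apply: le_trans (u_moment t 4).
by under [X in _ <= E X]eq_fun do rewrite (exprM `|_| 2 2) real_normK ?num_real // -exprM.
Qed.

Variables (bessel : bool) (Tau : {fset nat}).
Hypothesis Tau0 : forall tau, tau \in Tau -> (0 < tau)%N.

Let m := \max_(tau <- Tau) tau.

Let lags tau : tau \in enum_fset Tau -> (0 < tau <= m)%N.
Proof. by move=> h; rewrite Tau0 //= /m (@leq_bigmax_seq _ _ _ id). Qed.

Let S tau n w := (2 * Num.sqrt n%:R)^-1 * \sum_(0 <= i < n - m) u (i + m)%N w * u (i + m - tau)%N w.

Let Q := vol_clustering_Q bessel Tau y.

Let stat_approx : cvg_prob0 P (fun n w => Q n w - \sum_(tau <- Tau) S tau n w ^+ 2).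
Proof.
have H := @cvg_prob0_sum _ _ _ P _ (enum_fset Tau) _ (fun tau h =>
  @lag_summand_approx _ _ _ P y z 3 (K 4) (fun t => az (ltnSn t)) z_mean u_mean z_moment u_moment4
  tau m bessel (lags h)).
apply: cvg_prob0_near H; exists 1%N => // n n0 w.
rewrite sumrB; congr (_ - _).
rewrite /Q /vol_clustering_Q /vol_clustering_stat mulr_sumr.
apply: eq_bigr => tau _; congr (_ * (_ - _) ^+ 2).
by apply: eq_bigr => t _; rewrite !standardize_affine.
Qed.

Let Q_ge0 n w : 0 <= Q n w.
Proof.
rewrite /Q /vol_clustering_Q /vol_clustering_stat mulr_ge0 ?divr_ge0 //.
by apply: sumr_ge0 => i _; exact: sqr_ge0.
Qed.

(** The limit theorem for the sums of squares carries over to Q because their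
    difference tends to 0 in probability. *)
Lemma laplace_cvg l : 0 <= l ->
  E (fun w => expR (- (l * Q n w))) @[n --> \oo] -->
  (Num.sqrt (1 + 2 * l))^-1 ^+ #|` Tau|.
Proof.
move=> l0; have clt := @lindeberg_clt _ _ _ P y u K (fun t => au (ltnSn t)) u_mean u_var u_moment
  (enum_fset Tau) m (fset_uniq Tau) lags l l0.
have mS n : measurable_fun setT (fun w => \sum_(tau <- Tau) S tau n w ^+ 2).
  apply: (@adapted_measurable _ _ _ P y n); apply: adapted_sum => tau _ _.
  apply: adaptedX; apply: adaptedZ; apply: adapted_sum => i; rewrite mem_index_iota => h _.
  have im : (i + m < n)%N by move: h; rewrite /= ltn_subRL addnC.
  by apply: adaptedM; apply: au => //; exact: leq_ltn_trans (leq_subr _ _) im.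
have pert := expRN_perturbation l0 (measurable_vol_clustering_Q bessel Tau y) mS Q_ge0
  (fun n w => sumr_ge0 _ (fun tau _ => sqr_ge0 (S tau n w))) stat_approx.
pose f n := E (fun w => expR (- (l * Q n w))).
pose g n := E (fun w => expR (- (l * \sum_(tau <- Tau) S tau n w ^+ 2))).
have h : (f n - g n + g n) @[n --> \oo] --> 0 + (Num.sqrt (1 + 2 * l))^-1 ^+ #|` Tau|.
  by apply: cvgD; [exact: pert|exact: clt].
by rewrite add0r in h; apply: cvg_trans h; apply: near_eq_cvg; apply: nearW => n; rewrite /= subrK.
Qed.

(** The moments of exp(-|x|) are Laplace transforms at natural numbers. *)
Lemma cvg_in_law_chi_squared :
  cvg_in_law (fun n => vol_clustering_Q bessel Tau y n : {RV P >-> R})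
    (chi_squared #|` Tau|).
Proof.
move=> r cr.
pose nu_ n : probability R R := distribution P (vol_clustering_Q bessel Tau y n : {RV P >-> R}).
have mom (j : nat) : (\int[nu_ n]_x (expR (- `|x|) ^+ j)) @[n --> \oo] -->
    \int[chi_squared (R := R) #|` Tau|]_x (expR (- `|x|) ^+ j).
  have l0 : (0 : R) <= j%:R by exact: ler0n.
  have UE (x : R) : expR (- `|x|) ^+ j = expR (- (j%:R * `|x|)).
    by rewrite -expRM_natl mulrN.
  have -> : \int[chi_squared (R := R) #|` Tau|]_x (expR (- `|x|) ^+ j) =
      (Num.sqrt (1 + 2 * j%:R))^-1 ^+ #|` Tau|.
    rewrite /Rintegral -[RHS]/(fine _%:E) -(chi_squared_laplace _ l0).
    by congr fine; apply: eq_integral => x _; rewrite UE.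
  apply: cvg_trans (laplace_cvg l0); apply: near_eq_cvg; apply: nearW => n.
  rewrite /Ex /Rintegral ge0_integral_distribution //; last first.
    apply/measurable_EFinP; apply: measurable_funX; apply: measurableT_comp => //.
    apply: measurableT_comp => //; exact: normr_measurable.
  congr fine; apply: eq_integral => w _ /=.
  by rewrite UE ger0_norm //; exact: Q_ge0.
have nu0 n : nu_ n `]-oo, 0[%classic = 0%E.
  rewrite /nu_ /distribution /pushforward /= -[RHS](measure0 P); congr (P _).
  by apply/seteqP; split => // w /=; rewrite in_itv /= ltNge Q_ge0.
have h := @moments_cvg_cdf _ nu_ (chi_squared #|` Tau|) mom nu0 (chi_squared_ge0 _) r cr.
exact: h.
Qed.
End limit_law.

Theorem theorem3 (R : realType) (d : measure_display) (T : measurableType d)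
    (P : probability T R) (y : nat -> {RV P >-> R}) (mu sigma : R)
    (bessel : bool) (Tau : {fset nat}) :
  (forall tau, tau \in Tau -> (0 < tau)%N) ->
  0 < sigma ->
  iid_gaussian mu sigma y ->
  cvg_in_law (fun n => vol_clustering_Q bessel Tau y n : {RV P >-> R})
    (chi_squared #|` Tau|).
Proof.
move=> Tau0 sigma0 [y_indep y_normal].
exact: (cvg_in_law_chi_squared sigma0 y_indep y_normal bessel Tau0).
Qed.
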